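(* Let $E$ be the graph with $E^0=\{v_n\mid n\in\mathbb{N}_0\}$ and $E^1=\{e_n\mid n\in\mathbb{N}_0\}\cup\{f_n\mid n\in\mathbb{N}_0\}$, where $s(e_n)=r(e_n)=v_n$, $s(f_n)=v_n$ and $r(f_n)=v_{n+1}$ for $n\in\mathbb{N}_0=\{0,1,2,\dots\}$. Consider the Toeplitz algebra $\mathcal{T}C^*(E)$ endowed with its gauge action. Then the KMS$_\beta$ states for $\beta\in[0,\infty)$ and the ground states of $\mathcal{T}C^*(E)$ (identified with the elements of $D^\beta$ and $D^{\mathrm{gr}}$, respectively) are given as follows: (1) if $\beta=0$, then $D^\beta$ consists of the single conservative function $m^0_{v_0}$; (2) if $\beta\in(0,\ln2)$, then $D^\beta$ is the convex hull of the disjoint sets $D^\beta_{\mathrm{fin}}$ and $D^\beta_{\mathrm{dis}}$, where $\{m^\beta_{v_n}\}_{n\in\mathbb{N}_0}$ are all the extreme points of $D^\beta_{\mathrm{fin}}$, and $D^\beta_{\mathrm{dis}}$ consists of the single dissipative function $m^\beta_{\mathrm{inf}}$; (3) if $\beta\ge\ln2$, then $D^\beta=D^\beta_{\mathrm{fin}}$, and the extremal KMS$_\beta$ states are $\{m^\beta_{v_n}\}_{n\in\mathbb{N}_0}$; (4) the extreme points of the set $D^{\mathrm{gr}}$ of ground states are $\{m^{\mathrm{gr}}_{v_n}\}_{n\in\mathbb{N}_0}$, where $m^{\mathrm{gr}}_{v}(v')=1$ if $v'=v$ and $0$ otherwise, and every ground state is a KMS$_\infty$ state.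
   Context: **Graphs.** For a directed graph $E=(E^0,E^1,s,r)$, a path of length $n\ge1$ is a sequence $e_1\cdots e_n$ of edges with $r(e_i)=s(e_{i+1})$; vertices are paths of length $0$. $E^*$ is the set of finite paths, $|u|$ the length of $u$, $s(u)=s(e_1)$, $r(u)=r(e_n)$, $s(v)=r(v)=v$ for $v\in E^0$; $E^\infty$ is the set of infinite paths and $E^{\le\infty}=E^*\cup E^\infty$. $vE^1=\{e\in E^1:s(e)=v\}$. $u'\le x$ means $u'$ is an initial segment of $x$ (the one of length $0$ is $s(x)$); $u'<x$ means $u'\le x$ and $u'\ne x$. $Z(u)=\{x\in E^{\le\infty}:u\le x\}$, and $E^{\le\infty}$ has the topology generated by all $Z(u)$, $u\in E^*$, and their complements. $E^\infty_{\mathrm{rec}}$ is the set of $x\in E^\infty$ such that for some $v\in E^0$ the set $\{u\in E^*:u<x,\ r(u)=v\}$ is infinite; $E^\infty_{\mathrm{wan}}=E^\infty\setminus E^\infty_{\mathrm{rec}}$. **Toeplitz algebra and dynamics.** $\mathcal{T}C^*(E)$ is the universal $C^*$-algebra generated by partial isometries $(s_e)_{e\in E^1}$ with mutually orthogonal range projections and mutually orthogonal projections $(p_v)_{v\in E^0}$ with $s_e^*s_e=p_{r(e)}$ and $s_es_e^*\le p_{s(e)}$ for all $e$. The dynamics given by the gauge action is $\sigma_t(s_e)=\exp(it)s_e$, $\sigma_t(p_v)=p_v$. For $\beta\in(0,\infty)$ a KMS$_\beta$ state is a state $\psi$ with $\psi(ab)=\psi(b\sigma_{i\beta}(a))$ for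 all analytic $a,b$ (elements for which $t\mapsto\sigma_t(a)$ extends to an entire function); a KMS$_0$ state is a $\sigma$-invariant tracial state; a ground state is a state $\psi$ such that for all analytic $a,b$ the function $z\mapsto\psi(a\sigma_z(b))$ is bounded on the upper half-plane; a ground state is a KMS$_\infty$ state if it is a weak* limit of a sequence of KMS$_{\beta_n}$ states with $\beta_n\to\infty$. **Identification.** Put $N(u)=\exp(|u|)$ for $u\in E^*$. $D^\beta$ is the set of functions $m:E^0\to[0,1]$ with $\sum_{v}m(v)=1$ and $m(v)\ge\sum_{e\in vE^1}\exp(-\beta)m(r(e))$ for all $v\in E^0$; $D^{\mathrm{gr}}$ is the set of functions $m:E^0\to[0,1]$ with $\sum_vm(v)=1$. The map $\psi\mapsto(v\mapsto\psi(p_v))$ is a convex isomorphism from the KMS$_\beta$ states onto $D^\beta$ and from the ground states onto $D^{\mathrm{gr}}$; states are identified with the corresponding functions. Each $m\in D^\beta$ has an associated measure: the unique regular Borel probability measure $\mu$ on $E^{\le\infty}$ with $\mu(Z(v))=m(v)$ for $v\in E^0$ and $\mu(\{ex:x\in A\})=\exp(-\beta)\mu(A)$ for $e\in E^1$ and Borel $A\subseteq Z(r(e))$. $m$ is of finite type ($m\in D^\beta_{\mathrm{fin}}$) if $\mu(E^* )=1$, conservative if $\mu(E^\infty_{\mathrm{rec}})=1$, dissipative ($m\in D^\beta_{\mathrm{dis}}$) if $\mu(E^\infty_{\mathrm{wan}})=1$. **The functions.** Let $E_a^*v=\{u\in E^*:r(u)=v,\ r(u')\ne v\text{ for any }u'<u\}$,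 $v'E_a^*v=\{u\in E_a^*v:s(u)=v'\}$, $Z_v^a(\beta)=\sum_{u\in E_a^*v}N(u)^{-\beta}$, and, when $Z_v^a(\beta)<\infty$, $m_v^\beta(v')=\sum_{u\in v'E_a^*v}N(u)^{-\beta}(Z_v^a(\beta))^{-1}$. For $\beta\in(0,\ln2)$ let $a=\exp(-\beta)/(1-\exp(-\beta))>1$ and $m^\beta_{\mathrm{inf}}(v_k)=a^{-(k+1)}(a-1)$ for $k\ge0$. *)

(* Defs.v *)
From HB Require Import structures.
From mathcomp Require Import all_boot all_order all_algebra.
From mathcomp Require Import complex.
From mathcomp Require Import all_classical all_reals all_analysis.

Set Implicit Arguments.
Unset Strict Implicit.
Unset Printing Implicit Defensive.

Import Order.TTheory GRing.Theory Num.Theory.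
Import numFieldNormedType.Exports.

Local Open Scope classical_set_scope.
Local Open Scope ring_scope.

(* The vertex set is pointed, i.e. nonempty, because measurable spaces are
   pointed in the library. *)
Record graph := Graph {
  vert : pointedType;
  edge : choiceType;
  src : edge -> vert;
  rng : edge -> vert }.

Section Paths.
Variable E : graph.

Fixpoint walk (v : vert E) (es : seq (edge E)) : bool :=
  if es is e :: es' then (src e == v) && walk (rng e) es' else true.

(* A finite path is stored with its source, so that (v, [::]) is the path of
   length 0 at v. *)
Record fpath := Fpath {
  fpval : vert E * seq (edge E);
  _ : walk fpval.1 fpval.2 }.

HB.instance Definition _ := [isSub for fpval].
HB.instance Definition _ := [Choice of fpath by <:].

Definition flen (u : fpath) : nat := size (fpval u).2.
Definition fsrc (u : fpath) : vert E := (fpval u).1.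
Definition frng (u : fpath) : vert E :=
  last (fpval u).1 [seq rng e | e <- (fpval u).2].
Definition fnil (v : vert E) : fpath := @Fpath (v, [::]) isT.
HB.instance Definition _ := isPointed.Build fpath (fnil point).

Record ipath := Ipath {
  iedge : nat -> edge E;
  _ : forall n, rng (iedge n) = src (iedge n.+1) }.

Definition isrc (x : ipath) : vert E := src (iedge x 0%N).

(* E^{<=oo} *)
Inductive pathspace := Fin of fpath | Inf of ipath.

HB.instance Definition _ := gen_eqMixin pathspace.
HB.instance Definition _ := gen_choiceMixin pathspace.
HB.instance Definition _ := isPointed.Build pathspace (Fin (fnil point)).

Definition xsrc (x : pathspace) : vert E :=
  match x with Fin u => fsrc u | Inf y => isrc y end.

Definition initial (u : fpath) (x : pathspace) : Prop :=
  fsrc u = xsrc x /\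
  match x with
  | Fin w => prefix (fpval u).2 (fpval w).2
  | Inf y => (fpval u).2 = [seq iedge y i | i <- iota 0 (flen u)]
  end.

Definition strict_initial (u : fpath) (x : pathspace) : Prop :=
  initial u x /\ Fin u <> x.

Definition cylinder (u : fpath) : set pathspace := [set x | initial u x].

(* The pair (u, true) indexes Z(u) and (u, false) its complement. *)
HB.instance Definition _ :=
  @isSubBaseTopological.Build pathspace (fpath * bool)%type setT
    (fun ub => if ub.2 then cylinder ub.1 else ~` cylinder ub.1).

Lemma fcons_subproof (e : edge E) (u : fpath) :
  fsrc u = rng e -> walk (src e) (e :: (fpval u).2).
Proof. by case: u => -[v es] /= wes <-; rewrite eqxx. Qed.

Definition fcons (e : edge E) (u : fpath) (h : fsrc u = rng e) : fpath :=
  @Fpath (src e, e :: (fpval u).2) (fcons_subproof h).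

Lemma icons_subproof (e : edge E) (y : ipath) : isrc y = rng e ->
  let f := fun n => if n is k.+1 then iedge y k else e in
  forall n, rng (f n) = src (f n.+1).
Proof. by case: y => f hf /= h [|n] //=; exact: esym h. Qed.

Definition icons (e : edge E) (y : ipath) (h : isrc y = rng e) : ipath :=
  Ipath (icons_subproof h).

Definition xcons (e : edge E) (x : pathspace) :
    xsrc x = rng e -> pathspace :=
  match x return xsrc x = rng e -> pathspace with
  | Fin u => fun h => Fin (fcons h)
  | Inf y => fun h => Inf (icons h)
  end.

(* {ex : x in A}, for A included in Z(r(e)) *)
Definition xcons_set (e : edge E) (A : set pathspace) : set pathspace :=
  [set y | exists x (h : xsrc x = rng e), A x /\ y = xcons h].

Definition finpaths : set pathspace := [set x | exists u, x = Fin u].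
Definition infpaths : set pathspace := [set x | exists y, x = Inf y].

Definition recpaths : set pathspace :=
  infpaths `&` [set x | exists v,
    infinite_set [set u : fpath | strict_initial u x /\ frng u = v]].

Definition wanpaths : set pathspace := infpaths `\` recpaths.

Definition borel_paths := g_sigma_algebraType (@open pathspace).

(* E_a^* v *)
Definition first_arrival (v : vert E) : set fpath :=
  [set u | frng u = v /\
     forall u', strict_initial u' (Fin u) -> frng u' <> v].

End Paths.

Section States.
Variables (R : realType) (E : graph).
Implicit Types (beta : R) (m : vert E -> R).

Definition Dgr : set (vert E -> R) :=
  [set m | (forall v, 0 <= m v <= 1) /\ \esum_(v in setT) (m v)%:E = 1%E].

Definition Dkms beta : set (vert E -> R) :=
  [set m | [/\ forall v, 0 <= m v <= 1,
               \esum_(v in setT) (m v)%:E = 1%E &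
               forall v, (\esum_(e in [set e | src e = v])
                  (expR (- beta) * m (rng e))%:E <= (m v)%:E)%E]].

Definition regular_measure (mu : probability (borel_paths E) R) : Prop :=
  forall A : set (borel_paths E), measurable A ->
    mu A = ereal_inf [set mu U | U in
             [set U | @open (pathspace E) U /\ A `<=` U]] /\
    mu A = ereal_sup [set mu K | K in
             [set K | @compact (pathspace E) K /\ K `<=` A]].

Definition assoc_measure beta m (mu : probability (borel_paths E) R) : Prop :=
  [/\ regular_measure mu,
      forall v, mu (cylinder (fnil v)) = (m v)%:E &
      forall (e : edge E) (A : set (borel_paths E)), measurable A ->
        A `<=` cylinder (fnil (rng e)) ->
        mu (xcons_set e A) = ((expR (- beta))%:E * mu A)%E].

Definition Dfin beta : set (vert E -> R) :=
  [set m | Dkms beta m /\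
     exists2 mu, assoc_measure beta m mu & mu (@finpaths E) = 1%E].

Definition Dcon beta : set (vert E -> R) :=
  [set m | Dkms beta m /\
     exists2 mu, assoc_measure beta m mu & mu (@recpaths E) = 1%E].

Definition Ddis beta : set (vert E -> R) :=
  [set m | Dkms beta m /\
     exists2 mu, assoc_measure beta m mu & mu (@wanpaths E) = 1%E].

Definition weight (u : fpath E) : R := expR (flen u)%:R.

Definition Za beta (v : vert E) : \bar R :=
  \esum_(u in first_arrival v) (weight u `^ (- beta))%:E.

(* When Za beta v = +oo the junk value is the zero function, which does not
   belong to Dkms beta. *)
Definition mkms beta (v v' : vert E) : R :=
  fine (\esum_(u in first_arrival v `&` [set u | fsrc u = v'])
          (weight u `^ (- beta))%:E) / fine (Za beta v).

Definition mgr (v v' : vert E) : R := (v' == v)%:R.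

End States.

Definition extreme (R : realType) (V : Type) (S : set (V -> R)) :
    set (V -> R) :=
  [set m | S m /\ forall (x y : V -> R) (t : R), S x -> S y -> 0 < t < 1 ->
     m = (fun v => t * x v + (1 - t) * y v) -> x = m /\ y = m].

Definition convex_hull (R : realType) (V : Type) (S : set (V -> R)) :
    set (V -> R) :=
  [set m | exists n (c : 'I_n -> R) (x : 'I_n -> V -> R),
     [/\ forall i, 0 <= c i, forall i, S (x i), \sum_i c i = 1 &
         m = (fun v => \sum_i c i * x i v)]].

(* Not necessarily unital; the norm takes its values in the nonnegative reals
   of R[i]. *)
Record cstarAlg (R : realType) := CstarAlg {
  cstar_car :> completeNormedModType R[i];
  cmul : cstar_car -> cstar_car -> cstar_car;
  cstar : cstar_car -> cstar_car;
  cmulA : associative cmul;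
  cmulDl : left_distributive cmul +%R;
  cmulDr : right_distributive cmul +%R;
  cscaleAl : forall (k : R[i]) x y, k *: cmul x y = cmul (k *: x) y;
  cscaleAr : forall (k : R[i]) x y, k *: cmul x y = cmul x (k *: y);
  cstarK : involutive cstar;
  cstarD : {morph cstar : x y / x + y};
  cstarZ : forall (k : R[i]) x, cstar (k *: x) = k^* *: cstar x;
  cstarM : forall x y, cstar (cmul x y) = cmul (cstar y) (cstar x);
  cnormM : forall x y, `|cmul x y| <= `|x| * `|y|;
  cnorm_star : forall x, `|cmul (cstar x) x| = `|x| ^+ 2 }.

Section CstarTheory.
Variable R : realType.
Implicit Types A B : cstarAlg R.

(* Contractivity is automatic for *-homomorphisms of C*-algebras. *)
Record star_hom A B (phi : A -> B) : Prop := StarHom {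
  star_homD : forall x y, phi (x + y) = phi x + phi y;
  star_homZ : forall (k : R[i]) x, phi (k *: x) = k *: phi x;
  star_homM : forall x y, phi (cmul x y) = cmul (phi x) (phi y);
  star_hom_star : forall x, phi (cstar x) = cstar (phi x);
  star_hom_norm : forall x, `|phi x| <= `|x| }.

(* For projections p and q, q <= p means p q = q. *)
Record toeplitz_family (E : graph) B (s : edge E -> B) (p : vert E -> B) :
    Prop := ToeplitzFamily {
  vproj_star : forall v, cstar (p v) = p v;
  vproj_idem : forall v, cmul (p v) (p v) = p v;
  vproj_orth : forall v w, v <> w -> cmul (p v) (p w) = 0;
  eiso_partial : forall e, cmul (cmul (s e) (cstar (s e))) (s e) = s e;
  eiso_orth : forall e f, e <> f ->
    cmul (cmul (s e) (cstar (s e))) (cmul (s f) (cstar (s f))) = 0;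
  eiso_source : forall e, cmul (cstar (s e)) (s e) = p (rng e);
  eiso_range : forall e, cmul (p (src e)) (cmul (s e) (cstar (s e))) =
                         cmul (s e) (cstar (s e)) }.

Record closed_star_subalgebra B (S : set B) : Prop := ClosedStarSubalgebra {
  css_closed : closed S;
  css0 : S 0;
  cssD : forall x y, S x -> S y -> S (x + y);
  cssZ : forall (k : R[i]) x, S x -> S (k *: x);
  cssM : forall x y, S x -> S y -> S (cmul x y);
  css_star : forall x, S x -> S (cstar x) }.

Record toeplitz_algebra (E : graph) A (s : edge E -> A) (p : vert E -> A) :
    Prop := ToeplitzAlgebra {
  toeplitz_rel : toeplitz_family s p;
  toeplitz_gen : forall S : set A, closed_star_subalgebra S ->
    (forall e, S (s e)) -> (forall v, S (p v)) -> S = setT;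
  toeplitz_univ : forall (B : cstarAlg R) (s' : edge E -> B)
    (p' : vert E -> B), toeplitz_family s' p' ->
    exists phi : A -> B, [/\ star_hom phi, forall e, phi (s e) = s' e &
                             forall v, phi (p v) = p' v] }.

(* By toeplitz_gen these conditions determine sigma. *)
Record gauge_dynamics (E : graph) A (s : edge E -> A) (p : vert E -> A)
    (sigma : R -> A -> A) : Prop := GaugeDynamics {
  gauge_hom : forall t, star_hom (sigma t);
  gauge_edge : forall t e, sigma t (s e) = (cos t +i* sin t)%C *: s e;
  gauge_vert : forall t v, sigma t (p v) = p v }.

Definition is_state A (psi : {scalar A}) : Prop :=
  [/\ forall a, 0 <= psi (cmul (cstar a) a),
      forall a, `|psi a| <= `|a| &
      forall eps : R, 0 < eps ->
        exists2 a : A, `|a| <= 1 & (1 - eps)%:C%C < `|psi a| ].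

(* Entire functions are the sums of everywhere convergent power series. *)
Definition entire A (F : R[i] -> A) : Prop :=
  exists c : nat -> A, forall z : R[i],
    series (fun k => z ^+ k *: c k) @ \oo --> F z.

(* F z plays the role of sigma_z(a). *)
Definition analytic_extension A (sigma : R -> A -> A) (a : A)
    (F : R[i] -> A) : Prop :=
  entire F /\ forall t : R, F t%:C%C = sigma t a.

Definition analytic_elt A (sigma : R -> A -> A) (a : A) : Prop :=
  exists F, analytic_extension sigma a F.

Definition kms_state A (sigma : R -> A -> A) (beta : R) (psi : {scalar A}) :
    Prop :=
  is_state psi /\
  if beta == 0 then
    (forall a b, psi (cmul a b) = psi (cmul b a)) /\
    (forall t a, psi (sigma t a) = psi a)
  else
    forall a b (F : R[i] -> A),
      analytic_extension sigma a F -> analytic_elt sigma b ->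
      psi (cmul a b) = psi (cmul b (F (0 +i* beta)%C)).

Definition ground_state A (sigma : R -> A -> A) (psi : {scalar A}) : Prop :=
  is_state psi /\
  forall a b (F : R[i] -> A),
    analytic_elt sigma a -> analytic_extension sigma b F ->
    exists M : R, forall x y : R, 0 < y ->
      `|psi (cmul a (F (x +i* y)%C))| <= M%:C%C.

Definition kms_infty_state A (sigma : R -> A -> A) (psi : {scalar A}) :
    Prop :=
  ground_state sigma psi /\
  exists (beta : nat -> R) (psi_ : nat -> {scalar A}),
    [/\ forall n, 0 <= beta n,
        beta n @[n --> \oo] --> +oo,
        forall n, kms_state sigma (beta n) (psi_ n) &
        forall a : A,
          psi_ n a @[n --> \oo] --> psi a].

End CstarTheory.

(* e_n is [inl n] and f_n is [inr n]; the vertex v_n is n. *)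
Definition loop_ray : graph :=
  @Graph nat (nat + nat)%type
    (fun x => match x with inl n => n | inr n => n end)
    (fun x => match x with inl n => n | inr n => n.+1 end).

Definition minf (R : realType) (beta : R) (k : vert loop_ray) : R :=
  let a := expR (- beta) / (1 - expR (- beta)) in a ^- k.+1 * (a - 1).

(* Main.v *)
From HB Require Import structures.
Require Import Defs.
From mathcomp Require Import all_boot all_order all_algebra.
From mathcomp Require Import complex finmap.
From mathcomp Require Import all_classical all_reals all_analysis.
From mathcomp Require Import measurable_realfun.
From mathcomp Require Import ring lra.

Set Implicit Arguments.
Unset Strict Implicit.
Unset Printing Implicit Defensive.

Import Order.TTheory GRing.Theory Num.Theory.
Import numFieldNormedType.Exports.

Local Open Scope classical_set_scope.
Local Open Scope ring_scope.

(* Put q = exp (- beta).  An element of D^beta is a probability m on the vertices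
   with q (m k + m k.+1) <= m k, i.e. superharmonic for the operator [step].  Its
   Riesz decomposition is a potential plus a harmonic function; harmonic functions
   are geometric of ratio (1 - q) / q, hence summable only if q > 1/2, and the
   potentials are the mixtures of the potentials of point masses, which are the
   m_v^beta.  Potentials correspond to the measures carried by the finite paths: the
   mass of the paths from k of length at least J is the J-th iterate of [step] on m.
   Conversely a potential gives an atomic measure on the finite paths, and the
   harmonic function gives the image of Lebesgue measure under an expansion in
   independent digits.

   A ground state psi kills every x s_e^* and s_e x.  For large beta the sum over
   all paths u of exp (- beta |u|) psi (s_u^* x s_u), normalised, is a KMS_beta state
   within O (exp (- beta)) of psi. *)

(** Finite type and dissipativity are conditions on a measure that must be regular. Regularity holds
    for every Borel probability here: each vertex emits exactly two edges, so finite paths are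
    isolated, the sets Z(u) and {u} form a countable clopen base, and each Z(v) is compact. Vertex
    indices never decrease along a path, so there are only countably many recurrent paths; for beta
    > 0 each of them is null. For ground states the obstacles are that no unit is at hand and that a
    sum over infinitely many edges must converge. Both are met by the sharp bound |f (P x P)| <= f
    (P) |x| for a positive functional f and a projection P. Each vertex receives at most two edges,
    so one summation over edges at most doubles the norm, and the sum over paths converges once 2
    exp (- beta) < 1. The KMS relation is first proved on monomials; it reaches arbitrary analytic
    elements by comparing coefficients of power series on the real line. *)

Lemma eq_cvg_seq (V : topologicalType) (u v : nat -> V) (l : V) :
  u =1 v -> u @ \oo --> l -> v @ \oo --> l.
Proof. by move=> /funext ->. Qed.

(** * Superharmonic functions and their Riesz decomposition *)

Section Superharmonic.
Variable R : realType.
Implicit Types (m x y h d : nat -> R).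
Variable q : R.
Hypotheses (q0 : 0 < q) (q1 : q < 1).

(* With q = exp (- beta), the superharmonic probabilities of this operator are
   the elements of D^beta. *)
Definition step m : nat -> R := fun k => q * (m k + m k.+1).

Definition kmsd m : Prop :=
  [/\ forall k, 0 <= m k, series m @ \oo --> (1 : R) & forall k, step m k <= m k].

(** The decreasing limit of the iterates is the harmonic part in the Riesz decomposition, so among
    nonnegative superharmonic functions these are the potentials. *)
Definition transient m : Prop := forall k, iter J step m k @[J --> \oo] --> (0 : R).

Lemma step_mono m m' : (forall k, m k <= m' k) -> forall k, step m k <= step m' k.
Proof. by move=> h k; rewrite /step ler_pM2l // lerD. Qed.

Lemma stepD m m' : step (fun k => m k + m' k) = (fun k => step m k + step m' k).
Proof. by apply/funext => k; rewrite /step; ring. Qed.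

Lemma stepZ c m : step (fun k => c * m k) = (fun k => c * step m k).
Proof. by apply/funext => k; rewrite /step; ring. Qed.

Lemma iter_stepZ c m J : iter J step (fun k => c * m k) = (fun k => c * iter J step m k).
Proof. by elim: J => [//|J IH]; rewrite iterS IH stepZ. Qed.

Lemma iter_stepD m m' J :
  iter J step (fun k => m k + m' k) = (fun k => iter J step m k + iter J step m' k).
Proof. by elim: J => [//|J IH]; rewrite iterS IH stepD. Qed.

Lemma iter_step_ge0 m J : (forall k, 0 <= m k) -> forall k, 0 <= iter J step m k.
Proof.
move=> h; elim: J => [//|J IH] k; rewrite iterS /step mulr_ge0 ?(ltW q0) //.
exact: addr_ge0.
Qed.

Lemma iter_step_mono m m' J : (forall k, m k <= m' k) ->
  forall k, iter J step m k <= iter J step m' k.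
Proof. by move=> h; elim: J => [//|J IH] k; rewrite !iterS; exact: step_mono. Qed.

Lemma iter_step_le m J : (forall k, step m k <= m k) -> forall k, iter J step m k <= m k.
Proof.
move=> h; elim: J => [//|J IH] k; rewrite iterS.
by apply: le_trans (h k); exact: step_mono.
Qed.

Lemma transientZ c m : transient m -> transient (fun k => c * m k).
Proof.
move=> tm k; under eq_fun do rewrite iter_stepZ.
by rewrite -(mulr0 c); apply: cvgMl_tmp; exact: tm.
Qed.

Lemma transientD m m' : transient m -> transient m' -> transient (fun k => m k + m' k).
Proof.
move=> tm tm' k; under eq_fun do rewrite iter_stepD.
by rewrite -(addr0 0); apply: cvgD; [exact: tm|exact: tm'].
Qed.

Lemma transientB m m' : transient m -> transient m' -> transient (fun k => m k - m' k).
Proof.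
move=> tm tm'; have := transientD tm (transientZ (-1) tm').
by under [X in transient X -> _]eq_fun do rewrite mulN1r.
Qed.

(* Superharmonic functions with vanishing iterates are potentials, hence nonnegative. *)
Lemma potential_ge0 d : (forall k, step d k <= d k) -> transient d -> forall k, 0 <= d k.
Proof.
move=> sd td k; rewrite -(cvg_lim (@Rhausdorff R) (td k)).
apply: limr_le; first by apply/cvg_ex; eexists; exact: td.
by apply: nearW => J; exact: iter_step_le.
Qed.

(** Both d and - d are superharmonic with vanishing iterates, hence both are nonnegative. *)
Lemma potential_eq0 d : (forall k, step d k = d k) -> transient d -> forall k, d k = 0.
Proof.
move=> hd td k; apply/eqP; rewrite eq_le; apply/andP; split; last first.
  by apply: potential_ge0 => // j; rewrite hd.
rewrite -oppr_ge0; apply: (potential_ge0 (d := fun k => - d k)) => [j|j].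
  by rewrite /step -opprD mulrN -/(step d j) hd.
have := transientZ (-1) td; by under [X in transient X -> _]eq_fun do rewrite mulN1r; apply.
Qed.

Let r := (1 - q) / q.
Let r0 : 0 < r. Proof. by rewrite divr_gt0 // subr_gt0. Qed.

(** Harmonicity is a first-order recursion here, since only [k] and [k.+1] occur in [step]. *)
Lemma harmonic_geometric h : (forall k, step h k = h k) -> forall k, h k = h 0%N * r ^+ k.
Proof.
move=> hh; elim=> [|k IH]; first by rewrite expr0 mulr1.
rewrite exprSr mulrA -IH /r; have := hh k; rewrite /step => e.
have qn : q != 0 by rewrite gt_eqF.
apply: (mulfI qn); have -> : q * (h k * ((1 - q) / q)) = h k - q * h k by field.
by move: e; rewrite mulrDr; lra.
Qed.

Lemma geometric_harmonic c : forall k, step (fun k => c * r ^+ k) k = c * r ^+ k.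
Proof.
move=> k; rewrite /step exprS /r; have qn : q != 0 by rewrite gt_eqF.
set t := _ ^+ k; by field.
Qed.

(** The iterates decrease to a limit h, which is harmonic because [step] passes to limits, hence
    geometric with constant c = h 0. Subtracting h, which [step] fixes, leaves iterates tending to
    0. *)
Lemma harmonic_part m : (forall k, 0 <= m k) -> (forall k, step m k <= m k) ->
  exists2 c, 0 <= c & (forall k, c * r ^+ k <= m k) /\ transient (fun k => m k - c * r ^+ k).
Proof.
move=> m0 sm.
have cv k : cvgn (fun J => iter J step m k).
  apply: nonincreasing_is_cvgn; last by exists 0 => _ [J _ <-]; exact: iter_step_ge0.
  apply/nonincreasing_seqP => J; rewrite iterSr; exact: iter_step_mono.
pose h k := limn (fun J => iter J step m k).
have hc k : iter J step m k @[J --> \oo] --> h k by exact: cv.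
have hh k : step h k = h k.
  have h1 : iter J.+1 step m k @[J --> \oo] --> h k by rewrite (cvg_shiftS (fun J => iter J step m k)).
  have h2 : iter J.+1 step m k @[J --> \oo] --> step h k.
    by rewrite /=; apply: cvgMl_tmp; apply: cvgD; exact: hc.
  exact: (cvg_unique (@Rhausdorff R) h2 h1).
have hE := harmonic_geometric hh.
exists (h 0%N); first by apply: limr_ge => //; apply: nearW => J; exact: iter_step_ge0.
split=> k; first by rewrite -hE; apply: limr_le => //; apply: nearW => J; exact: iter_step_le.
have hit J : iter J step h k = h k by elim: J k => // J IH k; rewrite iterS /step !IH -/(step h k) hh.
have e J : iter J step (fun k => m k - h 0%N * r ^+ k) k = iter J step m k - h k.
  rewrite -(hit J); have -> : (fun k => m k - h 0%N * r ^+ k) = (fun k => m k + -1 * h k).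
    by apply/funext => j; rewrite -hE mulN1r.
  by rewrite iter_stepD iter_stepZ mulN1r.
under eq_fun do rewrite e; rewrite -(subrr (h k)); apply: cvgB; [exact: hc|exact: cvg_cst].
Qed.

(* The extremal element m_{v_n}, in closed form with a = q / (1 - q). *)
Let a := q / (1 - q).
Let a0 : 0 < a. Proof. by rewrite divr_gt0 // subr_gt0. Qed.

Definition zn n : R := \sum_(0 <= j < n.+1) (q / (1 - q)) ^+ j.
Definition mun n k : R := if (k <= n)%N then (q / (1 - q)) ^+ (n - k) / zn n else 0.

Lemma zn_gt0 n : 0 < zn n.
Proof.
rewrite /zn big_nat_recl // expr0 ltr_pwDl // sumr_ge0 // => i _.
by rewrite exprn_ge0 // ltW.
Qed.

Lemma mun_ge0 n k : 0 <= mun n k.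
Proof.
rewrite /mun; case: ifP => // _; rewrite divr_ge0 ?exprn_ge0 ?(ltW a0) //.
exact: ltW (zn_gt0 n).
Qed.

(** The defect is concentrated at n, so up to scale [mun n] is the potential of the point mass at n.
    Extremality rests on this. *)
Lemma mun_step n k : mun n k - step (mun n) k = if k == n then (1 - q) / zn n else 0.
Proof.
have zn0 : zn n != 0 by rewrite gt_eqF // zn_gt0.
have q1n : 1 - q != 0 by rewrite gt_eqF // subr_gt0.
rewrite /step /mun; case: ltngtP => [kn|kn|->].
- rewrite -(subnSK kn) exprS; set t := _ ^+ _; field.
  by rewrite q1n zn0.
- by rewrite addr0 mulr0 subrr.
- by rewrite subnn expr0 addr0; field.
Qed.

Lemma mun_sum n : series (mun n) @ \oo --> (1 : R).
Proof.
apply: cvg_near_cst; exists n.+1 => // N /= nN; rewrite /series /=.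
rewrite (big_cat_nat (n := n.+1)) //= [X in _ + X]big_nat_cond [X in _ + X]big1 ?addr0; last first.
  by move=> i /andP[/andP[ni _] _]; rewrite /mun leqNgt ni.
transitivity (\sum_(0 <= k < n.+1) (q / (1 - q)) ^+ (n - k) / zn n).
  by apply: eq_big_nat => i /andP[_ iN]; rewrite /mun -ltnS iN.
rewrite -mulr_suml big_nat_rev /=.
have -> : \sum_(0 <= i < n.+1) (q / (1 - q)) ^+ (n - (0 + n.+1 - i.+1)) = zn n.
  by apply: eq_big_nat => i /andP[_ iN]; rewrite add0n subSS subKn.
by rewrite divff // gt_eqF // zn_gt0.
Qed.

Lemma mun_kmsd n : kmsd (mun n).
Proof.
split; [exact: mun_ge0|exact: mun_sum|] => k.
rewrite -subr_ge0 mun_step; case: ifP => // _.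
by rewrite divr_ge0 ?subr_ge0 ?(ltW q1) // ltW // zn_gt0.
Qed.

(** A harmonic part with c > 0 would be positive everywhere, whereas [mun n] vanishes beyond n. *)
Lemma mun_transient n : transient (mun n).
Proof.
have [m0 _ sm] := mun_kmsd n; have [c c0 [cm tm]] := harmonic_part m0 sm.
have c00 : c = 0.
  apply/eqP; rewrite eq_le c0 andbT; have := cm n.+1.
  by rewrite [mun n n.+1]/mun ltnn pmulr_lle0 // exprn_gt0.
by move: tm; under [X in transient X -> _]eq_fun do rewrite c00 mul0r subr0.
Qed.

Lemma kmsd_cvg0 m : kmsd m -> m @ \oo --> (0 : R).
Proof. by case=> _ hs _; apply: cvg_series_cvg_0; apply/cvg_ex; exists 1. Qed.

Lemma kmsd_neq0 m : kmsd m -> ~ (forall k, m k = 0).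
Proof.
case=> _ hs _ h; have e : series m = (fun=> 0).
  by apply/funext => n; rewrite /series /= big1.
rewrite e in hs; move/(cvg_lim (@Rhausdorff R)): hs; rewrite lim_cst // => /eqP.
by rewrite eq_sym oner_eq0.
Qed.

Lemma term_le_sum m l k : (forall j, 0 <= m j) -> series m @ \oo --> l -> m k <= l.
Proof.
move=> m0 sm; rewrite -(cvg_lim (@Rhausdorff R) sm); apply: limr_ge.
  by apply/cvg_ex; eexists; exact: sm.
exists k.+1 => // n /= kn; rewrite /series /= (bigD1_seq k) ?iota_uniq ?mem_index_iota //=.
by rewrite lerDl sumr_ge0.
Qed.

(** The difference is nonnegative with total mass 0; a one-sided bound between probabilities is thus
    enough for equality. *)
Lemma sum1_ge_eq m m' : series m @ \oo --> (1 : R) -> series m' @ \oo --> (1 : R) ->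
  (forall k, m k <= m' k) -> m = m'.
Proof.
move=> hm hm' le; apply/funext => k; apply/eqP; rewrite eq_le le /= leNgt; apply/negP => lt.
have hd : series (fun k => m' k - m k) @ \oo --> (1 - 1 : R).
  apply: eq_cvg_seq (cvgB hm' hm) => n.
  by rewrite !fctE /series /= sumrB.
have : m' k - m k <= 1 - 1 by apply: term_le_sum hd => j; rewrite subr_ge0.
by rewrite subrr subr_le0 leNgt lt.
Qed.

Lemma series_scale c m l : series m @ \oo --> l -> series (fun k => c * m k) @ \oo --> (c * l : R).
Proof.
move=> hm; apply: eq_cvg_seq (cvgMl_tmp (a := c) hm) => n.
by rewrite /series /= mulr_sumr.
Qed.

Lemma series_add m m' l l' : series m @ \oo --> l -> series m' @ \oo --> l' ->
  series (fun k => m k + m' k) @ \oo --> (l + l' : R).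
Proof.
move=> hm hm'; apply: eq_cvg_seq (cvgD hm hm') => n.
by rewrite fctE /series /= big_split.
Qed.

Definition mix t x y : nat -> R := fun k => t * x k + (1 - t) * y k.

(** Taking t as the ratio of the defects of m and [mun n] at n removes the whole defect there. The
    remainder m - t mun n stays superharmonic and transient, hence nonnegative, and has mass 1 -
    t. *)
Lemma mun_split m n : kmsd m -> transient m -> step m n < m n ->
  exists t, [/\ 0 < t, t <= 1, t = 1 -> m = mun n &
    t < 1 -> exists m', [/\ kmsd m', transient m' & m = mix t (mun n) m']].
Proof.
move=> [m0 sm hm] tm lt.
pose t := (m n - step m n) / ((1 - q) / zn n).
have q1' : 0 < 1 - q by rewrite subr_gt0.
have cn0 : 0 < (1 - q) / zn n by rewrite divr_gt0 // zn_gt0.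
have t0 : 0 < t by rewrite divr_gt0 // subr_gt0.
pose d k := m k - t * mun n k.
have dstep k : step d k <= d k.
  have -> : d = (fun k => m k + (- t) * mun n k) by apply/funext => j; rewrite /d mulNr.
  rewrite stepD stepZ -subr_ge0.
  have -> : m k + - t * mun n k - (step m k + - t * step (mun n) k) =
     (m k - step m k) - t * (mun n k - step (mun n) k) by ring.
  rewrite mun_step; case: eqP => [->|_]; last by rewrite mulr0 subr0 subr_ge0.
  by rewrite /t divfK ?subrr // gt_eqF.
have td : transient d by apply: transientB => //; apply: transientZ; exact: mun_transient.
have d0 := potential_ge0 dstep td.
have sd : series d @ \oo --> (1 - t : R).
  have -> : d = (fun k => m k + (- t) * mun n k) by apply/funext => j; rewrite /d mulNr.
  by have := series_add sm (series_scale (c := - t) (mun_sum n)); rewrite mulr1.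
have t1 : t <= 1.
  rewrite -subr_ge0 -(cvg_lim (@Rhausdorff R) sd); apply: limr_ge.
    by apply/cvg_ex; eexists; exact: sd.
  by apply: nearW => N; rewrite /series /= sumr_ge0.
exists t; split=> //.
  move=> t1'; apply/esym; apply: sum1_ge_eq => //; first exact: mun_sum.
  by move=> k; rewrite -subr_ge0; have := d0 k; rewrite /d t1' mul1r.
move=> lt1; have t1' : 0 < 1 - t by rewrite subr_gt0.
have t1n : 1 - t != 0 by rewrite gt_eqF.
exists (fun k => (1 - t)^-1 * d k); split.
- split.
  + by move=> k; rewrite mulr_ge0 // invr_ge0 ltW.
  + by rewrite -[X in _ --> X](mulVf t1n); exact: series_scale.
  + by move=> k; rewrite stepZ; apply: ler_wpM2l => //; rewrite invr_ge0 ltW.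
- exact: transientZ.
- by apply/funext => k; rewrite /mix /d mulVKf // addrC subrK.
Qed.

Lemma kmsd_defect m : kmsd m -> transient m -> exists n, step m n < m n.
Proof.
move=> km tm; apply: contrapT => /forallNP h; apply: (kmsd_neq0 km).
apply: potential_eq0 => // k; have [_ _ hm] := km.
by apply/eqP; rewrite eq_le hm /= leNgt; apply/negP; exact: h.
Qed.

(** Away from n the nonnegative defects of x and y average to 0, so the defect of x is c times that
    of [mun n]. Then x - c mun n is harmonic with vanishing iterates, hence 0, and comparing masses
    gives c = 1. *)
Lemma mun_extreme n x y t : kmsd x -> transient x -> kmsd y -> 0 < t < 1 ->
  mun n = mix t x y -> x = mun n.
Proof.
move=> kx tx ky /andP[t0 t1] e.
have [x0 sx hx] := kx; have [y0 sy hy] := ky.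
have t1' : 0 < 1 - t by rewrite subr_gt0.
have hk k : k <> n -> step x k = x k.
  move=> /eqP/negbTE kn; have := mun_step n k; rewrite kn e /mix stepD !stepZ.
  move=> h; have hxk : 0 <= x k - step x k by rewrite subr_ge0.
  have hyk : 0 <= y k - step y k by rewrite subr_ge0.
  have h2 : t * (x k - step x k) + (1 - t) * (y k - step y k) = 0 by rewrite -h; ring.
  have p1 : 0 <= t * (x k - step x k) by rewrite mulr_ge0 // ltW.
  have p2 : 0 <= (1 - t) * (y k - step y k) by rewrite mulr_ge0 // ltW.
  have : t * (x k - step x k) = 0 by lra.
  by move=> /eqP; rewrite mulf_eq0 (gt_eqF t0) /= subr_eq0 => /eqP.
pose c := (x n - step x n) / ((1 - q) / zn n).
have cn0 : (1 - q) / zn n != 0 by rewrite gt_eqF // divr_gt0 ?subr_gt0 // zn_gt0.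
pose d k := x k - c * mun n k.
have xE : x = (fun k => c * mun n k).
  apply/funext => k; apply/eqP; rewrite -subr_eq0; apply/eqP; move: k.
  apply: (potential_eq0 (d := d)); last by apply: transientB => //; apply: transientZ; exact: mun_transient.
  move=> k; apply/eqP; rewrite eq_sym -subr_eq0; apply/eqP.
  have -> : d = (fun k => x k + (- c) * mun n k) by apply/funext => j; rewrite /d mulNr.
  rewrite stepD stepZ.
  have -> : x k + - c * mun n k - (step x k + - c * step (mun n) k) =
     (x k - step x k) - c * (mun n k - step (mun n) k) by ring.
  rewrite mun_step; case: eqP => [->|/hk ->]; last by rewrite mulr0 subrr subr0.
  by rewrite /c divfK ?subrr.
have c1 : c = 1.
  rewrite xE in sx; have h := series_scale (c := c) (mun_sum n).
  by have := cvg_unique (@Rhausdorff R) sx h; rewrite mulr1 => <-.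
by rewrite xE c1; apply/funext => k; rewrite mul1r.
Qed.

Lemma mix_sym t x y : mix t x y = mix (1 - t) y x.
Proof. by apply/funext => k; rewrite /mix subKr addrC. Qed.

Definition fin_set : set (nat -> R) := [set m | kmsd m /\ transient m].

Lemma mun_fin n : fin_set (mun n).
Proof. by split; [exact: mun_kmsd|exact: mun_transient]. Qed.

Lemma extreme_fin : extreme fin_set = [set mun n | n in [set: nat]].
Proof.
apply/seteqP; split=> m.
  move=> [[km tm] ext]; have [n hn] := kmsd_defect km tm; exists n => //.
  have [t [t0 t1 h1 h2]] := mun_split km tm hn.
  have [te|tn1] := eqVneq t 1; first by rewrite h1.
  have lt : t < 1 by rewrite lt_neqAle tn1.
  have [m' [km' tm' me]] := h2 lt.
  have t01 : 0 < t < 1 by rewrite t0.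
  by have [] := ext _ m' t (mun_fin n) (conj km' tm') t01 me.
move=> [n _ <-]; split; first exact: mun_fin.
move=> x y t [kx tx] [ky ty] t01 e; split; first exact: mun_extreme kx tx ky t01 e.
have t01' : 0 < 1 - t < 1 by move/andP: t01 => [? ?]; apply/andP; split; lra.
by apply: (mun_extreme ky ty kx t01'); rewrite -mix_sym.
Qed.

(** For q = exp (- beta) this is the function [minf] of the theorem, as [minf_geo] shows. *)
Definition geo k : R := (1 - r) * r ^+ k.

Section Dissipative.
Hypothesis qh : 1 / 2 < q.

Let r1 : r < 1.
Proof. by rewrite /r ltr_pdivrMr // mul1r; move: qh; lra. Qed.

Lemma geo_kmsd : kmsd geo.
Proof.
split.
- by move=> k; rewrite mulr_ge0 ?exprn_ge0 ?(ltW r0) // subr_ge0 ltW.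
- have := @cvg_geometric_series R (1 - r) r; rewrite ger0_norm ?(ltW r0) // => /(_ r1).
  by rewrite divff // gt_eqF // subr_gt0.
- by move=> k; rewrite geometric_harmonic.
Qed.

(** The harmonic part of m is c r^k, of total mass t = c / (1 - r); the transient remainder has mass
    1 - t and is normalised. *)
Lemma kmsd_decomp m : kmsd m -> exists t m', [/\ 0 <= t <= 1, fin_set m' & m = mix t geo m'].
Proof.
move=> km; have [m0 sm hm] := km; have [c c0 [cm tm]] := harmonic_part m0 hm.
have r1' : 0 < 1 - r by rewrite subr_gt0.
pose t := c / (1 - r).
have t0 : 0 <= t by rewrite divr_ge0 // ltW.
have tE k : t * geo k = c * r ^+ k by rewrite /t /geo mulrA divfK // gt_eqF.
pose d k := m k - t * geo k.
have d0 k : 0 <= d k by rewrite /d tE subr_ge0.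
have dE : d = (fun k => m k + (- t) * geo k) by apply/funext => j; rewrite /d mulNr.
have sd : series d @ \oo --> (1 - t : R).
  have [_ sg _] := geo_kmsd.
  by rewrite dE; have := series_add sm (series_scale (c := - t) sg); rewrite mulr1.
have td : transient d.
  by move: tm; under [X in transient X -> _]eq_fun do rewrite -tE.
have t1 : t <= 1.
  rewrite -subr_ge0 -(cvg_lim (@Rhausdorff R) sd); apply: limr_ge.
    by apply/cvg_ex; eexists; exact: sd.
  by apply: nearW => N; rewrite /series /= sumr_ge0.
exists t; have [te|tn1] := eqVneq t 1.
  (* At t = 1 the remainder is 0 and cannot be normalised, so an arbitrary member of [fin_set] fills
     the slot of weight 0. *)
  exists (mun 0); split; first by rewrite t0 t1.
    exact: mun_fin.
  have [g0 sg hg] := geo_kmsd.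
  rewrite /mix te subrr; apply/funext => k; rewrite mul1r mul0r addr0.
  suff <- : geo = m by [].
  apply: sum1_ge_eq => // j; rewrite -subr_ge0.
  by have := d0 j; rewrite /d te mul1r.
have t1' : 0 < 1 - t by rewrite subr_gt0 lt_neqAle tn1.
have t1n : 1 - t != 0 by rewrite gt_eqF.
exists (fun k => (1 - t)^-1 * d k); split; first by rewrite t0 t1.
  split; last exact: transientZ.
  split.
  + by move=> k; rewrite mulr_ge0 // invr_ge0 ltW.
  + by rewrite -[X in _ --> X](mulVf t1n); exact: series_scale.
  + move=> k; rewrite stepZ; apply: ler_wpM2l; first by rewrite invr_ge0 ltW.
    rewrite dE stepD stepZ; apply: lerD => //.
    by have -> : step geo k = geo k; [exact: geometric_harmonic|].
by apply/funext => k; rewrite /mix mulVKf // addrC subrK.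
Qed.

Lemma geo_not_transient : ~ transient geo.
Proof.
move=> tg; have := potential_eq0 (geometric_harmonic (1 - r)) tg 0%N.
by rewrite expr0 mulr1 => /eqP; rewrite subr_eq0 gt_eqF.
Qed.

Lemma harmonic_kmsd m : kmsd m -> (forall k, step m k = m k) -> m = geo.
Proof.
move=> [m0 sm _] hm; have mE := harmonic_geometric hm.
have [_ sg _] := geo_kmsd.
have e : m = (fun k => (m 0%N / (1 - r)) * geo k).
  by apply/funext => k; rewrite mE /geo mulrA divfK // gt_eqF // subr_gt0.
have h := series_scale (c := m 0%N / (1 - r)) sg; rewrite -e mulr1 in h.
have c1 := cvg_unique (@Rhausdorff R) sm h.
by rewrite e -c1; apply/funext => k; rewrite mul1r.
Qed.

End Dissipative.

Lemma kmsd_transient m : q <= 1 / 2 -> kmsd m -> transient m.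
Proof.
move=> qh km; have [m0 sm hm] := km; have [c c0 [cm tm]] := harmonic_part m0 hm.
have r1 : 1 <= r by rewrite /r ler_pdivlMr // mul1r; lra.
have c00 : c = 0.
  apply/eqP; rewrite eq_le c0 andbT -(cvg_lim (@Rhausdorff R) (kmsd_cvg0 km)).
  apply: limr_ge; first by apply/cvg_ex; eexists; exact: kmsd_cvg0.
  apply: nearW => k; apply: le_trans (cm k).
  by rewrite -[leLHS]mulr1; apply: ler_wpM2l => //; exact: exprn_ege1.
by move: tm; under [X in transient X -> _]eq_fun do rewrite c00 mul0r subr0.
Qed.

Lemma kmsd_convex n (c : 'I_n -> R) (x : 'I_n -> nat -> R) :
  (forall i, 0 <= c i) -> (forall i, kmsd (x i)) -> \sum_i c i = 1 ->
  kmsd (fun v => \sum_i c i * x i v).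
Proof.
move=> c0 kx c1; split.
- by move=> k; apply: sumr_ge0 => i _; rewrite mulr_ge0 //; have [] := kx i.
- rewrite -[X in _ --> X]c1.
  have h : (fun N => \sum_i series (fun k => c i * x i k) N) @ \oo --> \sum_i c i.
    apply: cvg_big => [|i _]; first exact: add_continuous.
    rewrite -[c i]mulr1; have [_ si _] := kx i.
    by have := series_scale (c := c i) si; rewrite mulr1.
  apply: eq_cvg_seq h => N.
  by rewrite /series /= exchange_big.
- move=> k; rewrite /step -big_split mulr_sumr /=; apply: ler_sum => i _.
  rewrite -mulrDr mulrCA; apply: ler_wpM2l => //.
  by have [_ _] := kx i; apply.
Qed.

End Superharmonic.

(** * Complex moduli and series *)

Section Moduli.
Variable R : realType.
Local Notation C := (R[i] : numFieldType).

(* Norms of R[i]-normed spaces take their values in R[i]; [rnorm] and [cabs] are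
   their real-valued versions. *)
Definition rnorm (V : normedModType R[i]) (x : V) : R := complex.Re `|x|.
Definition cabs (z : R[i]) : R := complex.Re `|z|.

Lemma rnormE (V : normedModType R[i]) (x : V) : `|x| = (rnorm x)%:C%C.
Proof.
rewrite /rnorm; have := ger0_Im (normr_ge0 x).
by case: (`|x|) => a b /= ->.
Qed.

Lemma cabsE (z : R[i]) : `|z| = (cabs z)%:C%C.
Proof.
rewrite /cabs; have := ger0_Im (normr_ge0 z).
by case: (`|z|) => a b /= ->.
Qed.

Lemma realC_inj (x y : R) : x%:C%C = y%:C%C -> x = y.
Proof. by case. Qed.

Lemma cabs_ge0 z : 0 <= cabs z.
Proof. by rewrite -lecR -cabsE normr_ge0. Qed.
Lemma cabsD x y : cabs (x + y) <= cabs x + cabs y.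
Proof. by rewrite -lecR rmorphD /= -!cabsE; exact: ler_normD. Qed.
Lemma cabsN x : cabs (- x) = cabs x.
Proof. by rewrite /cabs normrN. Qed.
Lemma cabsM x y : cabs (x * y) = cabs x * cabs y.
Proof. by apply: realC_inj; rewrite rmorphM /= -!cabsE normrM. Qed.
Lemma cabs0 : cabs 0 = 0.
Proof. by rewrite /cabs normr0. Qed.
Lemma cabs0_eq0 x : cabs x = 0 -> x = 0.
Proof. by move=> h; apply/eqP; rewrite -normr_eq0 cabsE h. Qed.
Lemma cabs_real (x : R) : cabs x%:C%C = `|x|.
Proof. by rewrite /cabs normc_def /= expr0n /= addr0 sqrtr_sqr. Qed.
Lemma cabs_Re z : `|complex.Re z| <= cabs z.
Proof. by rewrite -lecR -cabsE normc_ge_Re. Qed.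
Lemma cabs_Im z : `|complex.Im z| <= cabs z.
Proof.
rewrite /cabs normc_def /= -sqrtr_sqr; apply: ler_wsqrtr.
by rewrite lerDr sqr_ge0.
Qed.
Lemma cabs_le z : cabs z <= `|complex.Re z| + `|complex.Im z|.
Proof.
case: z => a b.
have -> : (a +i* b)%C = a%:C%C + (0 +i* b)%C by apply/eqP; rewrite eq_complex /= addr0 add0r !eqxx.
apply: (le_trans (cabsD _ _)); rewrite cabs_real /= addr0 add0r lerD2l.
by rewrite /cabs normc_def /= expr0n add0r sqrtr_sqr.
Qed.
Section Rnorm.
Variable V : normedModType R[i].
Implicit Types x y : V.
Lemma rnorm_ge0 x : 0 <= rnorm x.
Proof. by rewrite -lecR -rnormE normr_ge0. Qed.
Lemma rnormD x y : rnorm (x + y) <= rnorm x + rnorm y.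
Proof. by rewrite -lecR rmorphD /= -!rnormE; exact: ler_normD. Qed.
Lemma rnormN x : rnorm (- x) = rnorm x.
Proof. by rewrite /rnorm normrN. Qed.
Lemma rnormB x y : rnorm (x - y) = rnorm (y - x).
Proof. by rewrite -rnormN opprB. Qed.
Lemma rnorm0 : rnorm (0 : V) = 0.
Proof. by rewrite /rnorm normr0. Qed.
Lemma rnorm0_eq0 x : rnorm x = 0 -> x = 0.
Proof. by move=> h; apply/eqP; rewrite -normr_eq0 rnormE h. Qed.
Lemma rnormZ (k : R[i]) x : rnorm (k *: x) = cabs k * rnorm x.
Proof. by apply: realC_inj; rewrite rmorphM /= -cabsE -!rnormE normrZ. Qed.
Lemma cvg_rnormP (u : nat -> V) (l : V) :
  u @ \oo --> l <-> forall e : R, 0 < e -> \forall n \near \oo, rnorm (l - u n) < e.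
Proof.
split=> [h e e0|h].
  move/cvgrPdist_lt : h => /(_ e%:C%C); rewrite ltcR => /(_ e0).
  by apply: filterS => n; rewrite rnormE ltcR.
apply/cvgrPdist_lt => e e0.
have ei : complex.Im e = 0 by apply: ger0_Im; exact: ltW.
have ee : e = (complex.Re e)%:C%C by move: e {e0} ei => [a b] /= ->.
have e0' : 0 < complex.Re e by rewrite -ltcR -ee.
by move: (h _ e0'); apply: filterS => n hn; rewrite ee rnormE ltcR.
Qed.
End Rnorm.

Lemma cvg_cabsP (u : nat -> C) (l : C) :
  u @ \oo --> l <-> forall e : R, 0 < e -> \forall n \near \oo, cabs (l - u n) < e.
Proof. exact: (@cvg_rnormP (C : normedModType C)). Qed.

Lemma cvg_cplx (u : nat -> C) (a b : R) :
  (complex.Re (u n)) @[n --> \oo] --> a -> (complex.Im (u n)) @[n --> \oo] --> b ->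
  u @ \oo --> ((a +i* b)%C : C).
Proof.
move=> /cvgrPdist_lt ha /cvgrPdist_lt hb; apply/cvg_cabsP => e e0.
have e2 : 0 < e / 2 by rewrite divr_gt0.
near=> n; apply: le_lt_trans (cabs_le _) _.
rewrite [e]splitr; apply: ltrD; last first.
  by rewrite raddfB /=; near: n; exact: hb.
by rewrite raddfB /=; near: n; exact: ha.
Unshelve. all: by end_near. Qed.

Lemma cvg_Re (u : nat -> C) (l : C) : u @ \oo --> l ->
  (complex.Re (u n)) @[n --> \oo] --> complex.Re l.
Proof.
move=> /cvg_cabsP h; apply/cvgrPdist_lt => e e0; move: (h _ e0).
by apply: filterS => n; apply: le_lt_trans; rewrite -raddfB; exact: cabs_Re.
Qed.

Lemma cvg_Im (u : nat -> C) (l : C) : u @ \oo --> l ->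
  (complex.Im (u n)) @[n --> \oo] --> complex.Im l.
Proof.
move=> /cvg_cabsP h; apply/cvgrPdist_lt => e e0; move: (h _ e0).
by apply: filterS => n; apply: le_lt_trans; rewrite -raddfB; exact: cabs_Im.
Qed.

Lemma cvg_cabs (u : nat -> C) (l : C) : u @ \oo --> l ->
  (cabs (u n)) @[n --> \oo] --> cabs l.
Proof.
move=> /cvg_cabsP h; apply/cvgrPdist_lt => e e0; move: (h _ e0).
apply: filterS => n; apply: le_lt_trans; rewrite ler_norml.
have := cabsD (l - u n) (u n); have := cabsD (u n - l) l.
rewrite !subrK -(cabsN (l - u n)) opprB => h1 h2; apply/andP; split; lra.
Qed.

(** Given by real and imaginary parts, so that existence of the sum reduces to absolute convergence
    in R. *)
Definition csum (z : nat -> R[i]) : R[i] :=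
  (limn (series (fun n => complex.Re (z n))) +i*
   limn (series (fun n => complex.Im (z n))))%C.

Lemma csum_cvg (z : nat -> R[i]) (r : nat -> R) :
  (forall n, cabs (z n) <= r n) -> cvgn (series r) ->
  (series z : nat -> C) @ \oo --> (csum z : C).
Proof.
move=> zr cr.
have cR (f : R[i] -> R) : (forall z, `|f z| <= cabs z) ->
    cvgn (series (fun n => f (z n))).
  move=> hf; apply: normed_cvg; apply: series_le_cvg cr => n.
  - exact: normr_ge0.
  - by apply: le_trans (zr n); exact: cabs_ge0.
  - by apply: le_trans (zr n); exact: hf.
apply: cvg_cplx.
  have := cR _ cabs_Re; rewrite /csum; apply: cvg_trans => /=.
  apply: near_eq_cvg; apply: nearW => n.
  by rewrite /series /= raddf_sum.
have := cR _ cabs_Im; rewrite /csum; apply: cvg_trans => /=.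
apply: near_eq_cvg; apply: nearW => n.
by rewrite /series /= raddf_sum.
Qed.

Lemma csum_unique (z : nat -> R[i]) (l : C) :
  (series z : nat -> C) @ \oo --> l -> csum z = l.
Proof.
move=> h; rewrite /csum.
have /(cvg_lim _) -> // : series (fun n => complex.Re (z n)) @ \oo --> complex.Re l.
  have := cvg_Re h; apply: cvg_trans; apply: near_eq_cvg; apply: nearW => n.
  by rewrite /series /= raddf_sum.
have /(cvg_lim _) -> // : series (fun n => complex.Im (z n)) @ \oo --> complex.Im l.
  have := cvg_Im h; apply: cvg_trans; apply: near_eq_cvg; apply: nearW => n.
  by rewrite /series /= raddf_sum.
by case: (l : R[i]).
Qed.

Lemma csum_norm_le (z : nat -> R[i]) (r : nat -> R) :
  (forall n, cabs (z n) <= r n) -> cvgn (series r) ->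
  cabs (csum z) <= limn (series r).
Proof.
move=> zr cr; have := cvg_cabs (csum_cvg zr cr).
move=> h; have <- := cvg_lim _ h => //.
apply: ler_lim => //; first by apply/cvg_ex; eexists; exact: h.
apply: nearW => n; rewrite /series /=.
elim: n => [|n IH]; first by rewrite !big_geq // cabs0.
by rewrite !big_nat_recr //=; apply: le_trans (cabsD _ _) _; exact: lerD.
Qed.

End Moduli.

(** * Positive functionals on C*-algebras *)

Lemma conj_cplx (R : realType) (a b : R) : ((a +i* b)%C : R[i])^* = (a -i* b)%C.
Proof. by []. Qed.

Section CstarBasics.
Variables (R : realType) (A : cstarAlg R).
Implicit Types (x y z : A) (k : R[i]).

Lemma cmul0x x : cmul 0 x = 0.
Proof. by apply: (@addrI _ (cmul 0 x)); rewrite -cmulDl !addr0. Qed.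
Lemma cmulx0 x : cmul x 0 = 0.
Proof. by apply: (@addrI _ (cmul x 0)); rewrite -cmulDr !addr0. Qed.
Lemma cmulNx x y : cmul (- x) y = - cmul x y.
Proof. by apply: (@addrI _ (cmul x y)); rewrite -cmulDl !subrr cmul0x. Qed.
Lemma cmulxN x y : cmul x (- y) = - cmul x y.
Proof. by apply: (@addrI _ (cmul x y)); rewrite -cmulDr !subrr cmulx0. Qed.
Lemma cmulBl x y z : cmul (x - y) z = cmul x z - cmul y z.
Proof. by rewrite cmulDl cmulNx. Qed.
Lemma cmulBr x y z : cmul z (x - y) = cmul z x - cmul z y.
Proof. by rewrite cmulDr cmulxN. Qed.
Lemma cstar0 : cstar (0 : A) = 0.
Proof. by apply: (@addrI _ (cstar 0)); rewrite -cstarD !addr0. Qed.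
Lemma cstarN x : cstar (- x) = - cstar x.
Proof. by apply: (@addrI _ (cstar x)); rewrite -cstarD !subrr cstar0. Qed.
Lemma cstarB x y : cstar (x - y) = cstar x - cstar y.
Proof. by rewrite cstarD cstarN. Qed.

Lemma rnormM x y : rnorm (cmul x y) <= rnorm x * rnorm y.
Proof. by rewrite -lecR rmorphM /= -!rnormE; exact: cnormM. Qed.
Lemma rnorm_starM x : rnorm (cmul (cstar x) x) = rnorm x ^+ 2.
Proof. by apply: realC_inj; rewrite rmorphXn /= -!rnormE; exact: cnorm_star. Qed.
Lemma rnorm_star x : rnorm (cstar x) = rnorm x.
Proof.
have le z : rnorm z <= rnorm (cstar z).
  have [->|z0] := eqVneq (rnorm z) 0; first exact: rnorm_ge0.
  have zp : 0 < rnorm z by rewrite lt_def z0 rnorm_ge0.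
  by rewrite -(ler_pM2r zp) -expr2 -rnorm_starM rnormM.
by apply/eqP; rewrite eq_le le -{2}[x]cstarK le.
Qed.
Lemma proj_norm x : cstar x = x -> cmul x x = x -> rnorm x <= 1.
Proof.
move=> sx xx; have [->|x0] := eqVneq (rnorm x) 0; first by [].
have xp : 0 < rnorm x by rewrite lt_def x0 rnorm_ge0.
by rewrite -(ler_pM2r xp) -expr2 -rnorm_starM sx xx mul1r.
Qed.

(** Positive functionals are kept as plain functions with an explicit bound, so that infinite sums
    of them can be formed and estimated before being packed as a linear form by [mk_scalar]. *)
Record posf (c : R) (f : A -> R[i]) : Prop := Posf {
  posf_c : 0 <= c;
  posfD : forall x y, f (x + y) = f x + f y;
  posfZ : forall k x, f (k *: x) = k * f x;
  posf_ge0 : forall x, 0 <= f (cmul (cstar x) x);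
  posf_bd : forall x, cabs (f x) <= c * rnorm x }.

Section PosFun.
Variables (c : R) (f : A -> R[i]).
Hypothesis pf : posf c f.

Lemma posfB x y : f (x - y) = f x - f y.
Proof. by rewrite (posfD pf) -scaleN1r (posfZ pf) mulN1r. Qed.
Lemma posf0 : f 0 = 0.
Proof. by rewrite -(scale0r 0) (posfZ pf) mul0r. Qed.

Lemma posf_mul_bd x y : cabs (f (cmul x y)) <= c * (rnorm x * rnorm y).
Proof.
apply: le_trans (posf_bd pf _) _; apply: ler_wpM2l; last exact: rnormM.
exact: posf_c pf.
Qed.

Lemma posf_comb k l x y : f (cmul (cstar (k *: x + l *: y)) (k *: x + l *: y)) =
  k^* * k * f (cmul (cstar x) x) + k^* * l * f (cmul (cstar x) y)
  + (l^* * k * f (cmul (cstar y) x) + l^* * l * f (cmul (cstar y) y)).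
Proof.
rewrite cstarD !cstarZ cmulDl !cmulDr -!cscaleAl -!cscaleAr !scalerA.
by rewrite !(posfD pf) !(posfZ pf).
Qed.

(** Polarisation: positivity at x + y and at x + i y makes two imaginary parts vanish, which is the
    conjugate symmetry. *)
Lemma posf_herm x y : f (cmul (cstar x) y) = (f (cmul (cstar y) x))^*.
Proof.
have h k l := posf_ge0 pf (k *: x + l *: y).
have /ger0_Im h1 := h 1 1; have /ger0_Im h2 := h 1 'i%C.
have /ger0_Im := posf_ge0 pf x; have /ger0_Im := posf_ge0 pf y.
move: h1 h2; rewrite !posf_comb.
case: (f (cmul (cstar x) x)) => a b; case: (f (cmul (cstar y) y)) => a' b'.
case: (f (cmul (cstar x) y)) => s t; case: (f (cmul (cstar y) x)) => u v.
have ic : (('i%C : R[i])^* = (0 -i* 1)%C) by [].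
rewrite conjC1 !mul1r mulr1 ?ic ?conj_cplx /= => h1 h2 b0 b'0.
rewrite b0 b'0 in h1 h2.
by apply/eqP; rewrite eq_complex /=; apply/andP; split; apply/eqP; lra.
Qed.

Lemma posf_ReE x : f (cmul (cstar x) x) = (complex.Re (f (cmul (cstar x) x)))%:C%C.
Proof. by have /ger0_Im := posf_ge0 pf x; case: (f _) => a b /= ->. Qed.

Lemma posf_Re_ge0 x : 0 <= complex.Re (f (cmul (cstar x) x)).
Proof. by rewrite -lecR -posf_ReE; exact: posf_ge0 pf x. Qed.

Lemma posf_CS x y : cabs (f (cmul (cstar x) y)) ^+ 2 <=
  complex.Re (f (cmul (cstar x) x)) * complex.Re (f (cmul (cstar y) y)).
Proof.
set S := _ ^+ 2; set p := complex.Re _; set r := complex.Re _.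
have p0 : 0 <= p := posf_Re_ge0 x.
have r0 : 0 <= r := posf_Re_ge0 y.
have S0 : 0 <= S by rewrite sqr_ge0.
(* Positivity at t x + l y with l = - conj (f (x^* y)): this phase turns the two cross terms into -
   2 t S. *)
have key (t : R) : 0 <= t ^+ 2 * p - 2 * t * S + S * r.
  have := posf_ge0 pf (t%:C%C *: x + (- (f (cmul (cstar x) y))^*) *: y).
  rewrite posf_comb [f (cmul (cstar y) x)]posf_herm.
  rewrite (posf_ReE x) (posf_ReE y) -/p -/r.
  have SE : S = complex.Re (f (cmul (cstar x) y)) ^+ 2 + complex.Im (f (cmul (cstar x) y)) ^+ 2.
    by apply: realC_inj; rewrite add_Re2_Im2 /S rmorphXn /= cabsE.
  rewrite SE; case: (f (cmul (cstar x) y)) => u v /=.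
  by rewrite lecE /= => /andP[_]; lra.
(* For p = 0 the inequality is affine in t, and t = r + 1 forces S = 0; otherwise t = S / p is the
   minimiser. *)
have [p00|pn0] := eqVneq p 0.
  rewrite p00 mul0r; have := key (r + 1); rewrite p00; nra.
have pp : 0 < p by rewrite lt_def pn0.
have := key (S / p); have -> : (S / p) ^+ 2 * p = S * S / p by field.
have -> : 2 * (S / p) * S = 2 * (S * S / p) by field.
have [->|Sn0] := eqVneq S 0; first by move=> _; rewrite mulr_ge0.
have Sp : 0 < S by rewrite lt_def Sn0.
move=> h; have : S * S / p <= S * r by lra.
by rewrite -mulrA ler_pM2l // ler_pdivrMr // mulrC.
Qed.

(* By iterated Cauchy-Schwarz, |f h| <= f P ^ (1 - 2^-n) |f (h^(2^n))| ^ (2^-n)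
   for h = (x P)^* (x P); let n tend to infinity. *)
Lemma posf_conj_proj P x : cstar P = P -> cmul P P = P ->
  cabs (f (cmul (cmul P x) P)) <= complex.Re (f P) * rnorm x.
Proof.
move=> sP PP.
have PE : f P = f (cmul (cstar P) P) by rewrite sP PP.
have nP := proj_norm sP PP.
set cP := complex.Re (f P).
have cP0 : 0 <= cP by rewrite /cP PE posf_Re_ge0.
pose h0 := cmul (cstar (cmul x P)) (cmul x P).
pose h := fix h n := if n is m.+1 then cmul (h m) (h m) else h0.
have sh n : cstar (h n) = h n.
  by elim: n => [|n IH] /=; [rewrite /h0 cstarM cstarK | rewrite cstarM IH].
have Ph n : cmul P (h n) = h n.
  elim: n => [|n IH] /=; last by rewrite cmulA IH.
  by rewrite /h0 cstarM sP !cmulA PP.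
have nh n : rnorm (h n) = rnorm h0 ^+ (2 ^ n).
  elim: n => [|n IH] /=; first by rewrite expn0 expr1.
  by rewrite -{1}(sh n) rnorm_starM IH -exprM expnSr.
have c0 := posf_c pf.
pose t n := cabs (f (h n)).
have t0 n : 0 <= t n := cabs_ge0 _.
have th n : t n ^+ 2 <= cP * t n.+1.
  rewrite /t -{1}(Ph n) -{1}sP; apply: le_trans (posf_CS _ _) _.
  rewrite -PE -/cP; apply: ler_wpM2l => //.
  rewrite sh /=; apply: le_trans (ler_norm _) _; exact: cabs_Re.
have tb n : t n <= c * rnorm h0 ^+ (2 ^ n).
  by rewrite -nh; exact: posf_bd.
have h0le : rnorm h0 <= rnorm x ^+ 2.
  rewrite /h0 rnorm_starM; rewrite lerXn2r ?nnegrE ?rnorm_ge0 //.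
  apply: le_trans (rnormM _ _) _; rewrite -[leRHS]mulr1.
  by apply: ler_wpM2l => //; exact: rnorm_ge0.
have main : t 0%N <= cP * rnorm h0.
  have [cP00|cPn0] := eqVneq cP 0.
    have := th 0%N; rewrite cP00 !mul0r => h1.
    by rewrite -(ler_pXn2r (n := 2)) ?nnegrE // expr0n.
  have cPp : 0 < cP by rewrite lt_def cPn0.
  have tn n : (t 0%N / cP) ^+ (2 ^ n) <= t n / cP.
    elim: n => [|n IH]; first by rewrite expn0 expr1.
    rewrite expnSr exprM.
    apply: (@le_trans _ _ ((t n / cP) ^+ 2)).
      by rewrite lerXn2r ?nnegrE ?exprn_ge0 ?divr_ge0.
    rewrite expr_div_n ler_pdivrMr ?exprn_gt0 // expr2 -expr2.
    by apply: le_trans (th n) _; rewrite [cP ^+ 2]expr2 mulrA divfK // mulrC.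
  (* If the bound failed, [rho < 1] would satisfy 1 <= (c / cP) rho^(2^n) for every n, which is
     impossible. *)
  rewrite leNgt; apply/negP => lt0.
  pose s := t 0%N / cP.
  have sh0 : rnorm h0 < s by rewrite /s ltr_pdivlMr // mulrC.
  have s0 : 0 < s by apply: le_lt_trans sh0; exact: rnorm_ge0.
  pose rho := rnorm h0 / s.
  have rho1 : rho < 1 by rewrite /rho ltr_pdivrMr // mul1r.
  have rho0 : 0 <= rho by rewrite divr_ge0 ?rnorm_ge0 // ltW.
  have ge1 n : 1 <= (c / cP) * rho ^+ (2 ^ n).
    rewrite /rho expr_div_n mulrA ler_pdivlMr ?exprn_gt0 // mul1r.
    apply: le_trans (tn n) _; rewrite mulrAC ler_pM2r ?invr_gt0 //.
  have : (fun n => (c / cP) * rho ^+ n) @ \oo --> (c / cP) * 0.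
    apply: cvgMr; apply: cvg_expr; by rewrite ger0_norm.
  rewrite mulr0 => /cvgrPdist_lt /(_ 1 ltr01) [N _ hN].
  have := hN (2 ^ N)%N; rewrite /= => /(_ (ltnW (ltn_expl _ _))) => /(_ isT).
  rewrite sub0r normrN ger0_norm; last first.
    by rewrite mulr_ge0 ?exprn_ge0 // divr_ge0.
  by rewrite ltNge ge1.
(* A last Cauchy-Schwarz passes from [h0] back to P x P. *)
have CS2 := posf_CS P (cmul x P).
rewrite -PE -/cP -/h0 sP cmulA in CS2.
rewrite -(ler_pXn2r (n := 2)) ?nnegrE ?cabs_ge0 ?mulr_ge0 ?rnorm_ge0 //.
apply: le_trans CS2 _; rewrite exprMn [cP ^+ 2]expr2 -mulrA; apply: ler_wpM2l => //.
apply: (@le_trans _ _ (t 0%N)).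
  by apply: le_trans (ler_norm _) _; exact: cabs_Re.
by apply: le_trans main _; apply: ler_wpM2l.
Qed.

End PosFun.
End CstarBasics.

(** * Density arguments *)

Section Approximation.
Variables (R : realType) (A : cstarAlg R).
Implicit Types (x y z : A) (S : set A).

(** Metric closure phrased with [rnorm], which keeps every epsilon real. *)
Definition approx S x : Prop := forall e : R, 0 < e -> exists2 y, S y & rnorm (x - y) < e.

Definition approx_closed S : Prop := forall x, approx S x -> S x.

Lemma approx_sub S x : S x -> approx S x.
Proof. by move=> Sx e e0; exists x => //; rewrite subrr rnorm0. Qed.

Lemma approx_idem S : approx_closed (approx S).
Proof.
move=> x ax e e0; have e2 : 0 < e / 2 by rewrite divr_gt0.
have [y ay xy] := ax _ e2; have [z Sz yz] := ay _ e2.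
exists z => //; rewrite [e]splitr -(subrK y x) -addrA.
by apply: le_lt_trans (rnormD _ _) _; exact: ltrD.
Qed.

Lemma approx_closed_closed S : approx_closed S -> closed S.
Proof.
move=> h x clx; apply: h => e e0.
have e0' : (0 : R[i]) < e%:C%C by rewrite ltcR.
have [y [Sy]] := clx _ (nbhsx_ballx x _ e0').
by rewrite -ball_normE /= rnormE ltcR => xy; exists y.
Qed.

Lemma approxD S : (forall x y, S x -> S y -> S (x + y)) ->
  forall x y, approx S x -> approx S y -> approx S (x + y).
Proof.
move=> SD x y ax ay e e0; have e2 : 0 < e / 2 by rewrite divr_gt0.
have [x' Sx' xx'] := ax _ e2; have [y' Sy' yy'] := ay _ e2.
exists (x' + y'); first exact: SD.
rewrite opprD addrACA [e]splitr.
by apply: le_lt_trans (rnormD _ _) _; exact: ltrD.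
Qed.

Lemma approx_map S S' (F : A -> A) (c : R) : 0 <= c ->
  (forall x y, rnorm (F x - F y) <= c * rnorm (x - y)) ->
  (forall x, S x -> S' (F x)) -> forall x, approx S x -> approx S' (F x).
Proof.
move=> c0 FL FS x ax e e0; have c1 : 0 < c + 1 by rewrite ltr_wpDl.
have [y Sy xy] := ax _ (divr_gt0 e0 c1).
exists (F y); first exact: FS.
apply: le_lt_trans (FL _ _) _; move: xy; rewrite ltr_pdivlMr // => xy.
apply: le_lt_trans xy; rewrite mulrDr mulr1 mulrC lerDl; exact: rnorm_ge0.
Qed.

Lemma cmulr_lipschitz a x y : rnorm (cmul a x - cmul a y) <= rnorm a * rnorm (x - y).
Proof. by rewrite -cmulBr rnormM. Qed.
Lemma cmull_lipschitz a x y : rnorm (cmul x a - cmul y a) <= rnorm a * rnorm (x - y).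
Proof. by rewrite -cmulBl mulrC rnormM. Qed.
Lemma scale_lipschitz (k : R[i]) x y : rnorm (k *: x - k *: y) <= cabs k * rnorm (x - y).
Proof. by rewrite -scalerBr rnormZ. Qed.
Lemma cstar_lipschitz x y : rnorm (cstar x - cstar y) <= 1 * rnorm (x - y).
Proof. by rewrite -cstarB rnorm_star mul1r. Qed.

Inductive lspan S : set A :=
| lspan0 : lspan S 0
| lspan_cons k x y : S x -> lspan S y -> lspan S (k *: x + y).

Lemma lspanD S x y : lspan S x -> lspan S y -> lspan S (x + y).
Proof.
move=> hx hy; elim: hx => [|k g z Sg _ IH]; first by rewrite add0r.
by rewrite -addrA; exact: lspan_cons.
Qed.
Lemma lspanZ S (k : R[i]) x : lspan S x -> lspan S (k *: x).
Proof.
elim=> [|l g z Sg _ IH]; first by rewrite scaler0; exact: lspan0.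
by rewrite scalerDr scalerA; exact: lspan_cons.
Qed.
Lemma lspan_sub S x : S x -> lspan S x.
Proof. by move=> Sx; rewrite -[x]addr0 -{1}[x]scale1r; apply: lspan_cons => //; exact: lspan0. Qed.
Lemma lspan_ind2 S S' : S' 0 -> (forall x y, S' x -> S' y -> S' (x + y)) ->
  (forall (k : R[i]) x, S' x -> S' (k *: x)) -> S `<=` S' -> lspan S `<=` S'.
Proof.
move=> S0 SD SZ SS' x; elim=> // k g y Sg _ IH.
by apply: SD => //; apply: SZ; exact: SS'.
Qed.

End Approximation.

(** * The Toeplitz algebra and its ground states *)

Section Toeplitz.
Variables (R : realType) (E : graph) (A : cstarAlg R).
Variables (s : edge E -> A) (p : vert E -> A).
Hypothesis hT : toeplitz_family s p.
Implicit Types (x y : A) (e f : edge E) (v : vert E).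

Lemma s_rng e : cmul (s e) (p (rng e)) = s e.
Proof. by rewrite -(eiso_source hT) cmulA (eiso_partial hT). Qed.
Lemma src_s e : cmul (p (src e)) (s e) = s e.
Proof. by rewrite -{1}(eiso_partial hT) cmulA (eiso_range hT) (eiso_partial hT). Qed.
Lemma proj_s v e : v <> src e -> cmul (p v) (s e) = 0.
Proof. by move=> ve; rewrite -src_s cmulA (vproj_orth hT ve) cmul0x. Qed.
Lemma sstar_s e f : e <> f -> cmul (cstar (s e)) (s f) = 0.
Proof.
move=> ef; have h : cstar (s e) = cmul (cstar (s e)) (cmul (s e) (cstar (s e))).
  by rewrite -{1}(eiso_partial hT e) !cstarM cstarK.
rewrite h -(eiso_partial hT f) -cmulA [cmul (cmul (s e) _) (cmul _ _)]cmulA.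
by rewrite (eiso_orth hT ef) cmul0x cmulx0.
Qed.
Lemma rng_sstar e : cmul (p (rng e)) (cstar (s e)) = cstar (s e).
Proof. by rewrite -{2}[s e]s_rng cstarM (vproj_star hT). Qed.
Lemma sstar_src e : cmul (cstar (s e)) (p (src e)) = cstar (s e).
Proof. by rewrite -{2}[s e]src_s cstarM (vproj_star hT). Qed.
Lemma sstar_proj v e : v <> src e -> cmul (cstar (s e)) (p v) = 0.
Proof. by move=> ve; rewrite -(vproj_star hT v) -cstarM proj_s // cstar0. Qed.
Lemma proj_rnorm v : rnorm (p v) <= 1.
Proof. exact: proj_norm (vproj_star hT v) (vproj_idem hT v). Qed.
Lemma s_rnorm e : rnorm (s e) <= 1.
Proof.
rewrite -(ler_pXn2r (n := 2)) ?nnegrE ?rnorm_ge0 // expr1n -rnorm_starM.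
by rewrite (eiso_source hT) proj_rnorm.
Qed.

(* [mon u v w] is s_u p_v s_w^*, where s_u is the product of the s_e along u. *)
Fixpoint monr v (w : seq (edge E)) : A :=
  if w is e :: w' then cmul (monr v w') (cstar (s e)) else p v.
Fixpoint mon (u : seq (edge E)) v w : A :=
  if u is e :: u' then cmul (s e) (mon u' v w) else monr v w.

Definition monset : set A := [set x | exists u v w, x = mon u v w].

Lemma proj_monr v w : cmul (p v) (monr v w) = monr v w.
Proof. by elim: w => [|e w IH] /=; [rewrite (vproj_idem hT)|rewrite cmulA IH]. Qed.
Lemma proj_monr0 v v' w : v' <> v -> cmul (p v') (monr v w) = 0.
Proof. by move=> h; rewrite -proj_monr cmulA (vproj_orth hT h) cmul0x. Qed.
Lemma sstar_monr e w : cmul (cstar (s e)) (monr (src e) w) = monr (rng e) (rcons w e).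
Proof.
elim: w => [|f w IH] /=; last by rewrite cmulA IH.
by rewrite sstar_src rng_sstar.
Qed.

Lemma proj_mon u v' w : exists v'' : vert E,
  forall v, cmul (p v) (mon u v' w) = if v == v'' then mon u v' w else 0.
Proof.
case: u => [|e u]; [exists v'|exists (src e)] => v1 /=; case: eqP => [->|h].
- exact: proj_monr.
- exact: proj_monr0.
- by rewrite cmulA src_s.
- by rewrite cmulA proj_s // cmul0x.
Qed.

Hypothesis hgen : forall S : set A, closed_star_subalgebra S ->
    (forall e, S (s e)) -> (forall v, S (p v)) -> S = setT.

Let Sp := approx (lspan monset).

Let SpD x y : Sp x -> Sp y -> Sp (x + y).
Proof. by apply: approxD; exact: lspanD. Qed.
Let SpZ (k : R[i]) x : Sp x -> Sp (k *: x).
Proof.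
apply: (approx_map (cabs_ge0 k) (scale_lipschitz k)); exact: lspanZ.
Qed.
Let Sp0 : Sp 0. Proof. by apply: approx_sub; exact: lspan0. Qed.
Let Sp_mon u v w : Sp (mon u v w).
Proof. by apply: approx_sub; apply: lspan_sub; exists u, v, w. Qed.

Let Sp_left a : (forall u v w, Sp (cmul a (mon u v w))) -> forall x, Sp x -> Sp (cmul a x).
Proof.
move=> h x Sx; apply: approx_idem.
apply: approx_map Sx; [exact: (rnorm_ge0 a)|exact: cmulr_lipschitz|].
apply: (lspan_ind2 (S' := [set y | Sp (cmul a y)])) => /=.
- by rewrite cmulx0; exact: Sp0.
- by move=> y z hy hz; rewrite cmulDr; exact: SpD.
- by move=> k y hy; rewrite -cscaleAr; exact: SpZ.
- by move=> _ [u [v [w ->]]]; exact: h.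
Qed.

(** The closed span [Sp] of the monomials is not visibly closed under products. The elements that,
    together with their adjoints, multiply [Sp] into itself form a closed star subalgebra for formal
    reasons, and it suffices that it contains the generators. *)
Let M : set A := [set a | (forall x, Sp x -> Sp (cmul a x)) /\
                          (forall x, Sp x -> Sp (cmul (cstar a) x))].

Let MT : M = setT.
Proof.
apply: hgen.
- split.
  + apply: approx_closed_closed => a aM; split=> x Sx; apply: approx_idem.
      apply: (approx_map (S := M) (F := fun a => cmul a x) (c := rnorm x)) aM => //.
      * exact: rnorm_ge0.
      * by move=> y z; exact: cmull_lipschitz.
      * by move=> y [h _]; exact: h.
    apply: (approx_map (S := M) (F := fun a => cmul (cstar a) x) (c := rnorm x)) aM => //.
    * exact: rnorm_ge0.
    * move=> y z; apply: le_trans (cmull_lipschitz _ _ _) _.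
      by rewrite -cstarB rnorm_star.
    * by move=> y [_ h]; exact: h.
  + by split=> x _; rewrite ?cstar0 cmul0x; exact: Sp0.
  + move=> x y [h1 h2] [h3 h4]; split=> z Sz; rewrite ?cstarD cmulDl; apply: SpD.
    * exact: h1.
    * exact: h3.
    * exact: h2.
    * exact: h4.
  + move=> k x [h1 h2]; split=> z Sz; rewrite ?cstarZ -cscaleAl; apply: SpZ.
      exact: h1.
    exact: h2.
  + move=> x y [h1 h2] [h3 h4]; split=> z Sz; rewrite ?cstarM -cmulA.
      by apply: h1; exact: h3.
    by apply: h4; exact: h2.
  + by move=> x [h1 h2]; split=> //; rewrite cstarK.
(* On a monomial, s_e prolongs the word u. Its adjoint cancels the first letter of u or gives 0;
   when u is empty it is absorbed at the end of w. *)
- move=> e; split; apply: Sp_left => u v w; first exact: (Sp_mon (e :: u)).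
  case: u => [|f u] /=.
    have [->|ve] := pselect (v = src e); first by rewrite sstar_monr; exact: (Sp_mon [::]).
    by rewrite -proj_monr cmulA sstar_proj // cmul0x; exact: Sp0.
  rewrite cmulA; have [<-|ef] := pselect (e = f); last first.
    by rewrite sstar_s // cmul0x; exact: Sp0.
  rewrite (eiso_source hT); have [v' ->] := proj_mon u v w.
  by case: eqP => _; [exact: Sp_mon|exact: Sp0].
- move=> v'; have h x : Sp x -> Sp (cmul (p v') x).
    apply: Sp_left => u v w; have [v'' ->] := proj_mon u v w.
    by case: eqP => _; [exact: Sp_mon|exact: Sp0].
  by split=> //; rewrite (vproj_star hT).
Qed.

Let SpT x : Sp x.
Proof.
have left a y : Sp y -> Sp (cmul a y).
  by have [h _] : M a; [rewrite MT|exact: h].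
(* By [MT], [Sp] is stable under left multiplication by the whole algebra. Intersecting it with the
   set of its adjoints gives a closed star subalgebra containing the generators. *)
suff h : Sp `&` [set x | Sp (cstar x)] = setT.
  by have [] : (Sp `&` [set x | Sp (cstar x)]) x by rewrite h.
apply: hgen.
- split.
  + apply: approx_closed_closed => a aM; split; rewrite /=; apply: approx_idem.
      by move=> e e0; have [y [hy _] ay] := aM _ e0; exists y.
    apply: (approx_map (F := @cstar R A) ler01 (@cstar_lipschitz R A) _ aM).
    by move=> y [_].
  + by split; rewrite /= ?cstar0; exact: Sp0.
  + by move=> y z [h1 h2] [h3 h4]; split; rewrite /= ?cstarD; exact: SpD.
  + by move=> k y [h1 h2]; split; rewrite /= ?cstarZ; exact: SpZ.
  + by move=> y z [h1 h2] [h3 h4]; split; rewrite /= ?cstarM; exact: left.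
  + by move=> y [h1 h2]; split; rewrite /= ?cstarK.
- move=> e; split => /=.
    by rewrite -s_rng; exact: (Sp_mon [:: e] (rng e) [::]).
  by rewrite -rng_sstar; exact: (Sp_mon [::] (rng e) [:: e]).
- by move=> v; split; rewrite /= ?(vproj_star hT); exact: (Sp_mon [::] v [::]).
Qed.

(** Serves as an induction principle: a closed linear property has only to be checked on
    monomials. *)
Lemma mon_dense (S : set A) : approx_closed S -> S 0 ->
  (forall x y, S x -> S y -> S (x + y)) ->
  (forall (k : R[i]) x, S x -> S (k *: x)) ->
  (forall u v w, S (mon u v w)) -> forall x, S x.
Proof.
move=> clS S0 SD SZ Smon x; apply: clS => e e0.
have [y hy xy] := SpT x e0; exists y => //.
by move: y hy {xy}; apply: (lspan_ind2 S0 SD SZ) => _ [u [v [w ->]]]; exact: Smon.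
Qed.

End Toeplitz.

(** * Absolutely convergent complex series and the exponential *)

Section ComplexSeries.
Variable R : realType.
Local Notation C := (R[i] : numFieldType).
Implicit Types (z w : nat -> R[i]).

Definition asum z := exists2 r : nat -> R, forall n, cabs (z n) <= r n & cvgn (series r).

Lemma series_recl (V : zmodType) (u : nat -> V) n :
  series u n.+1 = u 0%N + series (fun k => u k.+1) n.
Proof. by rewrite /series /= big_nat_recl. Qed.

Lemma asum_cvg z : asum z -> (series z : nat -> C) @ \oo --> (csum z : C).
Proof. by move=> [r zr cr]; exact: csum_cvg zr cr. Qed.

Lemma cabs_lim_le (u : nat -> C) (l : C) (B : R) :
  u @ \oo --> l -> (forall n, cabs (u n) <= B) -> cabs l <= B.
Proof.
move=> /cvg_cabs h uB; have <- := cvg_lim (@Rhausdorff R) h.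
by apply: limr_le; [apply/cvg_ex; eexists; exact: h|exact: nearW].
Qed.

Lemma csumD z w : asum z -> asum w -> csum (fun n => z n + w n) = csum z + csum w.
Proof.
move=> /asum_cvg hz /asum_cvg hw; apply: csum_unique.
apply: eq_cvg_seq (cvgD hz hw) => n.
by rewrite /series /= big_split.
Qed.

Lemma csumZ (k : R[i]) z : asum z -> csum (fun n => k * z n) = k * csum z.
Proof.
move=> /asum_cvg hz; apply: csum_unique.
apply: eq_cvg_seq (cvgMl_tmp (a := k : C) hz) => n.
by rewrite /series /= mulr_sumr.
Qed.

Lemma csum_ge0 z : asum z -> (forall n, 0 <= z n) -> 0 <= csum z.
Proof.
move=> /asum_cvg hz z0.
have hR n : z n = (complex.Re (z n))%:C%C by have /ger0_Im := z0 n; case: (z n) => a b /= ->.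
have sIm : csum z = (complex.Re (csum z))%:C%C.
  rewrite /csum /=; congr (_ +i* _)%C; rewrite (_ : series _ = fun=> 0) ?lim_cst //.
  by apply/funext => n; rewrite /series /= big1 // => i _; rewrite hR.
rewrite sIm lecR; have /cvg_lim <- // := cvg_Re hz.
apply: limr_ge; first by apply/cvg_ex; eexists; exact: cvg_Re hz.
apply: nearW => n; rewrite /series /= raddf_sum; apply: sumr_ge0 => i _ /=.
by rewrite -lecR -hR.
Qed.

Lemma csum_single z n : (forall m, m <> n -> z m = 0) -> csum z = z n.
Proof.
move=> h; apply: csum_unique; apply: cvg_near_cst; exists n.+1 => // m /= nm.
rewrite /series /= (bigD1_seq n) ?iota_uniq ?mem_index_iota //= big1 ?addr0 //.
by move=> i /eqP; exact: h.
Qed.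

Lemma csum_shift z : asum z -> csum z = z 0%N + csum (fun n => z n.+1).
Proof.
move=> /asum_cvg; rewrite -cvg_shiftS => hz.
have -> : csum (fun n => z n.+1) = csum z - z 0%N; last by rewrite addrC subrK.
apply: csum_unique.
apply: eq_cvg_seq (cvgB hz (cvg_cst (z 0%N : C))) => n.
by rewrite fctE /= series_recl addrC addKr.
Qed.

Lemma asum_shift z : asum z -> asum (fun n => z n.+1).
Proof.
move=> [r zr cr]; exists (fun n => r n.+1) => //.
apply/cvg_ex; exists (limn (series r) - r 0%N).
have h : (fun n => series r n.+1) @ \oo --> limn (series r) by rewrite cvg_shiftS.
apply: eq_cvg_seq (cvgB h (cvg_cst (r 0%N))) => n.
by rewrite fctE /= series_recl addrC addKr.
Qed.

(** A power series by definition, as [entire] requires; values are computed only on the real axis by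
    [cexp_real] and on the imaginary axis by [cexp_cis]. *)
Definition cexp (x : R[i]) : R[i] := csum (fun k => x ^+ k / k`!%:R).

Lemma cabsX (x : R[i]) n : cabs (x ^+ n) = cabs x ^+ n.
Proof.
elim: n => [|n IH]; last by rewrite !exprS cabsM IH.
by rewrite !expr0 (cabs_real 1) normr1.
Qed.

Lemma cabs_nat n : cabs (n%:R : R[i]) = n%:R.
Proof. by have := cabs_real (n%:R : R); rewrite rmorph_nat normr_nat. Qed.

Lemma cabsV (x : R[i]) : cabs x^-1 = (cabs x)^-1.
Proof. by apply: realC_inj; rewrite fmorphV /= -!cabsE normfV. Qed.

Lemma asum_cexp (x : R[i]) : asum (fun k => x ^+ k / k`!%:R).
Proof.
exists (exp_coeff (cabs x)); last exact: is_cvg_series_exp_coeff.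
by move=> n; rewrite cabsM cabsX cabsV cabs_nat.
Qed.

Lemma cexp_cvg (x : R[i]) :
  (series (fun k => x ^+ k / k`!%:R) : nat -> C) @ \oo --> (cexp x : C).
Proof. exact: asum_cvg (asum_cexp x). Qed.

Lemma cexp_real (x : R) : cexp x%:C%C = (expR x)%:C%C.
Proof.
apply: csum_unique; apply: cvg_cplx => /=.
  apply: eq_cvg_seq (is_cvg_series_exp_coeff x) => n.
  rewrite /series /= raddf_sum; apply: eq_bigr => i _.
  by rewrite -rmorphXn -(rmorph_nat (real_complex R)) -fmorphV -rmorphM.
apply: cvg_near_cst; apply: nearW => n; rewrite raddf_sum big1 // => i _.
by rewrite -rmorphXn -(rmorph_nat (real_complex R)) -fmorphV -rmorphM.
Qed.

Definition cis (t : R) : R[i] := (cos t +i* sin t)%C.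

Lemma cis_coeff (t : R) n : ('i%C * t%:C%C) ^+ n / n`!%:R = (cos_coeff t n +i* sin_coeff t n)%C :> R[i].
Proof.
have -> : ('i%C * t%:C%C) ^+ n / n`!%:R = 'i%C ^+ n * (t ^+ n / n`!%:R)%:C%C :> R[i].
  by rewrite exprMn -rmorphXn -(rmorph_nat (real_complex R)) -mulrA -fmorphV -rmorphM.
have -> : 'i%C ^+ n = (((~~ odd n)%:R * (-1) ^+ n./2) +i* ((odd n)%:R * (-1) ^+ n.-1./2))%C :> R[i].
  rewrite -{1}(odd_double_half n) exprD -mul2n exprM sqr_i.
  have -> : (-1 : R[i]) ^+ n./2 = ((-1) ^+ n./2)%:C%C by rewrite rmorphXn rmorphN rmorph1.
  have [on|en] := boolP (odd n).
    have -> : n.-1./2 = n./2 by case: n on => //= n; rewrite uphalf_half => /negbTE ->.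
    by rewrite expr1 /=; apply/eqP; rewrite eq_complex /=; apply/andP; split; apply/eqP; ring.
  by rewrite expr0 /=; apply/eqP; rewrite eq_complex /=; apply/andP; split; apply/eqP; ring.
rewrite /cos_coeff /sin_coeff /= -?exprnP; apply/eqP; rewrite eq_complex /=.
by apply/andP; split; apply/eqP; ring.
Qed.

Lemma cexp_cis (t : R) : cexp ('i%C * t%:C%C) = cis t.
Proof.
apply: csum_unique; apply: cvg_cplx => /=.
  rewrite cos.unlock; apply: eq_cvg_seq (@is_cvg_series_cos_coeff R t) => n.
  by rewrite /series /= raddf_sum; apply: eq_bigr => i _; rewrite cis_coeff.
rewrite sin.unlock; apply: eq_cvg_seq (@is_cvg_series_sin_coeff R t) => n.
by rewrite /series /= raddf_sum; apply: eq_bigr => i _; rewrite cis_coeff.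
Qed.

Lemma cisD (s t : R) : cis (s + t) = cis s * cis t.
Proof. by rewrite /cis cosD sinD; apply/eqP; rewrite eq_complex /= eqxx addrC eqxx. Qed.
Lemma cis0 : cis 0 = 1.
Proof. by rewrite /cis cos0 sin0. Qed.
Lemma cis_conj (t : R) : (cis t)^* = cis (- t).
Proof. by rewrite /cis cosN sinN. Qed.

(** Identity theorem on the real line. Convergence at t = 1 bounds the coefficients, so for small t
    a first nonzero term would dominate the tail. *)
Lemma power_series_eq0 (h : nat -> R[i]) :
  (forall t : R, (series (fun k => (t%:C%C) ^+ k * h k) : nat -> C) @ \oo --> (0 : C)) ->
  forall k, h k = 0.
Proof.
move=> H.
have [B [B0 hB]] : exists B : R, 0 < B /\ forall k, cabs (h k) <= B.
  have := H 1 => /(cvgP _)/cvg_series_cvg_0 /cvg_cabsP /(_ 1 ltr01) [N _ hN].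
  exists (1 + \sum_(i < N) cabs (h i)); split.
    by rewrite ltr_pwDl // sumr_ge0 // => i _; exact: cabs_ge0.
  move=> k; have [kN|Nk] := ltnP k N.
    rewrite (bigD1 (Ordinal kN)) //= addrCA lerDl.
    by rewrite addr_ge0 // sumr_ge0 // => i _; exact: cabs_ge0.
  apply: (@le_trans _ _ 1); last by rewrite lerDl sumr_ge0 // => i _; exact: cabs_ge0.
  have := hN _ Nk; rewrite /= rmorph1 expr1n mul1r sub0r cabsN; exact: ltW.
apply: ltn_ind => n IH.
apply: cabs0_eq0; apply/eqP; rewrite eq_le cabs_ge0 andbT.
apply/ler_addgt0Pr => e e0; rewrite add0r.
(* The bound 1/2 keeps the geometric sum below 2, and e / (2 B) makes the tail bound 2 B t^(n+1) at
   most t^n e. *)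
pose t : R := Num.min (1/2) (e / (2 * B)).
have t0 : 0 < t by rewrite lt_min !divr_gt0 // mulr_gt0.
have t12 : t <= 1/2 by rewrite ge_min lexx.
have te : t * (2 * B) <= e by rewrite -ler_pdivlMr ?mulr_gt0 // ge_min lexx orbT.
(* h_n t^n = - (tail), and the tail is at most B t^{n+1} / (1 - t). *)
have key m : cabs (series (fun k => (t%:C%C) ^+ k * h k) (n.+1 + m)%N - t%:C%C ^+ n * h n)
    <= t ^+ n * e.
  have -> : series (fun k => (t%:C%C) ^+ k * h k) (n.+1 + m)%N - t%:C%C ^+ n * h n =
      \sum_(0 <= i < m) t%:C%C ^+ (n.+1 + i) * h (n.+1 + i)%N.
    rewrite /series /= (big_cat_nat (n := n.+1)) ?leq_addr //=.
    rewrite big_nat_recr //= big_nat_cond big1 ?add0r; last first.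
      by move=> i /andP[/andP[_ hi] _]; rewrite IH // mulr0.
    rewrite addrAC subrr add0r -{1}[n.+1]addn0 [(n.+1 + m)%N]addnC -[(n.+1+0)%N]add0n.
    rewrite addn0 big_addn addnK; apply: eq_bigr => i _.
    by rewrite addnC.
  have le_m : cabs (\sum_(0 <= i < m) t%:C%C ^+ (n.+1 + i) * h (n.+1 + i)%N) <=
      t ^+ n.+1 * B * \sum_(0 <= i < m) t ^+ i.
    elim: m => [|m IHm]; first by rewrite !big_geq // cabs0 mulr0.
    rewrite !big_nat_recr //= mulrDr; apply: le_trans (cabsD _ _) _.
    apply: lerD => //; rewrite cabsM cabsX cabs_real ger0_norm ?(ltW t0) //.
    rewrite exprD mulrAC; apply: ler_wpM2r; first by rewrite exprn_ge0 ?(ltW t0).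
    by apply: ler_wpM2l; rewrite ?exprn_ge0 ?(ltW t0).
  apply: le_trans le_m _.
  have s2 : \sum_(0 <= i < m) t ^+ i <= 2.
    elim: m => [|m IHm]; first by rewrite big_geq.
    rewrite big_nat_recl //= expr0; under eq_bigr do rewrite exprS.
    rewrite -mulr_sumr; have : 0 <= \sum_(0 <= i < m) t ^+ i.
      by apply: sumr_ge0 => i _; rewrite exprn_ge0 // ltW.
    by nra.
  rewrite exprS -!mulrA mulrCA ler_pM2l ?exprn_gt0 //.
  apply: le_trans te; rewrite ler_pM2l // [2 * B]mulrC.
  by apply: ler_wpM2l => //; exact: ltW.
have lim : cabs (0 - t%:C%C ^+ n * h n) <= t ^+ n * e.
  have := H t; rewrite -(cvg_shiftn n.+1) => h1.
  apply: (cabs_lim_le (cvgB h1 (cvg_cst (t%:C%C ^+ n * h n : C)))) => m.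
  by rewrite fctE /= addnC; exact: key.
move: lim; rewrite sub0r cabsN cabsM cabsX cabs_real ger0_norm ?(ltW t0) //.
by rewrite ler_pM2l // exprn_gt0.
Qed.

End ComplexSeries.

(** * The gauge action and the vanishing properties of ground states *)

Section Dynamics.
Variables (R : realType) (E : graph) (A : cstarAlg R).
Variables (s : edge E -> A) (p : vert E -> A).
Hypothesis hT : toeplitz_family s p.
Variable sigma : R -> A -> A.
Hypothesis hs : gauge_dynamics s p sigma.
Local Notation C := (R[i] : numFieldType).

Let hom_sigma t := gauge_hom hs t.

Definition homogeneous (d : R) (x : A) : Prop := forall t, sigma t x = cis (d * t) *: x.

Lemma homM d d' x y : homogeneous d x -> homogeneous d' y ->
  homogeneous (d + d') (cmul x y).
Proof.
move=> hx hy t; rewrite (star_homM (hom_sigma t)) hx hy -cscaleAl -cscaleAr scalerA.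
by rewrite -cisD mulrDl.
Qed.
Lemma hom_star d x : homogeneous d x -> homogeneous (- d) (cstar x).
Proof.
by move=> hx t; rewrite (star_hom_star (hom_sigma t)) hx cstarZ cis_conj mulNr.
Qed.
Lemma hom_s e : homogeneous 1 (s e).
Proof. by move=> t; rewrite (gauge_edge hs) mul1r. Qed.
Lemma hom_sstar e : homogeneous (-1) (cstar (s e)).
Proof. exact: hom_star (hom_s e). Qed.
Lemma hom_p v : homogeneous 0 (p v).
Proof. by move=> t; rewrite (gauge_vert hs) mul0r cis0 scale1r. Qed.

Definition degree (u w : seq (edge E)) : R := (size u)%:R - (size w)%:R.

Lemma degree_consl e u w : degree (e :: u) w = 1 + degree u w.
Proof. by rewrite /degree /= -natr1; ring. Qed.
Lemma degree_consr e w : degree [::] (e :: w) = degree [::] w + (-1).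
Proof. by rewrite /degree /= -natr1; ring. Qed.

Lemma hom_mon u v w : homogeneous (degree u w) (mon s p u v w).
Proof.
elim: u => [|e u IH] /=.
  elim: w => [|e w IH] /=; first by rewrite /degree subrr; exact: hom_p.
  by rewrite degree_consr; apply: homM => //; exact: hom_sstar.
by rewrite degree_consl; apply: homM => //; exact: hom_s.
Qed.

Definition hom_ext (d : R) (x : A) (z : R[i]) : A := cexp ('i%C * d%:C%C * z) *: x.

Lemma hom_analytic d x : homogeneous d x -> analytic_extension sigma x (hom_ext d x).
Proof.
move=> hx; split; last first.
  by move=> t; rewrite /hom_ext hx -mulrA -rmorphM /= cexp_cis.
exists (fun k => (('i%C * d%:C%C) ^+ k / k`!%:R) *: x) => z.
apply/cvg_rnormP => e e0.
have [x0|xn0] := eqVneq (rnorm x) 0.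
  apply: nearW => n; rewrite (rnorm0_eq0 x0) /hom_ext scaler0 sub0r rnormN.
  by rewrite /series /= big1 ?rnorm0 // => i _; rewrite !scaler0.
have xp : 0 < rnorm x by rewrite lt_def xn0 rnorm_ge0.
have /cvg_cabsP/(_ _ (divr_gt0 e0 xp)) := @cexp_cvg R ('i%C * d%:C%C * z).
apply: filterS => n hn.
have -> : series (fun k => z ^+ k *: (('i%C * d%:C%C) ^+ k / k`!%:R *: x)) n =
    series (fun k => ('i%C * d%:C%C * z) ^+ k / k`!%:R) n *: x.
  rewrite /series /= scaler_suml; apply: eq_bigr => i _; rewrite scalerA; congr (_ *: _).
  by rewrite [in RHS]exprMn mulrC mulrAC.
by rewrite /hom_ext -scalerBl rnormZ -ltr_pdivlMr.
Qed.

Lemma mon_analytic u v w : analytic_elt sigma (mon s p u v w).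
Proof. by eexists; apply: hom_analytic; exact: hom_mon. Qed.

Section Functionals.
Hypothesis hgen : forall S : set A, closed_star_subalgebra S ->
    (forall e, S (s e)) -> (forall v, S (p v)) -> S = setT.

(** Applied to the difference of the two sides of an identity, which then has only to be verified on
    monomials. *)
Lemma lipschitz_mon_eq0 (G : A -> R[i]) (c : R) : 0 <= c ->
  (forall x y, G (x + y) = G x + G y) -> (forall (k : R[i]) x, G (k *: x) = k * G x) ->
  (forall x, cabs (G x) <= c * rnorm x) ->
  (forall u v w, G (mon s p u v w) = 0) -> forall x, G x = 0.
Proof.
move=> c0 GD GZ Gc Gm.
apply: (mon_dense hT hgen (S := [set x | G x = 0])) => //=.
- move=> x ax; apply: cabs0_eq0; apply/eqP; rewrite eq_le cabs_ge0 andbT.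
  apply/ler_addgt0Pr => e e0; rewrite add0r.
  have c1 : 0 < c + 1 by rewrite ltr_wpDl.
  have [y Gy xy] := ax _ (divr_gt0 e0 c1).
  have -> : G x = G (x - y) by rewrite GD -scaleN1r GZ Gy mulr0 addr0.
  apply: le_trans (Gc _) _; move: xy; rewrite ltr_pdivlMr // mulrDr mulr1 mulrC => xy.
  by have := rnorm_ge0 (x - y); lra.
- by rewrite -(scale0r 0) GZ mul0r.
- by move=> x y /= Gx Gy; rewrite GD Gx Gy addr0.
- by move=> k x /= Gx; rewrite GZ Gx mulr0.
Qed.

Variable psi : {scalar A}.
Hypothesis gpsi : ground_state sigma psi.

Lemma ground_posf : posf 1 (psi : A -> R[i]).
Proof.
have [[h1 h2 h3] _] := gpsi; split.
- exact: ler01.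
- exact: raddfD.
- by move=> k x; exact: (linearZ_LR psi).
- exact: h1.
- by move=> x; rewrite mul1r -lecR -cabsE -rnormE.
Qed.
Let pf := ground_posf.

(** The adjoint of s_e has degree -1, so sigma at i y multiplies it by exp y; boundedness on the
    upper half plane forces the value 0. The factor x must be analytic for this, whence the
    reduction to monomials. *)
Lemma ground_sstar e x : psi (cmul x (cstar (s e))) = 0.
Proof.
move: x; apply: (lipschitz_mon_eq0 (c := rnorm (s e))) => [|x y|k x|x|u v w].
- exact: rnorm_ge0.
- by rewrite cmulDl (posfD pf).
- by rewrite -cscaleAl (posfZ pf).
- apply: le_trans (posf_bd pf _) _; rewrite mul1r; apply: le_trans (rnormM _ _) _.
  by rewrite rnorm_star mulrC.
have [_ /(_ (mon s p u v w) _ _ (mon_analytic u v w) (hom_analytic (hom_sstar e)))] := gpsi.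
move=> [M hM]; apply: cabs0_eq0; apply/eqP; rewrite eq_le cabs_ge0 andbT leNgt.
apply/negP => c0; set c := cabs _ in c0.
have key (y : R) : 0 < y -> c * y <= M.
  move=> y0; have := hM 0 y y0; rewrite /hom_ext -cscaleAr (posfZ pf).
  have -> : 'i%C * (-1)%:C%C * (0 +i* y)%C = y%:C%C :> R[i].
    by apply/eqP; rewrite eq_complex /=; apply/andP; split; apply/eqP; ring.
  rewrite cexp_real cabsE lecR cabsM cabs_real ger0_norm ?expR_ge0 // -/c.
  apply: le_trans; rewrite mulrC; apply: ler_wpM2r; first exact: ltW.
  by have := expR_ge1Dx y; lra.
have M0 : 0 < M + 1.
  by have := key 1 ltr01; have := c0; lra.
have := key _ (divr_gt0 M0 c0); rewrite mulrC divfK ?gt_eqF //; lra.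
Qed.

Lemma ground_s e x : psi (cmul (s e) x) = 0.
Proof.
by rewrite -[s e]cstarK (posf_herm pf) ground_sstar conjC0.
Qed.

(** On a monomial with a nonempty word both sides vanish because psi kills s_e on the left and its
    adjoint on the right; what remains are products of vertex projections. *)
Lemma ground_central v x : psi (cmul (p v) x) = psi (cmul x (p v)).
Proof.
apply/eqP; rewrite -subr_eq0; apply/eqP; move: x.
apply: (lipschitz_mon_eq0 (c := 2)) => [//|x y|k x|x|u v' w].
- by rewrite cmulDl cmulDr !(posfD pf) opprD addrACA.
- by rewrite -cscaleAl -cscaleAr !(posfZ pf) mulrBr.
- apply: le_trans (cabsD _ _) _; rewrite cabsN mulrDl mul1r.
  have le1 y : rnorm y <= rnorm x -> cabs (psi y) <= rnorm x.
    by move=> h; apply: le_trans (posf_bd pf _) _; rewrite mul1r.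
  apply: lerD; apply: le1; apply: le_trans (rnormM _ _) _.
    by rewrite -[leRHS]mul1r; apply: ler_wpM2r (proj_rnorm hT v); exact: rnorm_ge0.
  by rewrite -[leRHS]mulr1; apply: ler_wpM2l (proj_rnorm hT v); exact: rnorm_ge0.
case: u => [|e u] /=; last first.
  rewrite -cmulA ground_s subr0; have [->|ve] := pselect (v = src e).
    by rewrite cmulA (src_s hT) ground_s.
  by rewrite cmulA (proj_s hT) // cmul0x (posf0 pf).
case: w => [|e w] /=.
  have [->|vv] := pselect (v = v'); first by rewrite subrr.
  by rewrite !(vproj_orth hT) ?subrr //; exact: nesym.
rewrite cmulA ground_sstar sub0r -cmulA.
have [->|ve] := pselect (v = src e).
  by rewrite (sstar_src hT) ground_sstar oppr0.
by rewrite (sstar_proj hT) // cmulx0 (posf0 pf) oppr0.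
Qed.

End Functionals.
End Dynamics.

(** * KMS states near a ground state *)

Section KMS.
Variables (R : realType) (A : cstarAlg R).
Variables (s : edge loop_ray -> A) (p : vert loop_ray -> A).
Hypothesis hT : toeplitz_family s p.
Local Notation C := (R[i] : numFieldType).
Implicit Types (f : A -> R[i]) (c : R).

Lemma asum_bound (z : nat -> R[i]) (r : nat -> R) (B : R) :
  (forall n, cabs (z n) <= r n) -> (forall n, series r n <= B) -> asum z /\ cabs (csum z) <= B.
Proof.
move=> zr rB; have r0 n : 0 <= r n by apply: le_trans (zr n); exact: cabs_ge0.
have cr : cvgn (series r).
  apply: nondecreasing_is_cvgn; first exact: nondecreasing_series.
  by exists B => _ [n _ <-].
split; first by exists r.
apply: le_trans (csum_norm_le zr cr) _; apply: limr_le => //; exact: nearW.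
Qed.

(** The part of the KMS condition that concerns the vertex projections, which have degree 0; it is
    the input of [transfer_s]. *)
Definition central f := forall v x, f (cmul (p v) x) = f (cmul x (p v)).

Definition compress f e x := f (cmul (cmul (cstar (s e)) x) (s e)).

(* The dual of x |-> sum_e s_e^* x s_e; on the functions v |-> f (p v) it acts by
   (A m) v = sum of m (r e) over the edges e starting at v. *)
Definition transfer f x : R[i] :=
  csum (fun n => compress f (inl n) x + compress f (inr n) x).

(** Stands in for a unit: by [psum_cvg] these projections form an approximate unit. *)
Definition psum n : A := \sum_(0 <= i < n) p i.

Lemma psum_star n : cstar (psum n) = psum n.
Proof.
rewrite /psum; elim: n => [|n IH]; first by rewrite big_geq // cstar0.
by rewrite big_nat_recr //= cstarD IH (vproj_star hT).
Qed.

Lemma psum_proj n (v : nat) : cmul (psum n) (p v) = if (v < n)%N then p v else 0.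
Proof.
rewrite /psum; elim: n => [|n IH]; first by rewrite big_geq // cmul0x.
rewrite big_nat_recr //= cmulDl IH ltnS [(v <= n)%N]leq_eqVlt.
have [->|vn] := eqVneq v n; first by rewrite ltnn add0r /= (vproj_idem hT).
by rewrite /= (vproj_orth hT) ?addr0 // => /esym/eqP; apply/negP.
Qed.

Lemma psum_idem n : cmul (psum n) (psum n) = psum n.
Proof.
suff h m : (m <= n)%N -> cmul (psum n) (psum m) = psum m by exact: h.
elim: m => [|m IH] mn; first by rewrite {2 3}/psum !big_geq // cmulx0.
rewrite {2 3}/psum !big_nat_recr //= cmulDr -/(psum m) IH ?(ltnW mn) //.
by rewrite psum_proj mn.
Qed.

Lemma psum_rnorm n : rnorm (psum n) <= 1.
Proof. exact: proj_norm (psum_star n) (psum_idem n). Qed.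

Section Transfer.
Variables (c : R) (f : A -> R[i]).
Hypothesis pf : posf c f.

Let rho v := complex.Re (f (p v)).

Lemma rho_ge0 v : 0 <= rho v.
Proof. by have := posf_Re_ge0 pf (p v); rewrite (vproj_star hT) (vproj_idem hT). Qed.

Lemma rho_series n : series rho n = complex.Re (f (psum n)).
Proof.
rewrite /series /psum /=; elim: n => [|n IH]; first by rewrite !big_geq // (posf0 pf).
by rewrite !big_nat_recr //= IH (posfD pf) raddfD.
Qed.

Lemma rho_le n : series rho n <= c.
Proof.
rewrite rho_series.
apply: le_trans (ler_norm _) _; apply: le_trans (cabs_Re _) _.
apply: le_trans (posf_bd pf _) _; rewrite -[leRHS]mulr1.
by apply: ler_wpM2l (psum_rnorm n); exact: posf_c pf.
Qed.

Let r (x : A) (n : nat) : R := (rho n + rho n.+1) * rnorm x.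

(** The compressed element lies in the corner of p at r(e), so [posf_conj_proj] yields the factor f
    (p (r e)). Unlike the global bound c, this is summable over the edges. *)
Lemma compress_le e x : cabs (compress f e x) <= rho (rng e) * rnorm x.
Proof.
rewrite /compress; set y := cmul _ _.
have -> : y = cmul (cmul (p (rng e)) y) (p (rng e)).
  by rewrite /y !cmulA (rng_sstar hT) -[in RHS]cmulA (s_rng hT).
apply: le_trans (posf_conj_proj pf y (vproj_star hT _) (vproj_idem hT _)) _.
apply: ler_wpM2l; first exact: rho_ge0.
rewrite /y.
apply: le_trans (rnormM _ _) _; rewrite -[leRHS]mulr1.
apply: ler_pM (s_rnorm hT e); rewrite ?rnorm_ge0 //.
apply: le_trans (rnormM _ _) _; rewrite -[leRHS]mul1r rnorm_star.
by apply: ler_wpM2r (s_rnorm hT e); exact: rnorm_ge0.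
Qed.

(** The factor 2 counts the edges entering a vertex: v_n receives e_n and, for n > 0, also
    f_(n-1). *)
Lemma transfer_asum x :
  asum (fun n => compress f (inl n) x + compress f (inr n) x) /\
  cabs (transfer f x) <= 2 * c * rnorm x.
Proof.
apply: (asum_bound (r := r x)) => [n|n].
  rewrite /r mulrDl; apply: le_trans (cabsD _ _) _.
  by apply: lerD; exact: compress_le.
have -> : series (r x) n = (series rho n + series (fun k => rho k.+1) n) * rnorm x.
  by rewrite /series /= -big_split /= mulr_suml.
apply: ler_wpM2r; first exact: rnorm_ge0.
rewrite mulr_natl mulr2n; apply: lerD; first exact: rho_le.
apply: le_trans (rho_le n.+1); rewrite series_recl lerDr; exact: rho_ge0.
Qed.

Lemma compressD e x y : compress f e (x + y) = compress f e x + compress f e y.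
Proof. by rewrite /compress cmulDr cmulDl (posfD pf). Qed.
Lemma compressZ e k x : compress f e (k *: x) = k * compress f e x.
Proof. by rewrite /compress -cscaleAr -cscaleAl (posfZ pf). Qed.

Lemma transfer_posf : posf (2 * c) (transfer f).
Proof.
split.
- by rewrite mulr_ge0 // (posf_c pf).
- move=> x y; have [hx _] := transfer_asum x; have [hy _] := transfer_asum y.
  rewrite /transfer -csumD //; congr csum; apply/funext => n.
  by rewrite !compressD addrACA.
- move=> k x; have [hx _] := transfer_asum x.
  rewrite /transfer -csumZ //; congr csum; apply/funext => n.
  by rewrite !compressZ mulrDr.
- move=> x; have [hx _] := transfer_asum (cmul (cstar x) x).
  apply: csum_ge0 => // n.
  have h e : 0 <= compress f e (cmul (cstar x) x).
    by rewrite /compress cmulA -cstarM -cmulA; exact: posf_ge0 pf _.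
  by rewrite addr_ge0.
- by move=> x; have [] := transfer_asum x.
Qed.

Lemma transfer_central : central (transfer f).
Proof.
move=> v x; congr csum; apply/funext => n.
have h e : compress f e (cmul (p v) x) = compress f e (cmul x (p v)).
  rewrite /compress cmulA -[in RHS]cmulA -[in RHS]cmulA.
  have [->|ve] := pselect (v = src e); first by rewrite (sstar_src hT) (src_s hT) cmulA.
  by rewrite (sstar_proj hT) // (proj_s hT) // !cmulx0 !cmul0x.
by rewrite !h.
Qed.

(** One-step form of the KMS relation. Orthogonality of the ranges leaves only the term of e, and
    centrality moves the projection s_e^* s_e past a. *)
Lemma transfer_s (fc : central f) e a : transfer f (cmul (s e) a) = f (cmul a (s e)).
Proof.
have h e' : compress f e' (cmul (s e) a) = if e' == e then f (cmul a (s e)) else 0.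
  rewrite /compress cmulA; case: eqP => [->|ne].
    by rewrite (eiso_source hT) -cmulA fc -cmulA (s_rng hT).
  by rewrite (sstar_s hT ne) !cmul0x (posf0 pf).
rewrite /transfer; case: e h => n h.
  rewrite (csum_single (n := n)) ?h ?eqxx ?addr0 // => m /eqP/negbTE mn.
  by rewrite !h [inl m == _]mn (_ : (inr m == inl n :> edge loop_ray) = false) // addr0.
rewrite (csum_single (n := n)) ?h ?eqxx ?add0r // => m /eqP/negbTE mn.
by rewrite !h [inr m == _]mn (_ : (inl m == inr n :> edge loop_ray) = false) // addr0.
Qed.

End Transfer.

Section Mass.
Variables (c : R) (f : A -> R[i]).
Hypothesis pf : posf c f.
Hypothesis hgen : forall S : set A, closed_star_subalgebra S ->
    (forall e, S (s e)) -> (forall v, S (p v)) -> S = setT.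

(** A monomial is fixed by a single vertex projection, hence by every later partial sum; the
    property is closed and linear. *)
Lemma psum_cvg x (e : R) : 0 < e -> exists N, forall n, (N <= n)%N ->
  rnorm (x - cmul (psum n) x) < e.
Proof.
move: x e; apply: (mon_dense hT hgen (S := [set x | forall e : R, 0 < e ->
  exists N, forall n, (N <= n)%N -> rnorm (x - cmul (psum n) x) < e])).
- move=> x ax e e0; have e3 : 0 < e / 3 by rewrite divr_gt0.
  have [y hy xy] := ax _ e3; have [N hN] := hy _ e3; exists N => n Nn.
  have -> : x - cmul (psum n) x = (x - y) + (y - cmul (psum n) y) + cmul (psum n) (y - x).
    by rewrite cmulBr !addrA !subrK.
  have -> : e = e / 3 + e / 3 + e / 3 by field.
  apply: le_lt_trans (rnormD _ _) _; apply: ltr_leD.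
    by apply: le_lt_trans (rnormD _ _) _; apply: ltrD => //; exact: hN.
  apply: le_trans (rnormM _ _) _; apply: le_trans (ltW xy); rewrite rnormB -[leRHS]mul1r.
  by apply: ler_wpM2r (psum_rnorm n); exact: rnorm_ge0.
- by move=> e e0; exists 0%N => n _; rewrite cmulx0 subrr rnorm0.
- move=> x y hx hy e e0; have e2 : 0 < e / 2 by rewrite divr_gt0.
  have [N hN] := hx _ e2; have [M hM] := hy _ e2; exists (maxn N M) => n.
  rewrite geq_max => /andP[Nn Mn]; rewrite cmulDr opprD addrACA [e]splitr.
  by apply: le_lt_trans (rnormD _ _) _; apply: ltrD; [exact: hN|exact: hM].
- move=> k x hx e e0; have k1 : 0 < cabs k + 1 by rewrite ltr_wpDl ?cabs_ge0.
  have [N hN] := hx _ (divr_gt0 e0 k1); exists N => n Nn.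
  rewrite -cscaleAr -scalerBr rnormZ; have := hN n Nn.
  rewrite ltr_pdivlMr //; set t := rnorm _; have : 0 <= t by exact: rnorm_ge0.
  by have := cabs_ge0 k; nra.
- move=> u v w e e0.
  have h (m : nat) x : cmul (p m) x = x -> exists N, forall n, (N <= n)%N ->
      rnorm (x - cmul (psum n) x) < e.
    move=> hx; exists m.+1 => n mn.
    by rewrite -hx cmulA psum_proj mn subrr rnorm0.
  case: u => [|e' u] /=; first by apply: (h v); exact: proj_monr.
  by apply: (h (src e')); rewrite cmulA (src_s hT).
Qed.

(** Replaces the a priori constant c by the mass along the approximate unit: x is approximated by P
    x P, where [posf_conj_proj] is sharp. *)
Lemma mass_bound (M : R) : (forall n, complex.Re (f (psum n)) <= M) ->
  forall x, cabs (f x) <= M * rnorm x.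
Proof.
move=> hM x; apply/ler_addgt0Pr => e e0.
have c0 := posf_c pf; have c1 : 0 < c + 1 by rewrite ltr_wpDl.
have d0 : 0 < e / (c + 1) / 2 by rewrite !divr_gt0.
have [N hN] := psum_cvg x d0; have [N' hN'] := psum_cvg (cstar x) d0.
set n := maxn N N'; set P := psum n.
have h1 : rnorm (x - cmul P x) < e / (c + 1) / 2 by apply: hN; rewrite leq_maxl.
have h2 : rnorm (x - cmul x P) < e / (c + 1) / 2.
  by rewrite -rnorm_star cstarB cstarM psum_star; apply: hN'; rewrite leq_maxr.
have -> : f x = f (cmul (cmul P x) P) + f (x - cmul (cmul P x) P).
  by rewrite -(posfD pf) addrC subrK.
apply: le_trans (cabsD _ _) _; apply: lerD.
  apply: le_trans (posf_conj_proj pf x (psum_star n) (psum_idem n)) _.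
  by apply: ler_wpM2r; [exact: rnorm_ge0|exact: hM].
apply: le_trans (posf_bd pf _) _.
have h3 : rnorm (x - cmul (cmul P x) P) <= e / (c + 1).
  have -> : x - cmul (cmul P x) P = (x - cmul P x) + cmul P (x - cmul x P).
    by rewrite cmulBr cmulA !addrA !subrK.
  rewrite [leRHS]splitr; apply: le_trans (rnormD _ _) _; apply: lerD; first exact: ltW.
  apply: le_trans (rnormM _ _) _; apply: le_trans (ltW h2); rewrite -[leRHS]mul1r.
  by apply: ler_wpM2r (psum_rnorm n); exact: rnorm_ge0.
apply: (@le_trans _ _ (c * (e / (c + 1)))); first exact: ler_wpM2l.
rewrite mulrA ler_pdivrMr // [e * _]mulrC; apply: ler_wpM2r; [exact: ltW|lra].
Qed.

End Mass.
End KMS.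

Lemma conj_realC (R : realType) (x : R) : (x%:C%C : R[i])^* = x%:C%C.
Proof. by apply/eqP; rewrite eq_complex /= oppr0 !eqxx. Qed.

Lemma mk_scalar (R : realType) (A : cstarAlg R) (f : A -> R[i]) :
  (forall x y, f (x + y) = f x + f y) -> (forall (k : R[i]) x, f (k *: x) = k * f x) ->
  exists g : {scalar A}, forall x, g x = f x.
Proof.
move=> fD fZ.
have fl : linear_for *%R (f : A -> (R[i] : numFieldType)) by move=> k x y; rewrite fD fZ.
pose m := GRing.isLinear.Build _ _ _ _ f fl.
pose g : {scalar A} := HB.pack (f : A -> (R[i] : numFieldType)) m.
by exists g.
Qed.

Section Potential.
Variables (R : realType) (A : cstarAlg R).
Variables (s : edge loop_ray -> A) (p : vert loop_ray -> A).
Hypothesis hT : toeplitz_family s p.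
Hypothesis hgen : forall S : set A, closed_star_subalgebra S ->
    (forall e, S (s e)) -> (forall v, S (p v)) -> S = setT.
Variable sigma : R -> A -> A.
Hypothesis hs : gauge_dynamics s p sigma.
Variable psi : {scalar A}.
Hypothesis gpsi : ground_state sigma psi.
Variable q : R.
Hypotheses (q0 : 0 < q) (q2 : 2 * q < 1).
Local Notation C := (R[i] : numFieldType).

Let theta j : A -> R[i] := iter j (transfer s) (psi : A -> R[i]).

Lemma theta_posf j : posf (2 ^+ j) (theta j).
Proof.
elim: j => [|j IH]; first by rewrite expr0; exact: ground_posf gpsi.
by rewrite exprS; exact: (transfer_posf hT IH).
Qed.

Lemma theta_central j : central p (theta j).
Proof.
case: j => [|j]; first exact: (ground_central hT hs hgen gpsi).
exact: (transfer_central hT).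
Qed.

(* The sum over all paths u of q^|u| psi (s_u^* x s_u). *)
Definition potential x := csum (fun j => (q ^+ j)%:C%C * theta j x).

Let d := 2 * q.
Let d0 : 0 <= d. Proof. by apply: mulr_ge0 => //; exact: ltW. Qed.

Lemma geo_le n : series (fun j => d ^+ j) n <= (1 - d)^-1.
Proof.
have d1 : 0 < 1 - d by rewrite subr_gt0.
rewrite -[leRHS]mul1r ler_pdivlMr // /series /=.
have -> : (\sum_(0 <= j < n) d ^+ j) * (1 - d) = 1 - d ^+ n.
  elim: n => [|n IH]; first by rewrite big_geq // mul0r expr0 subrr.
  by rewrite big_nat_recr //= mulrDl IH exprSr; ring.
by rewrite gerBl exprn_ge0.
Qed.

Lemma potential_term x j : cabs ((q ^+ j)%:C%C * theta j x) <= d ^+ j * rnorm x.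
Proof.
rewrite cabsM cabs_real ger0_norm ?exprn_ge0 ?(ltW q0) // exprMn [2 ^+ j * _]mulrC -mulrA.
apply: ler_wpM2l; first by rewrite exprn_ge0 ?(ltW q0).
exact: posf_bd (theta_posf j) x.
Qed.

Lemma potential_asum x : asum (fun j => (q ^+ j)%:C%C * theta j x) /\
  cabs (potential x) <= (1 - d)^-1 * rnorm x.
Proof.
apply: (asum_bound (potential_term x)) => n.
have -> : series (fun j => d ^+ j * rnorm x) n = series (fun j => d ^+ j) n * rnorm x.
  by rewrite /series /= mulr_suml.
by apply: ler_wpM2r; [exact: rnorm_ge0|exact: geo_le].
Qed.

Lemma potential_posf : posf (1 - d)^-1 potential.
Proof.
split.
- by rewrite invr_ge0 subr_ge0 ltW.
- move=> x y; have [hx _] := potential_asum x; have [hy _] := potential_asum y.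
  rewrite /potential -csumD //; congr csum; apply/funext => n.
  by rewrite (posfD (theta_posf n)) mulrDr.
- move=> k x; have [hx _] := potential_asum x.
  rewrite /potential -csumZ //; congr csum; apply/funext => n.
  by rewrite (posfZ (theta_posf n)) mulrCA.
- move=> x; have [hx _] := potential_asum (cmul (cstar x) x).
  apply: csum_ge0 => // n; rewrite mulr_ge0 ?lecR ?exprn_ge0 ?(ltW q0) //.
  exact: posf_ge0 (theta_posf n) x.
- by move=> x; have [] := potential_asum x.
Qed.
Let pf := potential_posf.

(** The term of index 0 is psi itself and the others form a geometric tail of ratio d. *)
Lemma potential_near x : cabs (potential x - psi x) <= d / (1 - d) * rnorm x.
Proof.
have [hx _] := potential_asum x.
rewrite /potential (csum_shift hx) expr0 mul1r addrAC subrr add0r.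
apply: (asum_bound (r := fun j => d ^+ j.+1 * rnorm x) _ _).2 => n.
  exact: potential_term.
have -> : series (fun j => d ^+ j.+1 * rnorm x) n = d * series (fun j => d ^+ j) n * rnorm x.
  rewrite /series /= mulr_sumr mulr_suml; apply: eq_bigr => i _.
  by rewrite exprS.
apply: ler_wpM2r; first exact: rnorm_ge0.
by apply: ler_wpM2l => //; exact: geo_le.
Qed.

Lemma potential_central : central p potential.
Proof. by move=> v x; congr csum; apply/funext => n; rewrite theta_central. Qed.

(** The term of index 0 vanishes because psi kills s_e on the left; by [transfer_s] the others are
    those on the right shifted by one index, which costs one factor q. *)
Lemma potential_s e x : potential (cmul (s e) x) = q%:C%C * potential (cmul x (s e)).
Proof.
have [h1 _] := potential_asum (cmul (s e) x).
have [h2 _] := potential_asum (cmul x (s e)).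
rewrite /potential (csum_shift h1) /theta /= (ground_s hT hs hgen gpsi) mulr0 add0r.
rewrite -csumZ //; congr csum; apply/funext => n.
rewrite (transfer_s hT (theta_posf n) (theta_central n)).
by rewrite exprS rmorphM mulrA.
Qed.

Lemma potential_sstar e x :
  q%:C%C * potential (cmul (cstar (s e)) x) = potential (cmul x (cstar (s e))).
Proof.
rewrite (posf_herm pf (s e) x) -{2}[x]cstarK (posf_herm pf (cstar x)) cstarK.
by rewrite potential_s rmorphM /= conj_realC.
Qed.

(** The KMS condition for b homogeneous of degree dg, with the dynamics moved from a onto b: for q =
    exp (- beta) the factor is exp (beta dg). The degree may be negative, hence the real power. *)
Definition kms_rel (dg : R) (b : A) : Prop :=
  forall a, potential (cmul a b) = (q `^ (- dg))%:C%C * potential (cmul b a).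

Lemma kms_relM dg dg' b b' : kms_rel dg b -> kms_rel dg' b' ->
  kms_rel (dg + dg') (cmul b b').
Proof.
move=> hb hb' a; rewrite cmulA hb' cmulA hb mulrA -rmorphM /= -cmulA.
congr (_%:C%C * _); rewrite opprD addrC powRD //.
by rewrite (gt_eqF q0) /= implybT.
Qed.

Lemma kms_rel_mon u v w : kms_rel (degree R (E := loop_ray) u w) (mon s p u v w).
Proof.
have hp : kms_rel 0 (p v).
  by move=> a; rewrite oppr0 powRr0 mul1r potential_central.
have hse e : kms_rel 1 (s e).
  move=> a; rewrite potential_s mulrA -rmorphM /= powR_inv1 ?(ltW q0) //.
  by rewrite mulVf ?(gt_eqF q0) // mul1r.
have hss e : kms_rel (-1) (cstar (s e)).
  by move=> a; rewrite opprK powRr1 ?(ltW q0) // potential_sstar.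
elim: u => [|e u IH] /=.
  elim: w => [|e w IH] /=; first by rewrite /degree subrr.
  by rewrite degree_consr; apply: kms_relM.
by rewrite degree_consl; apply: kms_relM.
Qed.

(** Only monomials of degree dg different from 0 matter. Such an x is fixed by some p_v, so
    centrality and [kms_rel] give potential x = q^(- dg) potential x, and q < 1 forces 0. *)
Lemma potential_sigma t x : potential (sigma t x) = potential x.
Proof.
have hom := gauge_hom hs t.
apply/eqP; rewrite -subr_eq0; apply/eqP; move: x.
apply: (lipschitz_mon_eq0 hT hgen (c := 2 * (1 - d)^-1)) => [|x y|k x|x|u v w].
- by rewrite mulr_ge0 // (posf_c pf).
- by rewrite (star_homD hom) !(posfD pf) opprD addrACA.
- by rewrite (star_homZ hom) !(posfZ pf) mulrBr.
- apply: le_trans (cabsD _ _) _; rewrite cabsN -mulrA mulr_natl mulr2n.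
  apply: lerD; last exact: posf_bd pf x.
  apply: le_trans (posf_bd pf _) _; apply: ler_wpM2l; first exact: posf_c pf.
  by rewrite -lecR -!rnormE; exact: star_hom_norm hom x.
rewrite (hom_mon hs) (posfZ pf).
have [d0'|dn0] := eqVneq (degree R (E := loop_ray) u w) 0.
  by rewrite d0' mul0r cis0 mul1r subrr.
suff -> : potential (mon s p u v w) = 0 by rewrite mulr0 subrr.
have [v' hv'] := proj_mon hT u v w.
have e1 : cmul (p v') (mon s p u v w) = mon s p u v w by rewrite hv' eqxx.
have := kms_rel_mon u v w (p v'); rewrite -potential_central e1 => /esym/eqP.
rewrite -subr_eq0 -{2}[potential _]mul1r -mulrBl mulf_eq0 => /orP[|/eqP //].
rewrite subr_eq0 -(rmorph1 (real_complex R)) => /eqP/realC_inj/eqP.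
have qn1 : q == 1 = false by apply/negbTE/eqP => q1; move: q2; rewrite q1 mulr1 ltNge ler1n.
by rewrite powR_eq1 oppr_eq0 (negbTE dn0) orbF qn1 ltNge (ltW q0).
Qed.

(** For a monomial b of degree dg, gauge invariance multiplies potential (b a) by exp (- i dg t)
    when a is replaced by sigma_t a. Both sides are power series in real t, so their coefficients
    agree, and the identity persists at i beta, where it becomes [kms_rel]. *)
Lemma potential_kms a F b (beta : R) : q = expR (- beta) ->
  analytic_extension sigma a F -> potential (cmul a b) = potential (cmul b (F (0 +i* beta)%C)).
Proof.
move=> qE [[cf hcf] Ft].
apply/eqP; rewrite -subr_eq0; apply/eqP; move: b.
set K := (1 - d)^-1; have K0 : 0 <= K := posf_c pf.
apply: (lipschitz_mon_eq0 hT hgen (c := K * (rnorm a + rnorm (F (0 +i* beta)%C))))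
  => [|x y|k x|x|u v w].
- by rewrite mulr_ge0 // addr_ge0 ?rnorm_ge0.
- by rewrite cmulDl cmulDr !(posfD pf) opprD addrACA.
- by rewrite -cscaleAl -cscaleAr !(posfZ pf) mulrBr.
- apply: le_trans (cabsD _ _) _; rewrite cabsN mulrDr mulrDl; apply: lerD.
    by rewrite -mulrA; exact: posf_mul_bd.
  by rewrite -mulrA [rnorm _ * _]mulrC; exact: posf_mul_bd.
set b := mon s p u v w; set dg := degree R (E := loop_ray) u w.
pose g k := potential (cmul b (cf k)).
have gcvg z : (series (fun k => z ^+ k * g k) : nat -> C) @ \oo --> (potential (cmul b (F z)) : C).
  apply/cvg_cabsP => e e0.
  have k0 : 0 < K * rnorm b + 1 by rewrite ltr_wpDl // mulr_ge0 // rnorm_ge0.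
  have /cvg_rnormP/(_ _ (divr_gt0 e0 k0)) := hcf z.
  apply: filterS => n hn.
  have -> : series (fun k => z ^+ k * g k) n = potential (cmul b (series (fun k => z ^+ k *: cf k) n)).
    rewrite /series /=; elim: n {hn} => [|n IH].
      by rewrite !big_geq // cmulx0 (posf0 pf).
    by rewrite !big_nat_recr //= cmulDr (posfD pf) IH -cscaleAr (posfZ pf).
  rewrite -(posfB pf) -cmulBr; apply: le_lt_trans (posf_mul_bd pf _ _) _.
  move: hn; rewrite ltr_pdivlMr // => hn; apply: le_lt_trans hn.
  by rewrite mulrA mulrDr mulr1 [leLHS]mulrC lerDl rnorm_ge0.
have gt (t : R) : potential (cmul b (F t%:C%C)) = cis (- (dg * t)) * potential (cmul b a).
  have hom := gauge_hom hs t.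
  rewrite Ft -[potential (cmul b a)](potential_sigma t) (star_homM hom).
  rewrite (hom_mon hs) -cscaleAl (posfZ pf) mulrA -cisD addNr cis0 mul1r //.
pose c0 := potential (cmul b a).
pose w0 : R[i] := 'i%C * (- dg)%:C%C.
have hz k : g k - w0 ^+ k / k`!%:R * c0 = 0.
  move: k; apply: power_series_eq0 => t.
  have h1 := gcvg t%:C%C.
  have h2 := @cexp_cvg R (w0 * t%:C%C).
  rewrite gt in h1.
  have e : cexp (w0 * t%:C%C) = cis (- (dg * t)).
    by rewrite /w0 -mulrA -rmorphM /= cexp_cis mulNr.
  rewrite e in h2.
  rewrite -(subrr ((cis (- (dg * t)) * c0 : R[i]) : C)).
  apply: eq_cvg_seq (cvgB h1 (cvgMr_tmp (b := c0 : C) h2)) => n.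
  rewrite !fctE /series /= mulr_suml -sumrB; apply: eq_bigr => i _.
  by rewrite exprMn; ring.
have gE k : g k = w0 ^+ k / k`!%:R * c0 by apply/eqP; rewrite -subr_eq0 hz.
have h1 := gcvg (0 +i* beta)%C.
have h2 := @cexp_cvg R (w0 * (0 +i* beta)%C).
have -> : potential (cmul b (F (0 +i* beta)%C)) = cexp (w0 * (0 +i* beta)%C) * c0.
  have <- := csum_unique h1; apply: csum_unique; apply: eq_cvg_seq (cvgMr_tmp (b := c0 : C) h2) => n.
  rewrite /series /= mulr_suml; apply: eq_bigr => i _.
  by rewrite gE exprMn; ring.
have -> : w0 * (0 +i* beta)%C = (dg * beta)%:C%C.
  by rewrite /w0; apply/eqP; rewrite eq_complex /=; apply/andP; split; apply/eqP; ring.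
rewrite cexp_real kms_rel_mon -/c0 qE -expRM mulrNN mulrC [beta * _]mulrC.
by rewrite [_ * c0]mulrC subrr.
Qed.

Let M := limn (fun n => complex.Re (potential (psum p n))).

Lemma mass_cvg : (fun n => complex.Re (potential (psum p n))) @ \oo --> M.
Proof.
have e : (fun n => complex.Re (potential (psum p n))) = series (fun v => complex.Re (potential (p v))).
  by apply/funext => n; rewrite (rho_series p pf).
rewrite /M e; apply: nondecreasing_is_cvgn.
  by apply: nondecreasing_series => *; exact: (rho_ge0 hT pf).
by exists (1 - d)^-1 => _ [n _ <-]; exact: (rho_le hT pf n).
Qed.

Lemma mass_ub n : complex.Re (potential (psum p n)) <= M.
Proof.
have e : (fun n => complex.Re (potential (psum p n))) = series (fun v => complex.Re (potential (p v))).
  by apply/funext => m; rewrite (rho_series p pf).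
apply: (nondecreasing_cvgn_le (u_ := fun n => complex.Re (potential (psum p n)))).
  by rewrite e; apply: nondecreasing_series => *; exact: (rho_ge0 hT pf).
by apply/cvg_ex; eexists; exact: mass_cvg.
Qed.

Lemma mass_le : M <= (1 - d)^-1.
Proof.
apply: limr_le; first by apply/cvg_ex; eexists; exact: mass_cvg.
apply: nearW => n; rewrite -(rho_series p pf); exact: (rho_le hT pf n).
Qed.

(** The potential dominates psi on positive elements, so M bounds the norm of psi by [mass_bound],
    and a state has norm 1. *)
Lemma mass_ge1 : 1 <= M.
Proof.
have pg := ground_posf gpsi.
have hM n : complex.Re (psi (psum p n)) <= M.
  apply: le_trans (mass_ub n).
  have h x : complex.Re (psi (cmul (cstar x) x)) <= complex.Re (potential (cmul (cstar x) x)).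
    have [hx _] := potential_asum (cmul (cstar x) x).
    rewrite /potential (csum_shift hx) expr0 mul1r raddfD lerDl.
    have hge : 0 <= csum (fun n => (q ^+ n.+1)%:C%C * theta n.+1 (cmul (cstar x) x)).
      apply: csum_ge0; first exact: asum_shift hx.
      move=> m; rewrite mulr_ge0 ?lecR ?exprn_ge0 ?(ltW q0) //.
      exact: posf_ge0 (theta_posf m.+1) x.
    by move: hge; rewrite lecE /= => /andP[].
  by have := h (psum p n); rewrite (psum_star hT) (psum_idem hT).
have hpsi := mass_bound hT pg hgen hM.
have [[_ _ h3] _] := gpsi; rewrite leNgt; apply/negP => M1.
have e0 : 0 < 1 - M by rewrite subr_gt0.
have [a a1] := h3 _ e0; rewrite cabsE ltcR ltNge => /negP; apply.
have M0 : 0 <= M.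
  by apply: le_trans (mass_ub 0); rewrite /psum big_geq // (posf0 pf).
apply: le_trans (hpsi a) _; rewrite subKr -[leRHS]mulr1; apply: ler_wpM2l => //.
by move: a1; rewrite rnormE -(rmorph1 (real_complex R)) lecR.
Qed.

(** The state is the potential divided by its mass M. The error d / (1 - d) comes from
    [potential_near], and the additional d from normalising, since 1 - d <= 1 / M <= 1. *)
Lemma kms_exists (beta : R) : q = expR (- beta) -> beta != 0 ->
  exists phi : {scalar A}, kms_state sigma beta phi /\
    forall x, cabs (phi x - psi x) <= (d / (1 - d) + d) * rnorm x.
Proof.
move=> qE bn0; have M0 : 0 < M by apply: lt_le_trans mass_ge1.
have d1 : 0 < 1 - d by rewrite subr_gt0.
have [|k x|phi phiE] := @mk_scalar R A (fun x => (M^-1)%:C%C * potential x).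
- by move=> x y; rewrite (posfD pf) mulrDr.
- by rewrite (posfZ pf) mulrCA.
exists phi; split; last first.
  move=> x; rewrite phiE.
  have -> : M^-1%:C%C * potential x - psi x =
      M^-1%:C%C * (potential x - psi x) + (M^-1 - 1)%:C%C * psi x.
    by rewrite rmorphB rmorph1; ring.
  apply: le_trans (cabsD _ _) _; rewrite !cabsM !cabs_real mulrDl.
  have i1 : M^-1 <= 1 by rewrite invf_le1 // mass_ge1.
  have i0 : 0 <= M^-1 by rewrite invr_ge0 ltW.
  have i2 : 1 - d <= M^-1.
    by rewrite -[1 - d]invrK lef_pV2 ?posrE ?invr_gt0 // mass_le.
  apply: lerD.
    rewrite ger0_norm // -[leRHS]mul1r; apply: ler_pM => //; first exact: cabs_ge0.
    exact: potential_near.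
  apply: ler_pM => //; first exact: cabs_ge0.
    by rewrite ler_norml; apply/andP; split; lra.
  by have := posf_bd (ground_posf gpsi) x; rewrite mul1r.
split; last first.
  rewrite (negbTE bn0) => a b F aF _; rewrite !phiE; congr (_ * _).
  exact: potential_kms.
have bd x : cabs (phi x) <= rnorm x.
  rewrite phiE cabsM cabs_real ger0_norm ?invr_ge0 ?(ltW M0) //.
  rewrite mulrC ler_pdivrMr // mulrC. exact: (mass_bound hT pf hgen mass_ub x).
split.
- move=> a; rewrite phiE mulr_ge0 ?lecR ?invr_ge0 ?(ltW M0) //; exact: posf_ge0 pf a.
- by move=> a; rewrite cabsE rnormE lecR.
move=> e e0.
have : \forall n \near \oo, M * (1 - e) < complex.Re (potential (psum p n)).
  have eM : 0 < e * M by rewrite mulr_gt0.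
  move/cvgrPdist_lt : mass_cvg => /(_ _ eM); apply: filterS => n.
  by rewrite ltr_norml => /andP[_]; lra.
case=> N _ hN; have {}hN := hN N (leqnn N); exists (psum p N).
  by rewrite rnormE -(rmorph1 (real_complex R)) lecR; exact: (psum_rnorm hT).
rewrite cabsE ltcR phiE cabsM cabs_real ger0_norm ?invr_ge0 ?(ltW M0) //.
rewrite mulrC ltr_pdivlMr // mulrC; apply: lt_le_trans hN _.
by apply: le_trans (ler_norm _) _; exact: cabs_Re.
Qed.

End Potential.

Lemma ground_kms_infty (R : realType) (A : cstarAlg R)
    (s : edge loop_ray -> A) (p : vert loop_ray -> A)
    (hA : toeplitz_algebra s p)
    (sigma : R -> A -> A) (hs : gauge_dynamics s p sigma) (psi : {scalar A}) :
  ground_state sigma psi -> kms_infty_state sigma psi.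
Proof.
move=> gpsi; split=> //.
have hT := toeplitz_rel hA; have hgen := toeplitz_gen hA.
(* The shift by 3 gives q n <= 1 / (n + 4) <= 1 / 4; then 2 q < 1, and the error in [kms_exists] is
   at most 6 q. *)
pose b n : R := n%:R + 3.
have b0 n : 0 < b n by rewrite ltr_wpDl.
pose q n : R := expR (- b n).
have q0 n : 0 < q n := expR_gt0 _.
have qle n : q n <= (n%:R + 4)^-1.
  rewrite /q expRN lef_pV2 ?posrE ?expR_gt0 ?ltr_wpDl //.
  by have := expR_ge1Dx (b n); rewrite /b; lra.
have q4 n : q n <= 4^-1.
  by apply: le_trans (qle n) _; rewrite lef_pV2 ?posrE ?ltr_wpDl // lerDr.
have q2 n : 2 * q n < 1 by have := q4 n; lra.
have /choice[phi hphi] n := kms_exists hT hgen hs gpsi (q0 n) (q2 n) erefl (lt0r_neq0 (b0 n)).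
exists b, phi; split.
- by move=> n; exact: ltW.
- apply/cvgryPge => a; near=> n; apply: (@le_trans _ _ n%:R); last by rewrite /b lerDl.
  by near: n; exact: nbhs_infty_ger.
- by move=> n; have [] := hphi n.
move=> a; apply/cvg_cabsP => e e0.
pose r := rnorm a; have r0 : 0 <= r := rnorm_ge0 a.
near=> n; have [_ h] := hphi n.
rewrite -cabsN opprB; apply: le_lt_trans (h a) _; rewrite -/r.
have d1 : 2 * q n / (1 - 2 * q n) <= 4 * q n.
  by rewrite ler_pdivrMr ?subr_gt0 //; have := q0 n; have := q4 n; nra.
have n0 : (0 : R) <= n%:R by [].
have h6 : (2 * q n / (1 - 2 * q n) + 2 * q n) * r <= 6 * r / (n%:R + 4).
  rewrite [leRHS]mulrAC; apply: ler_wpM2r => //.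
  by have := qle n; lra.
apply: le_lt_trans h6 _; rewrite ltr_pdivrMr ?ltr_wpDl //.
have : 6 * r / e < n%:R.
  by near: n; exact: nbhs_infty_gtr.
by rewrite ltr_pdivrMr // mulrDr; nra.
Unshelve. all: by end_near. Qed.

(** * Paths of the loop-ray graph *)

Local Notation E := loop_ray.
Local Notation X := (pathspace E).

#[local] Arguments src : simpl never.
#[local] Arguments rng : simpl never.

(* Paths are coded by their source and by a word of bits, where false stands
   for the loop e_k and true for the edge f_k at the current vertex k. *)
Definition ray_edge (k : nat) (b : bool) : edge E := if b then inr k else inl k.

Fixpoint ray_edges (k : nat) (w : seq bool) : seq (edge E) :=
  if w is b :: w' then ray_edge k b :: ray_edges (k + b) w' else [::].

Definition edge_bit (e : edge E) : bool := if e is inr _ then true else false.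

Lemma src_ray_edge k b : src (ray_edge k b) = k.
Proof. by case: b. Qed.
Lemma rng_ray_edge k b : rng (ray_edge k b) = (k + b)%N.
Proof. by case: b; rewrite /rng /= ?addn1 ?addn0. Qed.
Lemma edge_bitK (e : edge E) : ray_edge (src e) (edge_bit e) = e.
Proof. by case: e. Qed.
Lemma edge_bit_ray k b : edge_bit (ray_edge k b) = b.
Proof. by case: b. Qed.

Lemma walk_ray_edges k w : walk (k : vert E) (ray_edges k w).
Proof.
elim: w k => [//|b w IH] k /=; rewrite src_ray_edge eqxx rng_ray_edge; exact: IH.
Qed.

Definition fp (k : nat) (w : seq bool) : Defs.fpath E :=
  @Fpath E (k : vert E, ray_edges k w) (walk_ray_edges k w).

Lemma ray_edges_bits k w : [seq edge_bit e | e <- ray_edges k w] = w.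
Proof. by elim: w k => //= b w IH k; rewrite edge_bit_ray IH. Qed.

Lemma walk_bits k es : walk (k : vert E) es -> es = ray_edges k [seq edge_bit e | e <- es].
Proof.
elim: es k => [//|e es IH] k /= /andP[/eqP <- w].
rewrite edge_bitK; congr (_ :: _); rewrite {1}(IH _ w); congr ray_edges.
by case: e {w} => n; rewrite /rng /src /= ?addn1 ?addn0.
Qed.

Lemma fp_surj u : exists k w, u = fp k w.
Proof.
case: u => -[k es] hw; exists k, [seq edge_bit e | e <- es].
by apply: val_inj => /=; rewrite -(walk_bits hw).
Qed.

Lemma fp_inj k w k' w' : fp k w = fp k' w' -> k = k' /\ w = w'.
Proof.
move=> [-> e]; split=> //.
by rewrite -(ray_edges_bits k' w) e ray_edges_bits.
Qed.

Lemma fsrc_fp k w : fsrc (fp k w) = k. Proof. by []. Qed.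

Lemma size_ray_edges k w : size (ray_edges k w) = size w.
Proof. by rewrite -{2}(ray_edges_bits k w) size_map. Qed.

Lemma flen_fp k w : flen (fp k w) = size w.
Proof. exact: size_ray_edges. Qed.

Lemma frng_fp k w : frng (fp k w) = (k + count id w)%N.
Proof.
rewrite /frng /=; elim: w k => [|b w IH] k /=; first by rewrite addn0.
by rewrite rng_ray_edge IH addnA.
Qed.

(** The vertex from which the edge of index i departs. *)
Definition vat (k : nat) (g : nat -> bool) (i : nat) : nat := (k + \sum_(0 <= j < i) g j)%N.

Lemma vatS k g i : vat k g i.+1 = (vat k g i + g i)%N.
Proof. by rewrite /vat big_nat_recr //= addnA. Qed.
Lemma vat0 k g : vat k g 0 = k.
Proof. by rewrite /vat big_geq // addn0. Qed.
Lemma vatSl k g i : vat k g i.+1 = vat (k + g 0) (fun j => g j.+1) i.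
Proof. by rewrite /vat big_nat_recl // addnA. Qed.

Lemma ip_subproof k g n :
  rng (ray_edge (vat k g n) (g n)) = src (ray_edge (vat k g n.+1) (g n.+1)).
Proof. by rewrite rng_ray_edge src_ray_edge vatS. Qed.

Definition ip (k : nat) (g : nat -> bool) : ipath E :=
  Ipath (iedge := fun n => ray_edge (vat k g n) (g n)) (ip_subproof k g).

Lemma ipath_eq (x y : ipath E) : iedge x =1 iedge y -> x = y.
Proof.
case: x y => f hf [f' hf'] /= /funext e; subst f'.
by congr Ipath; exact: Prop_irrelevance.
Qed.

Lemma ip_surj y : exists k g, y = ip k g.
Proof.
exists (isrc y), (fun n => edge_bit (iedge y n)); apply: ipath_eq => n /=.
suff -> : vat (isrc y) (fun n => edge_bit (iedge y n)) n = src (iedge y n) by rewrite edge_bitK.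
elim: n => [|n IH]; first by rewrite vat0.
case: y IH => f hf /= IH; rewrite vatS IH -hf.
by rewrite -[in RHS](edge_bitK (f n)) rng_ray_edge.
Qed.

Lemma isrc_ip k g : isrc (ip k g) = k.
Proof. by rewrite /isrc /= src_ray_edge vat0. Qed.

Lemma ip_inj k g k' g' : ip k g = ip k' g' -> k = k' /\ g = g'.
Proof.
move=> e; split; first by rewrite -(isrc_ip k g) -(isrc_ip k' g') e.
apply/funext => n; have := congr1 (fun y => edge_bit (iedge y n)) e.
by rewrite /= !edge_bit_ray.
Qed.

Lemma ps_ind (P : pathspace E -> Prop) :
  (forall k w, P (Fin (fp k w))) -> (forall k g, P (Inf (ip k g))) -> forall x, P x.
Proof.
move=> hF hI [u|y]; first by have [k [w ->]] := fp_surj u.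
by have [k [g ->]] := ip_surj y.
Qed.

Lemma ray_edges_prefix k w w' : prefix (ray_edges k w) (ray_edges k w') = prefix w w'.
Proof.
elim: w w' k => [|b w IH] [|b' w'] k //=.
have [<-|ne] := eqVneq b b'; first by rewrite eqxx IH.
suff -> : (ray_edge k b == ray_edge k b') = false by [].
apply/negbTE/eqP => h; move: ne.
by rewrite -(edge_bit_ray k b) h edge_bit_ray eqxx.
Qed.

Lemma ray_edges_ip k g n :
  [seq iedge (ip k g) i | i <- iota 0 n] = ray_edges k (mkseq g n).
Proof.
rewrite /mkseq; elim: n k g => [//|n IH] k g /=; rewrite vat0; congr (_ :: _).
have -> : iota 1 n = [seq i.+1 | i <- iota 0 n] by rewrite -(iotaDl 1 0).
rewrite -!map_comp -(IH _ (fun j => g j.+1)).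
by apply: eq_map => i /=; rewrite vatSl.
Qed.

Lemma initial_Fin k w k' w' :
  initial (fp k w) (Fin (fp k' w')) <-> k = k' /\ prefix w w'.
Proof.
by rewrite /initial /= /fsrc /=; split=> -[<-]; rewrite ray_edges_prefix.
Qed.

Lemma initial_Inf k w k' g :
  initial (fp k w) (Inf (ip k' g)) <-> k = k' /\ w = mkseq g (size w).
Proof.
rewrite /initial /= isrc_ip flen_fp ray_edges_ip /fsrc /=; split=> -[<- h]; split=> //.
  by rewrite -(ray_edges_bits k w) h ray_edges_bits size_mkseq.
by rewrite -h.
Qed.

Lemma edge_ray_edge (e : edge E) : e = ray_edge (src e) (edge_bit e).
Proof. by rewrite edge_bitK. Qed.

Definition bcons (b : bool) (g : nat -> bool) (n : nat) : bool :=
  if n is n'.+1 then g n' else b.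

(** In the coding, prefixing an edge is prepending a bit; the equality proof carried by [xcons]
    disappears. *)
Lemma xcons_setE k b (A : set (pathspace E)) :
  xcons_set (ray_edge k b) A =
  [set x | (exists2 w, A (Fin (fp (k + b) w)) & x = Fin (fp k (b :: w))) \/
           (exists2 g, A (Inf (ip (k + b) g)) & x = Inf (ip k (bcons b g)))].
Proof.
have eF w h : @xcons E (ray_edge k b) (Fin (fp (k + b) w)) h = Fin (fp k (b :: w)).
  by congr Fin; apply: val_inj; rewrite /= src_ray_edge.
have eI g h : @xcons E (ray_edge k b) (Inf (ip (k + b) g)) h = Inf (ip k (bcons b g)).
  congr Inf; apply: ipath_eq => -[|n] /=; first by rewrite vat0.
  by rewrite [in RHS]vatSl.
apply/seteqP; split=> x /=.
  move=> [y [h [Ay ->]]]; elim/ps_ind: y h Ay => [k' w|k' g] h Ay.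
    have kk : k' = (k + b)%N by rewrite -(rng_ray_edge k b) -h.
    by subst k'; left; exists w => //; rewrite eF.
  have kk : k' = (k + b)%N by rewrite -(rng_ray_edge k b) -h /= isrc_ip.
  by subst k'; right; exists g => //; rewrite eI.
move=> [[w Aw ->]|[g Ag ->]].
  have h : xsrc (Fin (fp (k + b) w)) = rng (ray_edge k b) by rewrite rng_ray_edge.
  by exists (Fin (fp (k + b) w)), h; rewrite eF.
have h : xsrc (Inf (ip (k + b) g)) = rng (ray_edge k b) by rewrite rng_ray_edge /= isrc_ip.
by exists (Inf (ip (k + b) g)), h; rewrite eI.
Qed.

(** * Topology of the path space *)

Definition cyl k w : set X := cylinder (fp k w).

Lemma subbase_open (ub : Defs.fpath E * bool) :
  open (if ub.2 then cylinder ub.1 else ~` cylinder ub.1 : set X).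
Proof.
exists [set (if ub.2 then cylinder ub.1 else ~` cylinder ub.1 : set X)]; last by rewrite bigcup_set1.
move=> A ->; exists (finmap.fset1 ub); last by rewrite set_fset1 bigcap_set1.
by move=> i; rewrite !inE.
Qed.

Lemma cyl_open k w : open (cyl k w).
Proof. exact: (subbase_open (fp k w, true)). Qed.
Lemma cylC_open k w : open (~` cyl k w).
Proof. exact: (subbase_open (fp k w, false)). Qed.
Lemma cyl_closed k w : closed (cyl k w).
Proof. by rewrite -openC; exact: cylC_open. Qed.

(** A path that starts with u and continues with neither of the two available edges is u itself.
    Hence finite paths are isolated. *)
Lemma set_FinE k w :
  [set Fin (fp k w)] = cyl k w `&` ~` cyl k (rcons w false) `&` ~` cyl k (rcons w true).
Proof.
apply/seteqP; split=> x /=.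
  have h b : ~ initial (fp k (rcons w b)) (Fin (fp k w)).
    by rewrite initial_Fin => -[_ /size_prefix]; rewrite size_rcons ltnn.
  move=> ->; split; last exact: h.
  by split; [rewrite /cyl /cylinder /= initial_Fin prefix_refl|exact: h].
elim/ps_ind: x => [k' w'|k' g]; rewrite /cyl /cylinder /=.
  rewrite !initial_Fin => -[[[-> /prefixP[[|b t] ->]]] h1 h2]; first by rewrite cats0.
  exfalso; case: b h1 h2 => [_ h|h _]; apply: h; split=> //;
    by rewrite -cat_rcons prefix_prefix.
rewrite !initial_Inf => -[[[-> hw] h1] h2]; exfalso.
case e : (g (size w)); [apply: h2|apply: h1]; split=> //;
  by rewrite size_rcons mkseqS -hw e.
Qed.

Lemma Fin_open k w : open [set Fin (fp k w)].
Proof.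
by rewrite set_FinE; apply: openI; [apply: openI; [exact: cyl_open|]|]; exact: cylC_open.
Qed.

Lemma Inf_bigcap k g : [set Inf (ip k g)] = \bigcap_n cyl k (mkseq g n).
Proof.
apply/seteqP; split=> x /=.
  by move=> -> n _; rewrite /cyl /cylinder /= initial_Inf size_mkseq.
elim/ps_ind: x => [k' w'|k' g'] h.
  have := h (size w').+1 I; rewrite /cyl /cylinder /= initial_Fin => -[_ /size_prefix].
  by rewrite size_mkseq ltnn.
have /initial_Inf[<- _] : initial (fp k (mkseq g 0)) (Inf (ip k' g')) := h 0%N I.
congr (Inf (ip _ _)); apply/funext => n.
have := h n.+1 I; rewrite /cyl /cylinder /= initial_Inf size_mkseq => -[_].
by move=> /(congr1 (fun s => nth false s n)); rewrite !nth_mkseq.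
Qed.

Lemma set1_closed (x : X) : closed [set x].
Proof.
elim/ps_ind: x => [k w|k g].
  rewrite set_FinE; apply: closedI; [apply: closedI; first exact: cyl_closed|];
    by rewrite closedC; exact: cyl_open.
by rewrite Inf_bigcap; apply: closed_bigI => n _; exact: cyl_closed.
Qed.

(* The sets Z(u) and {u} form a countable clopen base. *)
Definition bas (i : nat * seq bool * bool) : set X :=
  if i.2 then cyl i.1.1 i.1.2 else [set Fin (fp i.1.1 i.1.2)].

Lemma bas_open i : open (bas i).
Proof. by rewrite /bas; case: ifP => _; [exact: cyl_open|exact: Fin_open]. Qed.
Lemma bas_closed i : closed (bas i).
Proof. by rewrite /bas; case: ifP => _; [exact: cyl_closed|exact: set1_closed]. Qed.

(** Whether a path beginning like this infinite one lies in Z(u) is decided by its first |u|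
    edges. *)
Lemma subbase_cyl (ub : Defs.fpath E * bool) k g :
  (if ub.2 then cylinder ub.1 else ~` cylinder ub.1) (Inf (ip k g)) ->
  cyl k (mkseq g (flen ub.1)) `<=` (if ub.2 then cylinder ub.1 else ~` cylinder ub.1).
Proof.
case: ub => u b /=; have [k' [w' ->]] := fp_surj u; rewrite flen_fp.
have h x : cyl k (mkseq g (size w')) x ->
    (initial (fp k' w') x <-> initial (fp k' w') (Inf (ip k g))).
  rewrite initial_Inf; elim/ps_ind: x => [j w|j g']; rewrite /cyl /cylinder /=.
    rewrite !initial_Fin => -[-> pw]; split=> -[-> h]; split=> //.
      by move: pw h; rewrite !prefixE size_mkseq => /eqP <- /eqP ->.
    by rewrite h.
  rewrite !initial_Inf size_mkseq => -[-> pw]; split=> -[-> h]; split=> //.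
    by rewrite h -pw size_mkseq.
  by rewrite -pw.
case: b => hx x cx /=; first by apply/(h x cx).
by move=> hi; apply: hx; apply/(h x cx).
Qed.

Lemma cyl_mono k (g : nat -> bool) n m : (n <= m)%N -> cyl k (mkseq g m) `<=` cyl k (mkseq g n).
Proof.
move=> nm; have pf : prefix (mkseq g n) (mkseq g m).
  by rewrite /mkseq -(subnKC nm) iotaD map_cat prefix_prefix.
elim/ps_ind => [j w|j g']; rewrite /cyl /cylinder /= ?initial_Fin ?initial_Inf.
  by move=> [-> h]; split=> //; exact: prefix_trans h.
rewrite !size_mkseq => -[-> e]; split=> //.
apply: (@eq_from_nth _ false); rewrite !size_mkseq // => i in_.
have := congr1 (fun s => nth false s i) e; rewrite !nth_mkseq //; exact: leq_trans nm.
Qed.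

Lemma bas_base (U : set X) (x : X) : open U -> U x -> exists2 i, bas i x & bas i `<=` U.
Proof.
move=> [D sD <-] [B DB Bx].
have [F _ hF] := sD B DB.
have {}hF : \bigcap_(i in [set` (F : {fset Defs.fpath E * bool})])
  (if i.2 then cylinder i.1 else ~` cylinder i.1 : set X) = B := hF.
have {}Bx : B x := Bx.
elim/ps_ind: x Bx => [k w|k g] Bx.
  exists (k, w, false) => //; rewrite /bas /= => y ->; by exists B.
(* A basic open set involves finitely many paths; N bounds their lengths, so the first N edges
   decide every membership. *)
have [N hN] : exists N, forall ub, ub \in (F : {fset Defs.fpath E * bool}) -> (flen ub.1 <= N)%N.
  exists (\max_(ub <- (F : {fset Defs.fpath E * bool})) flen ub.1) => ub ubF.
  by rewrite (big_rem _ ubF) leq_maxl.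
exists (k, mkseq g N, true).
  by rewrite /bas /cyl /cylinder /= initial_Inf size_mkseq.
rewrite /bas /= => y cy; exists B => //; rewrite -hF => ub ubF.
have hx := Bx; rewrite -hF in hx.
apply: subbase_cyl; first exact: hx ub ubF.
apply: cyl_mono cy; exact: hN.
Qed.

Lemma open_bigcup_bas (U : set X) : open U ->
  U = \bigcup_(i in [set i | bas i `<=` U]) bas i.
Proof.
move=> oU; apply/seteqP; split=> x.
  by move=> Ux; have [i ix iU] := bas_base oU Ux; exists i.
by move=> [i iU ix]; exact: iU.
Qed.

Lemma vat_count k g n : (k + count id (mkseq g n))%N = vat k g n.
Proof.
rewrite /vat; congr (_ + _)%N; elim: n => [|n IH]; first by rewrite big_geq.
by rewrite mkseqS -cats1 count_cat IH big_nat_recr //= addn0.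
Qed.

Lemma vat_mono k g n m : (n <= m)%N -> (vat k g n <= vat k g m)%N.
Proof.
move=> /subnKC <-; elim: (m - n)%N => [|d IH]; first by rewrite addn0.
by apply: leq_trans IH _; rewrite addnS vatS leq_addr.
Qed.

(* In this graph a path is recurrent exactly when it ends with a repeated loop. *)
Definition recpt (kw : nat * seq bool) : X := Inf (ip kw.1 (nth false kw.2)).

(** The vertex index never decreases along a path. If edges f occur infinitely often, it exceeds
    every v, so only finitely many initial segments end at v. Hence the recurrent paths are
    countably many. *)
Lemma recpaths_recpt : @recpaths E `<=` range recpt.
Proof.
move=> x [[y ->]]; have [k [g ->]] := ip_surj y => -[v hinf].
have [[N hN]|hN] := pselect (exists N, forall n, (N <= n)%N -> g n = false).
  exists (k, mkseq g N) => //; rewrite /recpt /=; congr (Inf (ip _ _)).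
  apply/funext => n; have [nN|Nn] := ltnP n N; first by rewrite nth_mkseq.
  by rewrite nth_default ?size_mkseq // hN.
exfalso; apply: hinf.
have unb m : exists N, (m <= vat k g N)%N.
  elim: m => [|m [N IH]]; first by exists 0%N.
  have [n Nn gn] : exists2 n, (N <= n)%N & g n.
    apply: contrapT => h; apply: hN; exists N => n Nn; apply/negbTE/negP => gn.
    by apply: h; exists n.
  exists n.+1; rewrite vatS gn addn1 ltnS; apply: leq_trans IH _; exact: vat_mono.
have [N vN] := unb (v : nat).+1.
apply: (@sub_finite_set _ _ ((fun n => fp k (mkseq g n)) @` `I_N)).
  move=> u /= [[hi _] hv]; have [k' [w uE]] := fp_surj u; subst u.
  move: hi => /initial_Inf[kk hw]; subst k'.
  exists (size w); last by rewrite -hw.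
  rewrite /= ltnNge; apply/negP => Nw.
  move: hv; rewrite frng_fp hw vat_count => hv.
  by have := leq_trans vN (vat_mono k g Nw); rewrite hv ltnn.
exact: finite_image (finite_II N).
Qed.

Lemma recpaths_loop : @recpaths E (recpt (0%N, [::])).
Proof.
split; first by eexists.
exists (0%N : vert E) => fin_.
have : finite_set ((@flen E) @` [set u | strict_initial u (recpt (0%N, [::])) /\ frng u = (0%N : vert E)]).
  exact: finite_image.
rewrite (_ : _ @` _ = setT); first by move/infinite_nat.
apply/seteqP; split=> // n _; exists (fp 0 (nseq n false)); last first.
  by rewrite flen_fp size_nseq.
split; last by rewrite frng_fp count_nseq mul0n.
split=> //; apply/initial_Inf; split=> //; rewrite size_nseq.
apply: (@eq_from_nth _ false); rewrite ?size_mkseq ?size_nseq // => i hi.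
by rewrite nth_nseq hi nth_mkseq // nth_nil.
Qed.

(** * Borel sets *)

Lemma borel_open (U : set X) : open U -> measurable (U : set (borel_paths E)).
Proof. exact: sub_sigma_algebra. Qed.

Lemma borel_closed (U : set X) : closed U -> measurable (U : set (borel_paths E)).
Proof.
move=> cU; rewrite -[U]setCK; apply: measurableC; apply: borel_open.
exact: closed_openC.
Qed.

Lemma borel_cyl k w : measurable (cyl k w : set (borel_paths E)).
Proof. exact: borel_open (cyl_open k w). Qed.

Lemma borel_set1 (x : X) : measurable ([set x] : set (borel_paths E)).
Proof. exact: borel_closed (set1_closed (x := x)). Qed.

Lemma countable_bigcup_measurable d (T : sigmaRingType d) (I : countType) (D : set I)
  (F : I -> set T) : (forall i, D i -> measurable (F i)) -> measurable (\bigcup_(i in D) F i).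
Proof.
move=> h; rewrite bigcup_mkcond; apply: countable_bigcupT_measurable => // i.
by case: ifPn => // /set_mem; exact: h.
Qed.

Lemma finpathsE : @finpaths E = \bigcup_kw [set Fin (fp kw.1 kw.2)].
Proof.
apply/seteqP; split=> x.
  by move=> [u ->]; have [k [w ->]] := fp_surj u; exists (k, w).
by move=> [[k w] _ ->]; exists (fp k w).
Qed.

Lemma borel_finpaths : measurable (@finpaths E : set (borel_paths E)).
Proof.
rewrite finpathsE; apply: countable_bigcup_measurable => kw _; exact: borel_set1.
Qed.

Lemma borel_recpaths : measurable (@recpaths E : set (borel_paths E)).
Proof.
have -> : @recpaths E = \bigcup_(kw in [set kw | @recpaths E (recpt kw)]) [set recpt kw].
  apply/seteqP; split=> x; last by move=> [kw h ->].
  by move=> rx; have [kw _ xE] := recpaths_recpt rx; exists kw; rewrite //= xE.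
apply: countable_bigcup_measurable => kw _; exact: borel_set1.
Qed.

Lemma finpathsC : ~` @finpaths E = @infpaths E.
Proof.
apply/seteqP; split=> -[u|y] h //; first by exfalso; apply: h; exists u.
- by exists y.
- by case: h.
- by case.
Qed.

Lemma borel_wanpaths : measurable (@wanpaths E : set (borel_paths E)).
Proof.
apply: measurableD borel_recpaths; rewrite -finpathsC.
exact: measurableC borel_finpaths.
Qed.

Lemma borel_bas_measurable d (T : measurableType d) (f : T -> borel_paths E) :
  (forall k w, measurable (f @^-1` cyl k w)) ->
  measurable_fun setT f.
Proof.
move=> h.
have hF k w : measurable (f @^-1` [set Fin (fp k w)]).
  rewrite set_FinE !preimage_setI !preimage_setC.
  apply: measurableI; last exact/measurableC/h.
  by apply: measurableI; [exact: h|exact/measurableC/h].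
have hb i : measurable (f @^-1` bas i) by rewrite /bas; case: ifP.
apply: (@measurability _ _ _ _ setT f (@open X)) => //.
move=> _ [U oU <-]; rewrite setTI (open_bigcup_bas oU) preimage_bigcup.
exact: countable_bigcup_measurable.
Qed.

(** * Compactness and regularity *)

(* Even coordinates of a point of the Cantor space tell where the path stops,
   odd coordinates are its bits. *)
Definition xdec (k : nat) (c : nat -> bool) : X :=
  match pselect (exists n, c n.*2) with
  | left h => Fin (fp k (mkseq (fun i => c i.*2.+1) (ex_minn h)))
  | right _ => Inf (ip k (fun i => c i.*2.+1))
  end.

Lemma prefix_mkseq (w : seq bool) g n : prefix w (mkseq g n) <->
  (size w <= n)%N /\ forall i, (i < size w)%N -> g i = nth false w i.
Proof.
split=> [h|[h1 h2]].
  have sw : (size w <= n)%N by rewrite -[n](size_mkseq g) size_prefix.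
  split=> // i iw; move: h; rewrite prefixE => /eqP <-.
  by rewrite nth_take // nth_mkseq // (leq_trans iw).
rewrite prefixE; apply/eqP; apply: (@eq_from_nth _ false).
  by rewrite size_takel // size_mkseq.
rewrite size_takel ?size_mkseq // => i iw.
by rewrite nth_take // nth_mkseq ?h2 // (leq_trans iw).
Qed.

Lemma xdec_cyl k c k' w : cyl k' w (xdec k c) <->
  k' = k /\ forall i, (i < size w)%N -> c i.*2 = false /\ c i.*2.+1 = nth false w i.
Proof.
rewrite /xdec /cyl /cylinder /=; case: pselect => [h|h].
  case: ex_minnP => n cn nmin; rewrite initial_Fin prefix_mkseq; split.
    move=> [-> [wn hw]]; split=> // i iw; split; last exact: hw.
    apply/negbTE/negP => ci; have := nmin _ ci.
    by rewrite leqNgt (leq_trans iw wn).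
  move=> [-> hw]; split=> //; split; last by move=> i /hw[].
  by rewrite leqNgt; apply/negP => /hw[]; rewrite cn.
rewrite initial_Inf; split.
  move=> [-> hw]; split=> // i iw; split.
    by apply/negbTE/negP => ci; apply: h; exists i.
  by rewrite hw nth_mkseq.
move=> [-> hw]; split=> //; apply: (@eq_from_nth _ false); rewrite ?size_mkseq // => i iw.
by rewrite nth_mkseq //; have [_ ->] := hw i iw.
Qed.

Lemma xdec_range k : range (xdec k) = cyl k [::].
Proof.
apply/seteqP; split=> x; first by move=> [c _ <-]; apply/xdec_cyl.
elim/ps_ind: x => [k' w|k' g].
  rewrite /cyl /cylinder /= initial_Fin => -[<- _].
  pose c j := if odd j then nth false w j./2 else j./2 == size w.
  have cE i : c i.*2 = (i == size w) by rewrite /c odd_double doubleK.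
  have cO i : c i.*2.+1 = nth false w i by rewrite /c /= odd_double /= uphalf_double.
  exists c => //; rewrite /xdec; case: pselect => [h|[]]; last by exists (size w); rewrite cE.
  case: ex_minnP => n; rewrite cE => /eqP -> _; congr (Fin (fp _ _)).
  apply: (@eq_from_nth _ false); rewrite size_mkseq // => i iw.
  by rewrite nth_mkseq // cO.
rewrite /cyl /cylinder /= initial_Inf => -[<- _].
pose c j := if odd j then g j./2 else false.
have cE i : c i.*2 = false by rewrite /c odd_double.
have cO i : c i.*2.+1 = g i by rewrite /c /= odd_double /= uphalf_double.
exists c => //; rewrite /xdec; case: pselect => h; first by exfalso; case: h => n; rewrite cE.
by congr (Inf (ip _ _)); apply/funext => i; rewrite cO.
Qed.

Lemma cantor_coord_open (j : nat) (b : bool) : open [set c : cantor_space | c j = b].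
Proof.
have hc : continuous (fun c : cantor_space => c j) := @proj_continuous nat (fun=> bool) j.
exact: ((continuousP _).1 hc [set b] (discrete_open _)).
Qed.

Lemma cantor_coord_closed (j : nat) (b : bool) : closed [set c : cantor_space | c j = b].
Proof.
rewrite -openC; have -> : ~` [set c : cantor_space | c j = b] = [set c | c j = ~~ b].
  apply/seteqP; split=> c /=; first by case: (c j) b => -[].
  by move=> ->; case: b.
exact: cantor_coord_open.
Qed.

Lemma xdec_cyl_clopen k k' w :
  open [set c : cantor_space | cyl k' w (xdec k c)] /\
  closed [set c : cantor_space | cyl k' w (xdec k c)].
Proof.
pose B n := [set c : cantor_space | forall i, (i < n)%N ->
  c i.*2 = false /\ c i.*2.+1 = nth false w i].
have hB n : open (B n) /\ closed (B n).
  elim: n => [|n [oB cB]].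
    have -> : B 0%N = setT by apply/seteqP; split.
    by split; [exact: openT|exact: closedT].
  have -> : B n.+1 = B n `&` ([set c | c n.*2 = false] `&` [set c | c n.*2.+1 = nth false w n]).
    apply/seteqP; split=> c h.
      by split; [move=> i /ltnW; exact: h|split; have [] := h n (ltnSn n)].
    move=> i; rewrite ltnS leq_eqVlt => /orP[/eqP ->|]; last exact: h.1.
    by case: h => _ [].
  split; first by apply: openI => //; apply: openI; exact: cantor_coord_open.
  by apply: closedI => //; apply: closedI; exact: cantor_coord_closed.
have [kk|kk] := pselect (k' = k).
  have -> : [set c : cantor_space | cyl k' w (xdec k c)] = B (size w).
    by apply/seteqP; split=> c /=; [move/xdec_cyl => []|move=> h; apply/xdec_cyl].
  exact: hB.
have -> : [set c : cantor_space | cyl k' w (xdec k c)] = set0.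
  by apply/seteqP; split=> c //= /xdec_cyl[].
by split; [exact: open0|exact: closed0].
Qed.

Lemma xdec_continuous k : continuous (xdec k : cantor_space -> X).
Proof.
apply: (continuousP _).2 => U oU; rewrite (open_bigcup_bas oU) preimage_bigcup.
apply: bigcup_open => -[[k' w] b] _; rewrite /bas; case: b => /=.
  exact: (xdec_cyl_clopen k k' w).1.
rewrite set_FinE !preimage_setI !preimage_setC.
have h w' : open (~` (xdec k @^-1` cyl k' w' : set cantor_space)).
  by rewrite openC; exact: (xdec_cyl_clopen k k' w').2.
apply: openI (h _); apply: openI (h _).
exact: (xdec_cyl_clopen k k' w).1.
Qed.

(** Z(v_k) is the image of the Cantor space under the continuous map [xdec k]. *)
Lemma cyl_compact k : compact (cyl k [::]).
Proof.
rewrite -xdec_range; apply: continuous_compact cantor_space_compact.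
exact/continuous_subspaceT/xdec_continuous.
Qed.

Lemma path_hausdorff : hausdorff_space X.
Proof.
rewrite open_hausdorff => x y /eqP xy.
have oy : open (~` [set y]) by rewrite openC; exact: set1_closed.
have [i ix iy] := bas_base oy xy.
exists (bas i, ~` bas i); rewrite /= ?inE; first by split=> // /iy; apply.
split; [exact: bas_open|by rewrite openC; exact: bas_closed|exact: setICr].
Qed.

Lemma cyl0_mem (x : X) : cyl (xsrc x : nat) [::] x.
Proof.
elim/ps_ind: x => [k w|k g]; rewrite /cyl /cylinder /= ?initial_Fin ?initial_Inf //.
  by split=> //; exact: prefix0s.
by rewrite isrc_ip.
Qed.

Section Regularity.
Variables (R : realType) (mu : probability (borel_paths E) R).

Let mu_fin A : measurable A -> mu A \is a fin_num.
Proof. by move=> mA; exact: fin_num_measure. Qed.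

(** The usual route to regularity: these sets form a sigma-algebra, and it contains the clopen base,
    hence all open sets and all Borel sets. *)
Definition squeezed : set (set X) := [set A | forall e : R, 0 < e ->
  exists C U, [/\ closed C, open U, C `<=` A, A `<=` U & (mu (U `\` C) <= e%:E)%E]].

Lemma squeezed_clopen (A : set X) : open A -> closed A -> squeezed A.
Proof. by move=> oA cA e e0; exists A, A; split=> //; rewrite setDv measure0 lee_fin ltW. Qed.

Lemma squeezedC A : squeezed A -> squeezed (~` A).
Proof.
move=> sA e e0; have [C [U [cC oU CA AU m]]] := sA e e0.
exists (~` U), (~` C); split.
- by rewrite closedC.
- by rewrite openC.
- exact: subsetC.
- exact: subsetC.
- by rewrite setDE setCK setIC -setDE.
Qed.

Lemma squeezed_bigcup (A : nat -> set X) : (forall n, squeezed (A n)) ->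
  squeezed (\bigcup_n A n).
Proof.
move=> sA e e0; have e2 : 0 < e / 2 by rewrite divr_gt0.
have /choice[CU hCU] n : exists CU : set X * set X,
    [/\ closed CU.1, open CU.2, CU.1 `<=` A n, A n `<=` CU.2 &
      (mu (CU.2 `\` CU.1) <= (e / 2 / (2 ^ n.+1)%:R)%:E)%E].
  have en : 0 < e / 2 / (2 ^ n.+1)%:R by rewrite divr_gt0 // ltr0n expn_gt0.
  by have [C [U h]] := sA n _ en; exists (C, U).
(* The union [Doo] of the inner closed sets need not be closed; a finite stage [D n] is, and
   continuity from above bounds the loss. Half of e goes to the outer sets, half to this
   truncation. *)
pose U := \bigcup_n (CU n).2; pose D n := \bigcup_(i in `I_n) (CU i).1.
pose Doo := \bigcup_n (CU n).1.
have mU n : measurable ((CU n).2 : set (borel_paths E)) by apply: borel_open; have [] := hCU n.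
have mC n : measurable ((CU n).1 : set (borel_paths E)) by apply: borel_closed; have [] := hCU n.
have mUU : measurable (U : set (borel_paths E)) by exact: bigcupT_measurable.
have mDn n : measurable (D n : set (borel_paths E)) by exact: bigcup_measurable.
have mDoo : measurable (Doo : set (borel_paths E)) by exact: bigcupT_measurable.
have h1 : (mu (U `\` Doo) <= (e / 2)%:E)%E.
  apply: (@le_trans _ _ (mu (\bigcup_n ((CU n).2 `\` (CU n).1)))).
    apply: le_measure; rewrite ?inE; first exact: measurableD.
      by apply: bigcupT_measurable => n; exact: measurableD.
    move=> x [[n _ Unx] nD]; exists n => //; split=> // Cx; apply: nD.
    by exists n.
  apply: le_trans (measure_sigma_subadditive _ _ _ (@subset_refl _ _)) _.
  - by move=> n; exact: measurableD.
  - by apply: bigcupT_measurable => n; exact: measurableD.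
  apply: le_trans (epsilon_trick0 xpredT (ltW e2)); apply: lee_nneseries => [n *|n *].
    exact: measure_ge0.
  by have [] := hCU n.
have h2 : (fun n => mu (U `\` D n)) @ \oo --> mu (\bigcap_n (U `\` D n)).
  apply: nonincreasing_cvg_mu.
  - by rewrite ltey_eq mu_fin //; exact: measurableD.
  - by move=> n; exact: measurableD.
  - by apply: bigcapT_measurable => n; exact: measurableD.
  - move=> n m nm; apply/subsetPset => x [Ux nD]; split=> // -[i /= im Ci]; apply: nD.
    by exists i => //=; exact: leq_trans nm.
have bE : \bigcap_n (U `\` D n) = U `\` Doo.
  apply/seteqP; split=> x.
    move=> h; split; first by have [] := h 0%N I.
    by move=> [n _ Cx]; have [_] := h n.+1 I; apply; exists n => /=.
  by move=> [Ux nD] n _; split=> // -[i _ Ci]; apply: nD; exists i.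
rewrite bE in h2.
have hlt : (mu (U `\` Doo) < e%:E)%E by apply: le_lt_trans h1 _; rewrite lte_fin; lra.
have [n _ hn] := h2 _ (open_nbhs_nbhs (conj (@open_ereal_lt_ereal R e%:E) hlt)).
exists (D n), U; split.
- apply: closed_bigcup => //.
  by move=> i _; have [] := hCU i.
- by apply: bigcup_open => i _; have [] := hCU i.
- by move=> x [i _ Ci]; exists i => //; have [_ _ + _ _] := hCU i; apply.
- by move=> x [i _ Ai]; exists i => //; have [_ _ _ + _] := hCU i; apply.
- exact: ltW (hn n (leqnn n)).
Qed.

Lemma squeezed_measurable (A : set (borel_paths E)) : measurable A -> squeezed A.
Proof.
have s0 : squeezed set0 by apply: squeezed_clopen; [exact: open0|exact: closed0].
have sopen : @open X `<=` squeezed.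
  move=> U oU.
  pose F n : set X := if choice.unpickle n is Some i then
    (if pselect (bas i `<=` U) then bas i else set0) else set0.
  have -> : U = \bigcup_n F n.
    apply/seteqP; split=> x.
      move=> Ux; have [i ix iU] := bas_base oU Ux; exists (choice.pickle i) => //.
      by rewrite /F choice.pickleK; case: pselect.
    move=> [n _]; rewrite /F; case: choice.unpickle => // i; case: pselect => // iU.
    exact: iU.
  apply: squeezed_bigcup => n; rewrite /F; case: choice.unpickle => // i.
  case: pselect => //= iU; apply: squeezed_clopen; [exact: bas_open|exact: bas_closed].
have sig : sigma_algebra setT squeezed.
  split=> // [B sB|]; last exact: squeezed_bigcup.
  by rewrite setTD; exact: squeezedC.
exact: (smallest_sub sig sopen).
Qed.

Lemma prob_regular : regular_measure mu.
Proof.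
move=> A mA; have sA := squeezed_measurable mA; split; apply/eqP; rewrite eq_le; apply/andP; split.
- apply: le_ereal_inf_tmp => _ [U [oU AU] <-].
  by apply: le_measure => //; rewrite inE //; exact: borel_open.
- apply/lee_addgt0Pr => e e0; have [C [U [cC oU CA AU h]]] := sA e e0.
  have mU := borel_open oU; have mC := borel_closed cC.
  apply: (@le_trans _ _ (mu U)); first by apply: ereal_inf_lbound; exists U.
  apply: (@le_trans _ _ (mu (A `|` (U `\` C)))).
    apply: le_measure; rewrite ?inE //; first by apply: measurableU => //; exact: measurableD.
    move=> x Ux; have [Cx|nC] := pselect (C x); first by left; exact: CA.
    by right.
  apply: le_trans (measureU2 _ _ _) _ => //; first exact: measurableD.
  exact: leeD2l.
- apply/lee_addgt0Pr => e e0; have e2 : 0 < e / 2 by rewrite divr_gt0.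
  have [C [U [cC oU CA AU h]]] := sA _ e2.
  have mU := borel_open oU; have mC := borel_closed cC.
  (* A closed set may meet infinitely many Z(v), so it is cut down to the first n vertices; the
     discarded mass tends to 0. *)
  pose T n : set X := \bigcup_(k in `I_n) cyl k [::].
  have mT n : measurable (T n : set (borel_paths E)).
    by apply: bigcup_measurable => k _; exact: borel_cyl.
  have hT : (fun n => mu (~` T n)) @ \oo --> mu (\bigcap_n ~` T n).
    apply: nonincreasing_cvg_mu.
    + by rewrite ltey_eq mu_fin //; exact: measurableC.
    + by move=> n; exact: measurableC.
    + by apply: bigcapT_measurable => n; exact: measurableC.
    + move=> n m nm; apply/subsetPset => x nT [k /= kn ck]; apply: nT.
      by exists k => //=; exact: leq_trans nm.
  have T0 : \bigcap_n ~` T n = set0.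
    apply/seteqP; split=> x // h0; apply: (h0 (xsrc x : nat).+1 I).
    by exists (xsrc x : nat) => //=; exact: cyl0_mem.
  rewrite T0 measure0 in hT.
  have e2' : (0 < (e / 2)%:E)%E by rewrite lte_fin.
  have [n _ hn] := hT _ (open_nbhs_nbhs (conj (@open_ereal_lt_ereal R (e / 2)%:E) e2')).
  pose K := C `&` T n.
  have mK : measurable (K : set (borel_paths E)) by exact: measurableI.
  have cK : compact K.
    rewrite /K setIC; apply: compact_closedI => //.
    rewrite /T bigcup_mkord; apply: bigsetU_compact => k _; exact: cyl_compact.
  apply: (@le_trans _ _ (mu (K `|` ((U `\` C) `|` ~` T n)))).
    apply: le_measure; rewrite ?inE //.
      apply: measurableU => //; apply: measurableU; first exact: measurableD.
      exact: measurableC.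
    move=> x Ax; have [Cx|nC] := pselect (C x); last first.
      by right; left; split=> //; exact: AU.
    by have [Tx|nT] := pselect (T n x); [left|right; right].
  apply: le_trans (measureU2 _ _ _) _ => //.
    by apply: measurableU; [exact: measurableD|exact: measurableC].
  apply: leeD.
    by apply: ereal_sup_ubound; exists K => //; split=> // x [/CA].
  apply: le_trans (measureU2 _ _ _) _ => //; [exact: measurableD|exact: measurableC|].
  rewrite [e]splitr EFinD; apply: leeD => //; exact: ltW (hn n (leqnn n)).
- apply: ge_ereal_sup => _ [K [cK KA] <-].
  have mK := borel_closed (compact_closed path_hausdorff cK).
  by apply: le_measure; rewrite ?inE.
Qed.

End Regularity.

(** * The functions m_v^beta *)

Section ExtendedSums.
Variable R : realType.

Lemma nneseries_EFinP (u : nat -> R) (l : R) : (forall n, 0 <= u n) ->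
  \esum_(j in [set: nat]) (u j)%:E = l%:E <-> series u @ \oo --> l.
Proof.
move=> u0; rewrite -nneseries_esumT; last by move=> n; rewrite lee_fin.
have e : (fun n => \sum_(0 <= i < n) (u i)%:E)%E = EFin \o series u.
  by apply/funext => n; rewrite /= sumEFin.
split=> [h|h].
  have hc : cvgn (fun n => \sum_(0 <= i < n) (u i)%:E)%E.
    by apply: is_cvg_nneseries => n _ _; rewrite lee_fin.
  have {}hc : EFin \o series u @ \oo --> l%:E by rewrite -h -e; exact: hc.
  exact: fine_cvg hc.
apply/cvg_lim => //; rewrite e; apply/fine_cvgP; split; last exact: h.
by apply: nearW => n.
Qed.

Lemma ge0_esumZl (T : choiceType) (S : set T) (F : T -> \bar R) (c : R) :
  0 <= c -> (forall x, 0 <= F x)%E ->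
  \esum_(x in S) (c%:E * F x)%E = (c%:E * \esum_(x in S) F x)%E.
Proof.
move=> c0 F0; rewrite /esum -ereal_supZl //; last first.
  by apply/set0P; exists (\sum_(x \in set0) F x)%E; exists set0 => //; exact: fsets_set0.
congr ereal_sup; apply/seteqP; split=> y.
  move=> [X XS <-]; exists (\sum_(x \in X) F x)%E; first by exists X.
  by rewrite ge0_mule_fsumr.
move=> [_ [X XS <-] <-]; exists X => //.
by rewrite ge0_mule_fsumr.
Qed.

Lemma esum_pair_singletons (T : choiceType) (a b : T) (F : T -> \bar R) :
  a <> b -> (forall x, 0 <= F x)%E ->
  \esum_(x in [set a; b]) F x = (F a + F b)%E.
Proof.
move=> ab F0; rewrite (esumID [set a]) //; congr (_ + _)%E.
  rewrite (_ : _ `&` _ = [set a]) ?esum_set1 //.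
  by apply/seteqP; split=> x /=; [case|move=> ->; split=> //; left].
rewrite (_ : _ `&` _ = [set b]) ?esum_set1 //.
apply/seteqP; split=> x /=; first by move=> [[|]].
by move=> ->; split; [right|exact: nesym].
Qed.

Section Words.
Variables (q : R) (d : nat -> R) (W : nat -> seq bool -> R).
Hypothesis W0 : forall k w, 0 <= W k w.
Hypothesis d0 : forall k, 0 <= d k.
Hypothesis q0 : 0 <= q.
Hypothesis Wcons : forall k b w, W k (b :: w) = d k * q * W (k + b) w.

(** The total weight of the words of length j, by [esum_level]. The factor d kills words that leave
    n in the count of first arrivals; it is 1 in the count of all paths. *)
Fixpoint level j k : R :=
  if j is j'.+1 then d k * step q (level j') k else W k [::].

Lemma esum_level j k : \esum_(w in [set w | size w = j]) (W k w)%:E = (level j k)%:E.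
Proof.
elim: j k => [|j IH] k.
  rewrite (_ : [set w | _] = [set [::]]) ?esum_set1 ?lee_fin //.
  by apply/seteqP; split=> [[|b w]|w ->].
have im b : \esum_(w in cons b @` [set w | size w = j]) (W k w)%:E =
    \esum_(w in [set w | size w = j]) (W k (b :: w))%:E.
  by apply: esum_image => x y _ _ [].
rewrite (esumID (cons true @` [set w | size w = j])); last by move=> w _; rewrite lee_fin.
rewrite (_ : _ `&` _ = cons true @` [set w | size w = j]); last first.
  by apply/seteqP; split=> w /=; [case|move=> [w' <- <-]; split=> //; exists w'].
rewrite (_ : _ `&` _ = cons false @` [set w | size w = j]); last first.
  apply/seteqP; split=> w /=.
    by case: w => [[]//|[] w /= [[sw] h]]; [case: h|]; exists w.
  by move=> [w' <- <-]; split=> // -[? _].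
rewrite !im.
have sc b : \esum_(w in [set w | size w = j]) (W k (b :: w))%:E =
    ((d k * q)%:E * (level j (k + b))%:E)%E.
  rewrite -IH -ge0_esumZl ?mulr_ge0 // => [|w]; last by rewrite lee_fin.
  by apply: eq_esum => w _; rewrite Wcons EFinM.
rewrite !sc -!EFinM -EFinD /= addn0 addn1 /step; congr EFin; ring.
Qed.

Lemma esum_words k l : series (level ^~ k) @ \oo --> l ->
  \esum_(w in [set: seq bool]) (W k w)%:E = l%:E.
Proof.
move=> hl.
rewrite (_ : [set: seq bool] = \bigcup_(j in setT) [set w | size w = j]); last first.
  by apply/seteqP; split=> w // _; exists (size w).
rewrite esum_bigcupT.
- under eq_esum do rewrite esum_level.
  apply/nneseries_EFinP => // j; rewrite -lee_fin -esum_level.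
  by apply: esum_ge0 => w _; rewrite lee_fin.
- by apply/trivIsetP => i j _ _ ij; apply/seteqP; split=> w //= [iw jw]; move: ij; rewrite -iw -jw eqxx.
- by move=> w; rewrite lee_fin.
Qed.

(** Since m is its term of level 0 plus its image under the weighted step, the partial sums
    telescope to m minus an iterate. *)
Lemma series_level (m : nat -> R) :
  (forall k, m k = W k [::] + d k * step q m k) ->
  (forall k, iter J (fun m' j => d j * step q m' j) m k @[J --> \oo] --> (0 : R)) ->
  forall k, series (level ^~ k) @ \oo --> m k.
Proof.
move=> hm ht k; pose L := fun (m' : nat -> R) j => d j * step q m' j.
have levelE j : level j = iter j L (fun k => W k [::]).
  by elim: j => [//|j IH]; apply/funext => i /=; rewrite IH.
have LB m1 m2 i : L m1 i - L m2 i = L (fun j => m1 j - m2 j) i by rewrite /L /step; ring.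
have sE J : series (level ^~ k) J = m k - iter J L m k.
  have iB j i : iter j L m i - iter j.+1 L m i = level j i.
    rewrite levelE; elim: j i => [|j IH] i; first by rewrite /= {1}hm addrK.
    rewrite [in RHS]iterS [in LHS]iterS [iter j.+2 _ _]iterS LB.
    by congr (L _ i); apply/funext => l; exact: IH.
  rewrite /series /=; elim: J => [|J IH]; first by rewrite big_geq //= subrr.
  by rewrite big_nat_recr //= IH -iB /= addrA subrK.
apply: (eq_cvg_seq (u := fun J => m k - iter J L m k)) => [J|]; first by rewrite sE.
rewrite -[X in _ --> X]subr0; apply: cvgB; [exact: cvg_cst|exact: ht].
Qed.

End Words.
End ExtendedSums.

Fixpoint arrives (n k : nat) (w : seq bool) : bool :=
  if w is b :: w' then (k != n) && arrives n (k + b) w' else k == n.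

Lemma arrivesP n k w : arrives n k w <->
  (k + count id w)%N = n /\ forall w', prefix w' w -> w' <> w -> (k + count id w')%N <> n.
Proof.
elim: w k => [|b w IH] k /=.
  rewrite addn0; split=> [/eqP ->|[-> _]] //; split=> // -[|b w'] //.
rewrite addnA; split=> [/andP[/eqP kn /IH[h1 h2]]|[h1 h2]].
  split=> // -[|b' w'] /=; first by rewrite addn0.
  move=> /andP[/eqP -> pw] ne; rewrite addnA; apply: h2 => // e; apply: ne.
  by rewrite e.
apply/andP; split; first by apply/eqP => kn; apply: (h2 [::]); rewrite /= ?addn0.
apply/IH; split=> // w' pw ne; rewrite -addnA; apply: (h2 (b :: w')) => //=.
  by rewrite eqxx.
by case.
Qed.

Lemma first_arrivalP (n k : nat) w :
  @first_arrival E (n : vert E) (fp k w) <-> arrives n k w.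
Proof.
rewrite arrivesP /first_arrival /= frng_fp; split=> -[h1 h2]; split=> //.
  move=> w' pw ne; have := h2 (fp k w'); rewrite frng_fp; apply; split.
    exact/initial_Fin.
  by case=> /(congr1 (map edge_bit)); rewrite !ray_edges_bits.
move=> u' [hi hn]; have [k' [w' uE]] := fp_surj u'; subst u'.
move: hi => /initial_Fin[kk pw]; subst k'; rewrite frng_fp; apply: h2 => // ww.
by apply: hn; rewrite ww.
Qed.

Section Extremal.
Variables (R : realType) (beta : R).
Let q := expR (- beta).
Let q0 : 0 < q. Proof. exact: expR_gt0. Qed.

Lemma weight_pow k w : weight R (fp k w) `^ (- beta) = q ^+ size w.
Proof. by rewrite /weight flen_fp -expRM mulrC expRM_natr. Qed.

Variables (n : nat) (m : nat -> R).
Let d (k : nat) : R := (k != n)%:R.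
Hypothesis m0 : forall k, 0 <= m k.
Hypothesis m_eq : forall k, m k = (k == n)%:R + d k * step q m k.
Hypothesis m_cvg : forall k,
  iter J (fun m' j => d j * step q m' j) m k @[J --> \oo] --> (0 : R).

(** First-step decomposition: a first arrival at n is the trivial path at n, or an edge from some
    other vertex followed by a first arrival. This is [m_eq]; [m_cvg] removes the remainder of the
    telescoping sum. *)
Lemma arrival_sum (k : nat) :
  \esum_(u in @first_arrival E (n : vert E) `&` [set u : Defs.fpath E | fsrc u = (k : vert E)])
     (weight R u `^ (- beta))%:E = (m k)%:E.
Proof.
pose W k w : R := if arrives n k w then q ^+ size w else 0.
have -> : @first_arrival E (n : vert E) `&` [set u : Defs.fpath E | fsrc u = (k : vert E)] =
    fp k @` [set w | arrives n k w].
  apply/seteqP; split=> u /=.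
    move=> []; have [k' [w ->]] := fp_surj u; rewrite fsrc_fp => + kk; subst k'.
    by move=> /first_arrivalP h; exists w.
  by move=> [w /first_arrivalP h <-].
rewrite esum_image; last by move=> x y _ _ /fp_inj[].
transitivity (\esum_(w in [set: seq bool]) (W k w)%:E).
  rewrite esum_mkcond; apply: eq_esum => w _; rewrite /W weight_pow.
  have -> : (w \in [set w | arrives n k w]) = arrives n k w by apply/idP/idP; rewrite inE.
  by case: ifP.
apply: (esum_words (q := q) (d := d)).
- by move=> j w; rewrite /W; case: ifP => // _; rewrite exprn_ge0 // ltW.
- by move=> j.
- exact: ltW.
- move=> j b w; rewrite /W /= /d; case: eqVneq => //= _; rewrite ?mul0r // mul1r.
  by case: ifP; rewrite ?mulr0 // exprS.
- apply: series_level => // j; rewrite {1}m_eq; congr (_ + _); rewrite /W /=.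
  by case: ifP.
Qed.

Lemma Za_sum (l : R) : series m @ \oo --> l -> @Za R E beta (n : vert E) = l%:E.
Proof.
move=> sm; rewrite /Za.
have -> : @first_arrival E (n : vert E) =
    \bigcup_(k in [set: nat]) (@first_arrival E (n : vert E) `&` [set u : Defs.fpath E | fsrc u = (k : vert E)]).
  by apply/seteqP; split=> u; [move=> h; exists (fsrc u)|move=> [k _ []]].
rewrite esum_bigcupT.
- under eq_esum do rewrite arrival_sum.
  exact/nneseries_EFinP.
- apply/trivIsetP => i j _ _ ij; apply/seteqP; split=> u //= [[_ iu] [_ ju]].
  by move: ij; rewrite -iu -ju eqxx.
- by move=> u; rewrite lee_fin powR_ge0.
Qed.

Lemma mkms_eq (l : R) : series m @ \oo --> l -> forall k, @mkms R E beta (n : vert E) k = m k / l.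
Proof. by move=> sm k; rewrite /mkms arrival_sum (Za_sum sm). Qed.

End Extremal.

(** Scaled to the value 1 at n, [mun n] solves the first-arrival equation. The iterates stopped at n
    are dominated by those of [step], which vanish by transience. *)
Lemma mkms_mun (R : realType) (beta : R) (n : nat) : 0 < beta ->
  @mkms R E beta (n : vert E) = mun (expR (- beta)) n.
Proof.
move=> b0; set q := expR (- beta).
have q0 : 0 < q := expR_gt0 _.
have q1 : q < 1 by rewrite expR_lt1 oppr_lt0.
pose z := zn q n; have z0 : 0 < z := zn_gt0 q0 q1 n.
pose m k := z * mun q n k.
have m0 k : 0 <= m k by rewrite mulr_ge0 ?(ltW z0) // mun_ge0.
have hst k : m k = (k == n)%:R + (k != n)%:R * step q m k.
  rewrite /m stepZ; have [->|kn] := eqVneq k n.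
    by rewrite mul0r addr0 /mun leqnn subnn expr0 mul1r divff // gt_eqF.
  have := mun_step q0 q1 n k; rewrite (negbTE kn) => /eqP; rewrite subr_eq0 => /eqP <-.
  by rewrite add0r mul1r.
have ht k : iter J (fun m' j => (j != n)%:R * step q m' j) m k @[J --> \oo] --> (0 : R).
  have tm : transient q m by apply: transientZ; exact: mun_transient.
  apply: (squeeze_cvgr _ (cvg_cst 0) (tm k)); apply: nearW => J.
  elim: J k => [|J IH] k; first by rewrite /= m0 lexx.
  have s0 : 0 <= step q (iter J (fun m' j => (j != n)%:R * step q m' j) m) k.
    rewrite mulr_ge0 ?(ltW q0) // addr_ge0 //.
      by have /andP[] := IH k.
    by have /andP[] := IH k.+1.
  rewrite !iterS; apply/andP; split; first by rewrite mulr_ge0.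
  apply: (@le_trans _ _ (step q (iter J (fun m' j => (j != n)%:R * step q m' j) m) k)).
    by rewrite -[leRHS]mul1r ler_wpM2r // lern1; case: (k != n).
  by apply: step_mono => // j; have /andP[] := IH j.
have sm : series m @ \oo --> z.
  by rewrite -[X in _ --> X]mulr1; apply: series_scale; exact: mun_sum.
apply/funext => k; rewrite (mkms_eq m0 hst ht sm) /m mulrC mulKf // gt_eqF //.
Qed.

(** At beta = 0 one has q = 1 and the closed form [mun] degenerates; but only the trivial path makes
    a first arrival at v_0. *)
Lemma mkms0 (R : realType) : @mkms R E 0 (0%N : vert E) = (fun k => (k == 0%N)%:R).
Proof.
pose m (k : nat) : R := (k == 0%N)%:R.
have m0 k : 0 <= m k by [].
have hst k : m k = (k == 0%N)%:R + (k != 0%N)%:R * step (expR (- 0)) m k.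
  by case: k => [|k]; rewrite /m /= ?mul0r ?addr0 // /step addr0 mulr0 mulr0 add0r.
have L0 : (fun j => (j != 0%N)%:R * step (expR (- 0)) m j) = (fun=> 0).
  by apply/funext => -[|k]; rewrite /= ?mul0r // /step addr0 mulr0 mulr0.
have z J : iter J.+1 (fun m' j => (j != 0%N)%:R * step (expR (- 0)) m' j) m = (fun=> 0).
  elim: J => [//|J IH]; rewrite iterS IH; apply/funext => k.
  by rewrite /step addr0 !mulr0.
have ht k : iter J (fun m' j => (j != 0%N)%:R * step (expR (- 0)) m' j) m k @[J --> \oo] --> (0 : R).
  by apply: cvg_near_cst; exists 1%N => // -[//|J] _; rewrite z.
have sm : series m @ \oo --> (1 : R).
  apply: cvg_near_cst; exists 1%N => // N /= N0; rewrite /series /=.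
  by rewrite -(prednK N0) big_nat_recl // big1 ?addr0.
by apply/funext => k; rewrite (mkms_eq m0 hst ht sm) divr1.
Qed.

Lemma Dkms_kmsd (R : realType) (beta : R) (m : vert E -> R) :
  @Dkms R E beta m <-> kmsd (expR (- beta)) m.
Proof.
set q := expR (- beta); have q0 : 0 < q := expR_gt0 _.
have hs v : (forall k, 0 <= m k) -> (\esum_(e in [set e : edge E | src e = v])
    (q * m (rng e))%:E = (step q m (v : nat))%:E)%E.
  move=> m0; have -> : [set e : edge E | src e = v] = [set (inl (v : nat) : edge E); inr (v : nat)].
    apply/seteqP; split=> [[k|k]|e] /=.
    - by rewrite /src /= => ->; left.
    - by rewrite /src /= => ->; right.
    - by move=> [] ->.
  rewrite esum_pair_singletons //; last by move=> e; rewrite lee_fin mulr_ge0 // ltW.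
  by rewrite /step mulrDr EFinD.
split=> [[m01 ms mh]|[m0 ms mh]].
  have m0 k : 0 <= m k by have /andP[] := m01 k.
  split=> //; first exact/nneseries_EFinP.
  by move=> k; rewrite -lee_fin -hs.
split.
- by move=> v; rewrite m0 (term_le_sum v m0 ms).
- exact/nneseries_EFinP.
- by move=> v; rewrite hs // lee_fin.
Qed.

(** * Associated measures *)

Lemma fnil_fp (k : nat) : fnil (k : vert E) = fp k [::].
Proof. exact: val_inj. Qed.

Lemma xcons_cyl k b w : xcons_set (ray_edge k b) (cyl (k + b) w) = cyl k (b :: w).
Proof.
rewrite xcons_setE; apply/seteqP; split=> x /=.
  move=> [[w' /initial_Fin[_ h] ->]|[g /initial_Inf[_ h] ->]].
    by apply/initial_Fin; split=> //=; rewrite eqxx.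
  apply/initial_Inf; split=> //; rewrite /mkseq /=; congr (_ :: _).
  rewrite {1}h /mkseq -[in RHS](addn0 1%N) iotaDl -map_comp.
  by apply: eq_map.
elim/ps_ind: x => [k' w'|k' g]; rewrite /cyl /cylinder /=.
  rewrite initial_Fin; case: w' => [[]//|b' w'] /= [<- /andP[/eqP <- h]].
  by left; exists w' => //; apply/initial_Fin.
rewrite initial_Inf /mkseq /= => -[<- [e h]]; right; exists (fun n => g n.+1); last first.
  by congr (Inf (ip _ _)); apply/funext => -[|n].
apply/initial_Inf; split=> //; rewrite {1}h /mkseq -[in LHS](addn0 1%N) iotaDl -map_comp.
by apply: eq_map.
Qed.

Lemma cyl_sub_nil k w : cyl k w `<=` cyl k [::].
Proof.
elim/ps_ind => [k' v|k' g].
  by move=> /initial_Fin[-> _]; apply/initial_Fin; split=> //; exact: prefix0s.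
by move=> /initial_Inf[-> _]; apply/initial_Inf.
Qed.

Lemma cyl_split (k : nat) :
  cyl k [::] = [set Fin (fp k [::])] `|` (cyl k [:: false] `|` cyl k [:: true]).
Proof.
apply/seteqP; split=> x.
  elim/ps_ind: x => [k' w|k' g]; rewrite /cyl /cylinder /= !(initial_Fin, initial_Inf).
    move=> [<- _]; case: w => [|[] w]; [by left|right; right|right; left];
      by split=> //=; rewrite ?eqxx ?prefix0s.
  move=> [<- _]; right; case e: (g 0); [right|left]; split=> //;
    by rewrite /mkseq /= e.
by move=> [->|[]]; [apply/initial_Fin|exact: cyl_sub_nil|exact: cyl_sub_nil].
Qed.

(** Infinite paths are included, so the intersection over J consists of the infinite paths from
    k. *)
Definition longer (k J : nat) : set X := \bigcup_(w in [set w | size w = J]) cyl k w.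

Lemma longer0 k : longer k 0 = cyl k [::].
Proof.
apply/seteqP; split=> x; last by exists [::].
by move=> [w /= /size0nil ->].
Qed.

Lemma cyl_cons_false k w x : cyl k (false :: w) x -> ~ cyl k (true :: w) x.
Proof.
elim/ps_ind: x => [k' v|k' g]; rewrite /cyl /cylinder /= !(initial_Fin, initial_Inf).
  by case: v => [[]|[] v] //= [_ h] [].
by rewrite /mkseq /= => -[_ [<- _]] [_ []].
Qed.

Lemma cyl_headP k b w x : cyl k (b :: w) x -> cyl k [:: b] x.
Proof.
elim/ps_ind: x => [k' v|k' g].
  case: v => [/initial_Fin[]//|b' v] /initial_Fin[-> /= /andP[bb _]].
  by apply/initial_Fin; rewrite /= bb ?prefix0s.
by move=> /initial_Inf[-> [e _]]; apply/initial_Inf; split=> //; rewrite /mkseq /= -e.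
Qed.

Lemma longerS k J : longer k J.+1 =
  xcons_set (ray_edge k false) (longer (k + false) J) `|`
  xcons_set (ray_edge k true) (longer (k + true) J).
Proof.
have h b : xcons_set (ray_edge k b) (longer (k + b) J) =
    \bigcup_(w in [set w | size w = J]) cyl k (b :: w).
  apply/seteqP; split=> x.
    move=> [y [hy [[w sw yw] ->]]]; exists w => //; rewrite -xcons_cyl.
    by exists y, hy.
  by move=> [w sw]; rewrite -xcons_cyl => -[y [hy [yw ->]]]; exists y, hy; split=> //; exists w.
rewrite !h; apply/seteqP; split=> x.
  by move=> [[//|[] w] [sw] xw]; [right|left]; exists w.
by move=> [] [w sw xw]; [exists (false :: w)|exists (true :: w)] => //=; rewrite sw.
Qed.

Lemma longer_head k b J : xcons_set (ray_edge k b) (longer (k + b) J) `<=` cyl k [:: b].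
Proof.
move=> x [y [hy [[w sw yw] ->]]]; apply: (@cyl_headP _ _ w); rewrite -xcons_cyl.
by exists y, hy.
Qed.

Lemma longer_xcons_disj k J : [disjoint xcons_set (ray_edge k false) (longer (k + false) J) &
  xcons_set (ray_edge k true) (longer (k + true) J)].
Proof. by apply/disj_setPS => x [/longer_head h1 /longer_head]; exact: cyl_cons_false. Qed.

Lemma longer_sub k J : longer k J `<=` cyl k [::].
Proof. by move=> x [w _]; exact: cyl_sub_nil. Qed.

Lemma longer_measurable k J : measurable (longer k J : set (borel_paths E)).
Proof. by apply: countable_bigcup_measurable => w _; exact: borel_cyl. Qed.

(** The image under prefixing is Borel because it is cut out of [longer k J.+1] by a cylinder. *)
Lemma longer_xcons_measurable k b J :
  measurable (xcons_set (ray_edge k b) (longer (k + b) J) : set (borel_paths E)).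
Proof.
have -> : xcons_set (ray_edge k b) (longer (k + b) J) = longer k J.+1 `&` cyl k [:: b].
  rewrite longerS; apply/seteqP; split=> x.
    by move=> h; split; [case: b h => h; [right|left]|exact: longer_head h].
  by case: b => -[[] // /longer_head h1 h2]; exfalso; [exact: cyl_cons_false h1 h2|exact: cyl_cons_false h2 h1].
by apply: measurableI; [exact: longer_measurable|exact: borel_cyl].
Qed.

Lemma prob_setU (R : realType) (mu : probability (borel_paths E) R)
  (A B : set (borel_paths E)) : measurable A -> measurable B -> A `&` B = set0 ->
  mu (A `|` B) = (mu A + mu B)%E.
Proof. exact: measureU. Qed.

Section AssociatedMeasure.
Variables (R : realType) (beta : R) (m : nat -> R) (mu : probability (borel_paths E) R).
Hypothesis am : @assoc_measure R E beta m mu.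
Let q := expR (- beta).

Lemma assoc_cyl k : mu (cyl k [::]) = (m k)%:E.
Proof. by have [_ h _] := am; rewrite /cyl -fnil_fp h. Qed.

Lemma assoc_xcons k (b : bool) (A : set (borel_paths E)) : measurable A -> A `<=` cyl (k + b) [::] ->
  mu (xcons_set (ray_edge k b) A) = (q%:E * mu A)%E.
Proof.
move=> mA sA; have [_ _ h] := am; apply: h => //.
by rewrite rng_ray_edge fnil_fp.
Qed.

Lemma assoc_longer J k : mu (longer k J) = (iter J (step q) m k)%:E.
Proof.
elim: J k => [|J IH] k; first by rewrite longer0 assoc_cyl.
rewrite longerS prob_setU; last 3 first.
- exact: longer_xcons_measurable.
- exact: longer_xcons_measurable.
- by apply/eqP; rewrite -disj_set2E; exact: longer_xcons_disj.
rewrite !assoc_xcons; try exact: longer_measurable; try exact: longer_sub.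
by rewrite !IH -!EFinM -EFinD iterS /step /= addn0 addn1 mulrDr.
Qed.

(** By continuity from above the iterates converge to the mass of the infinite paths from k, which
    is 0. *)
Lemma assoc_fin_transient : mu (@finpaths E) = 1%E -> transient q m.
Proof.
move=> h1 k.
have hc : (fun J => mu (longer k J)) @ \oo --> mu (\bigcap_J longer k J).
  apply: nonincreasing_cvg_mu.
  - by rewrite ltey_eq fin_num_measure //; exact: longer_measurable.
  - by move=> J; exact: longer_measurable.
  - by apply: bigcapT_measurable => J; exact: longer_measurable.
  apply/nonincreasing_seqP => J; apply/subsetPset => x [w sw xw].
  have [v [b ww]] : exists v b, w = rcons v b.
    by case/lastP: w sw {xw} => [//|v b] _; exists v, b.
  exists v; first by move: sw; rewrite ww /= size_rcons => -[].
  move: xw; rewrite ww; elim/ps_ind: x => [k' u|k' g].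
    move=> /initial_Fin[-> h]; apply/initial_Fin; split=> //.
    by apply: prefix_trans h; exact: prefix_rcons.
  move=> /initial_Inf[-> h]; apply/initial_Inf; split=> //.
  by move: h; rewrite size_rcons mkseqS => /rcons_inj[].
have h0 : mu (\bigcap_J longer k J) = 0%E.
  apply/eqP; rewrite eq_le measure_ge0 andbT.
  have <- : mu (~` @finpaths E) = 0%E.
    by rewrite probability_setC ?h1 ?subee //; exact: borel_finpaths.
  apply: le_measure; rewrite ?inE.
  - by apply: bigcapT_measurable => J; exact: longer_measurable.
  - exact: measurableC borel_finpaths.
  move=> x hx [u xu]; rewrite {}xu in hx; have [k' [w uE]] := fp_surj u; subst u.
  have [v /= sv /initial_Fin[_ /size_prefix]] := hx (size w).+1 I.
  by rewrite sv ltnn.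
rewrite h0 in hc.
have : (fun J => (iter J (step q) m k)%:E) @ \oo --> 0%E.
  by move: hc; under eq_fun do rewrite assoc_longer.
exact: fine_cvg.
Qed.

(** The defect of m at k is the mass of the trivial path at k, which is null because it is not an
    infinite path. *)
Lemma assoc_wan_harmonic : mu (@wanpaths E) = 1%E -> forall k, step q m k = m k.
Proof.
move=> h1 k; apply/esym.
have h0 : mu [set Fin (fp k [::])] = 0%E.
  apply/eqP; rewrite eq_le measure_ge0 andbT.
  have <- : mu (~` @wanpaths E) = 0%E.
    by rewrite probability_setC ?h1 ?subee //; exact: borel_wanpaths.
  apply: le_measure; rewrite ?inE.
  - exact: borel_set1.
  - exact: measurableC borel_wanpaths.
  by move=> x -> [[y]].
have hl : longer k 1 = cyl k [:: false] `|` cyl k [:: true].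
  apply/seteqP; split=> x; first by move=> [[//|[] [|//]] _ h]; [right|left].
  by move=> []; [exists [:: false]|exists [:: true]].
have := assoc_cyl k; rewrite cyl_split -hl prob_setU; last 3 first.
- exact: borel_set1.
- exact: longer_measurable.
- by apply/seteqP; split=> x // [-> [w /= sw /initial_Fin[_ /size_prefix]]]; rewrite sw.
by rewrite h0 add0e assoc_longer => -[].
Qed.

End AssociatedMeasure.

Lemma mk_prob (R : realType) d (T : measurableType d) (f : set T -> \bar R) :
  f set0 = 0%E -> (forall A, 0 <= f A)%E -> semi_sigma_additive f -> f setT = 1%E ->
  exists P : probability T R, forall A, P A = f A.
Proof.
move=> f0 fge fs f1.
pose m1 := isMeasure.Build d T R f f0 fge fs.
pose mu : {measure set T -> \bar R} := HB.pack f m1.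
have mu1 : (mu : set T -> \bar R) setT = 1%E by [].
pose m2 := @Measure_isProbability.Build d T R mu mu1.
pose P : probability T R := HB.pack f m1 m2.
by exists P.
Qed.

Lemma Fin_fp_inj k w k' w' : Fin (fp k w) = Fin (fp k' w') :> X -> k = k' /\ w = w'.
Proof.
by move=> /(congr1 (fun x : X => if x is Fin u then u else fp 0 [::])) /fp_inj.
Qed.

(** * Atomic measures on the finite paths *)

Section FiniteType.
Variables (R : realType) (beta : R) (m : nat -> R).
Let q := expR (- beta).
Let q0 : 0 < q. Proof. exact: expR_gt0. Qed.
Hypotheses (km : kmsd q m) (tm : transient q m).

(* The mass of a path u ending at v is q^|u| times the defect of m at v. *)
Definition point_mass (k : nat) (w : seq bool) : R :=
  q ^+ size w * (m (k + count id w) - step q m (k + count id w)).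

Let pm_ge0 k w : 0 <= point_mass k w.
Proof. by have [_ _ h] := km; rewrite mulr_ge0 ?exprn_ge0 ?(ltW q0) // subr_ge0. Qed.

Lemma point_mass_sum k : \esum_(w in [set: seq bool]) (point_mass k w)%:E = (m k)%:E.
Proof.
apply: (esum_words (q := q) (d := fun=> 1)) => //.
- exact: ltW.
- by move=> j b w; rewrite /point_mass /= exprS addnA mul1r mulrA.
apply: series_level => [j|j].
  by rewrite /point_mass expr0 !mul1r /= addn0 subrK.
have -> : (fun (m' : nat -> R) l => 1 * step q m' l) = step q.
  by apply/funext => m'; apply/funext => l; rewrite mul1r.
exact: tm.
Qed.

Definition atoms (A : set X) : set (nat * seq bool) := [set kw | A (Fin (fp kw.1 kw.2))].

Definition atomic_measure (A : set (borel_paths E)) : \bar R :=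
  \esum_(kw in atoms A) (point_mass kw.1 kw.2)%:E.

Let pm_ge0E (kw : nat * seq bool) : (0 <= (point_mass kw.1 kw.2)%:E)%E.
Proof. by rewrite lee_fin. Qed.

Lemma atomic_cyl k : atomic_measure (cyl k [::]) = (m k)%:E.
Proof.
rewrite /atomic_measure (_ : atoms _ = pair k @` setT); last first.
  apply/seteqP; split=> [[k' w]|kw [w _ <-]].
    by move=> /initial_Fin[/= <- _]; exists w.
  by apply/initial_Fin; split=> //; exact: prefix0s.
by rewrite esum_image ?point_mass_sum // => x y _ _ [].
Qed.

Lemma atomic_setT : atomic_measure setT = 1%E.
Proof.
rewrite /atomic_measure (_ : atoms _ = \bigcup_(k in [set: nat]) atoms (cyl k [::])); last first.
  apply/seteqP; split=> [[k w] _|//]; exists k => //.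
  by apply/initial_Fin; split=> //; exact: prefix0s.
rewrite esum_bigcupT //; last first.
  apply/trivIsetP => i j _ _ ij; apply/seteqP; split=> [[k w]|//] [] /=.
  by move=> /initial_Fin[ik _] /initial_Fin[jk _]; move: ij; rewrite ik jk eqxx.
have [m0 sm _] := km.
have -> : \esum_(i in [set: nat]) \esum_(j in atoms (cyl i [::])) (point_mass j.1 j.2)%:E =
  \esum_(i in [set: nat]) (m i)%:E by apply: eq_esum => i _; exact: atomic_cyl.
exact/nneseries_EFinP.
Qed.

Lemma atomic_sigma_additive : semi_sigma_additive atomic_measure.
Proof.
move=> F mF tF mUF; rewrite /atomic_measure.
have -> : atoms (\bigcup_n F n) = \bigcup_n atoms (F n).
  by apply/seteqP; split=> kw [n _ h]; exists n.
rewrite esum_bigcupT //; last first.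
  apply/trivIsetP => i j _ _ ij; apply/seteqP; split=> // kw [h1 h2].
  by have := trivIsetP.1 tF i j I I ij; rewrite -subset0 => /(_ _ (conj h1 h2)).
rewrite -nneseries_esumT; last by move=> n; apply: esum_ge0.
apply: is_cvg_nneseries => n _ _; exact: esum_ge0.
Qed.

Lemma transient_Dfin : @Dfin R E beta m.
Proof.
split; first exact/Dkms_kmsd.
have [mu muE] : exists P : probability (borel_paths E) R, forall A, P A = atomic_measure A.
  apply: mk_prob.
  - by rewrite /atomic_measure (_ : atoms _ = set0) ?esum_set0 //; apply/seteqP; split.
  - by move=> A; exact: esum_ge0.
  - exact: atomic_sigma_additive.
  - exact: atomic_setT.
exists mu; last first.
  rewrite muE -atomic_setT /atomic_measure; congr esum.
  by apply/seteqP; split=> // kw _; exists (fp kw.1 kw.2).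
split; first exact: prob_regular.
  by move=> v; rewrite (fnil_fp v) muE; exact: atomic_cyl.
move=> e A mA; rewrite (edge_ray_edge e) rng_ray_edge fnil_fp => sA.
set k := (src e : nat); set b := edge_bit e.
rewrite !muE /atomic_measure (_ : atoms _ = (fun kw => (k, b :: kw.2)) @` atoms A).
  rewrite esum_image; last first.
    move=> [k1 w1] [k2 w2]; rewrite !inE /atoms /= => /sA/initial_Fin[h1 _] /sA/initial_Fin[h2 _].
    by move=> [->]; rewrite -h1 -h2.
  rewrite -ge0_esumZl ?(ltW q0) //.
  apply: eq_esum => -[k1 w1] /sA/initial_Fin[/= <- _].
  by rewrite -EFinM /point_mass /= exprS addnA mulrA.
rewrite xcons_setE; apply/seteqP; split=> [[k1 w1] []|_ [[k1 w1] h <-]].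
- by move=> [w Aw /Fin_fp_inj[/= -> ->]]; exists ((k + b)%N, w).
- by move=> [g _].
- left; exists w1 => //=; have /initial_Fin[/= e1 _] := sA _ h.
  by move: h; rewrite /atoms /= -e1.
Qed.

End FiniteType.

(** * The conservative state at beta = 0 *)

Section Conservative.
Variable R : realType.

Let x0 : X := recpt (0%N, [::]).

(** The measure is the Dirac mass at the infinite loop e_0 e_0 ..., which prefixing by e_0 fixes; at
    beta = 0 the scaling factor is 1. No other edge has the loop in its domain. *)
Lemma loop_Dcon : @Dcon R E 0 (fun k : vert E => ((k : nat) == 0%N)%:R).
Proof.
pose m (k : nat) : R := (k == 0%N)%:R.
have q1 : expR (- (0 : R)) = 1 by rewrite oppr0 expR0.
split.
  apply/Dkms_kmsd; rewrite q1; split=> [k||k]; first exact: ler0n.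
    apply: cvg_near_cst; exists 1%N => // N /= N0; rewrite /series /=.
    by rewrite -(prednK N0) big_nat_recl // big1 ?addr0.
  by rewrite /step mul1r addr0.
pose P := @dirac _ (borel_paths E) x0 R : probability (borel_paths E) R.
have PE (A : set (borel_paths E)) : P A = (x0 \in A)%:R%:E by rewrite /P /= /dirac indicE.
exists P; last first.
  by rewrite PE mem_set //; exact: recpaths_loop.
split; first exact: prob_regular.
  move=> v; rewrite (fnil_fp v) PE; congr ((nat_of_bool _)%:R%:E).
  apply/idP/eqP; first by rewrite inE => /initial_Inf[].
  by move=> v0; rewrite inE v0; apply/initial_Inf.
move=> e A mA; rewrite (edge_ray_edge e) rng_ray_edge fnil_fp => sA.
rewrite q1 mul1e !PE; congr ((nat_of_bool _)%:R%:E).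
set k := (src e : nat) in sA *; set b := edge_bit e in sA *.
rewrite xcons_setE; apply/idP/idP; rewrite !inE.
  move=> [[w _]//|[g Ag]] /(congr1 (fun x : X => if x is Inf y then y else ip 0 (nth false [::]))) /ip_inj.
  move=> [/= k0 gE]; have b0 : b = false by have := congr1 (fun h => h 0%N) gE.
  have gE' : g = nth false [::].
    by apply/funext => i; have := congr1 (fun h => h i.+1) gE; rewrite nth_nil /= nth_nil => <-.
  by move: Ag; rewrite gE' -k0 b0.
move=> Ax; have /initial_Inf[kb _] := sA _ Ax.
have aux (k' : nat) (b' : bool) : (k' + b')%N = 0%N -> k' = 0%N /\ b' = false.
  by case: k' => //; case: b'.
have [k0 b0] := aux _ _ kb.
right; exists (nth false [::]); first by rewrite kb.
rewrite k0 b0 /x0 /recpt /=; congr (Inf (ip _ _)); apply/funext => -[|i] //=.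
by rewrite !nth_nil.
Qed.

(** With q = 1 superharmonicity forces m to vanish at every [k.+1]. *)
Lemma Dkms0 : @Dkms R E 0 = [set @mkms R E 0 (0%N : vert E)].
Proof.
rewrite mkms0; apply/seteqP; split=> m.
  move=> /Dkms_kmsd; rewrite oppr0 expR0 => -[m0 sm hm].
  have mS k : m k.+1 = 0.
    by apply/eqP; rewrite eq_le m0 andbT; have := hm k; rewrite /step mul1r gerDl.
  apply/funext => -[|k]; last by rewrite mS.
  have h : series m @ \oo --> (m 0%N : R).
    apply: cvg_near_cst; exists 1%N => // N /= N0; rewrite /series /=.
    by rewrite -(prednK N0) big_nat_recl // big1 ?addr0.
  exact: (cvg_unique (@Rhausdorff R) h sm).
by move=> ->; have [] := loop_Dcon.
Qed.

End Conservative.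

(** * The dissipative state: Lebesgue measure and digit expansions *)

Section Affine.
Variable R : realType.
Notation leb := (@lebesgue_measure R).

Lemma measure_preimage d d' (T1 : measurableType d) (T2 : measurableType d')
    (nu : {measure set T1 -> \bar R}) (f : T1 -> T2) : measurable_fun setT f ->
  exists nu' : {measure set T2 -> \bar R}, forall A, nu' A = nu (f @^-1` A).
Proof.
move=> mf.
unshelve refine (ex_intro _ (pushforward nu f : {measure set T2 -> \bar R}) _).
  exact: mf.
by [].
Qed.

(** The rescaled image measure agrees with Lebesgue measure on half-open intervals, and these
    determine it. *)
Lemma lebesgue_affine (c s : R) (B : set (measurableTypeR R)) : 0 < s -> measurable B ->
  leb [set x | B ((x - c) / s)] = (s%:E * leb B)%E.
Proof.
move=> s0 mB.
have mg : measurable_fun setT (fun x : measurableTypeR R => (x - c) / s : measurableTypeR R).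
  apply: measurable_funM; last exact: measurable_cst.
  by apply: measurable_funB; [exact: measurable_id|exact: measurable_cst].
have [nu nuE] := measure_preimage leb mg.
have si : 0 <= s^-1 by rewrite invr_ge0 ltW.
pose nu' : {measure set (measurableTypeR R) -> \bar R} := mscale (NngNum si) nu.
have nu'E D : nu' D = (s^-1%:E * leb [set x : R | D ((x - c) / s)%R])%E.
  by rewrite -nuE.
have h : leb B = nu' B.
  apply: lebesgue_measure_unique => // _ [[a b] _ <-]; rewrite nu'E.
  have -> : [set x : R | `]a, b]%classic ((x - c) / s)] = `]c + s * a, c + s * b]%classic.
    apply/seteqP; split=> x /=; rewrite !in_itv /= => /andP[h1 h2].
      by move: h1 h2; rewrite ltr_pdivlMr // ler_pdivrMr // => h1 h2; apply/andP; split; lra.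
    by rewrite ltr_pdivlMr // ler_pdivrMr //; apply/andP; split; lra.
  rewrite !lebesgue_measure_itv /= !lte_fin ltrD2l ltr_pM2l //; case: ifP => _; last by rewrite mule0.
  by rewrite -!EFinB -EFinM; congr EFin; field; rewrite gt_eqF.
rewrite h nu'E.
by rewrite muleA -EFinM divff ?mul1e // gt_eqF.
Qed.

End Affine.

Lemma esum_single (R : realType) (u : nat -> \bar R) k : (forall j, 0 <= u j)%E ->
  (forall j, j <> k -> u j = 0%E) -> (\sum_(j <oo) u j)%E = u k.
Proof.
move=> u0 uk; rewrite nneseries_esumT // (esumID [set k]) // setTI esum_set1 //.
by rewrite setTI esum1 ?adde0 // => j /=; exact: uk.
Qed.

Section DigitMeasure.
Variables (R : realType) (q : R).
Hypotheses (q0 : 0 < q) (q1 : q < 1).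
Notation leb := (@lebesgue_measure R).
Notation RM := (measurableTypeR R).

(* The expansion of a point of [0, 1) in digits with probabilities q and
   1 - q makes the digits independent for Lebesgue measure. *)
Definition shift (x : R) : R := if x < q then x / q else (x - q) / (1 - q).
Definition digit (x : R) (i : nat) : bool := q <= iter i shift x.
Definition digit_path (k : nat) (x : R) : X := Inf (ip k (digit x)).

Lemma affine_measurable (c s : R) : measurable_fun setT (fun x : RM => (x - c) / s : RM).
Proof.
apply: measurable_funM; last exact: measurable_cst.
by apply: measurable_funB; [exact: measurable_id|exact: measurable_cst].
Qed.

Lemma shift_measurable : measurable_fun setT (shift : RM -> RM).
Proof.
apply: measurable_fun_ifT.
- by apply: measurable_fun_ltr; [exact: measurable_id|exact: measurable_cst].
- have := affine_measurable 0 q; by under [X in measurable_fun _ X -> _]eq_fun do rewrite subr0.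
- exact: affine_measurable.
Qed.

Lemma digit_measurable i b : measurable ([set x | digit x i = b] : set RM).
Proof.
have mi : measurable_fun setT (iter i shift : RM -> RM).
  elim: i => [|i IH]; first exact: measurable_id.
  by have := measurableT_comp shift_measurable IH.
have mb : measurable_fun setT (fun x : RM => q <= iter i shift x).
  by apply: measurable_fun_ler => //; exact: measurable_cst.
by have := mb measurableT [set b] I; rewrite setTI.
Qed.

Lemma digit_path_measurable k : measurable_fun setT (digit_path k : RM -> borel_paths E).
Proof.
apply: borel_bas_measurable => k' w.
have [kk|kk] := pselect (k' = k); last first.
  rewrite (_ : _ @^-1` _ = set0) //; apply/seteqP; split=> x //.
  by move=> /initial_Inf[].
rewrite (_ : _ @^-1` _ = \bigcap_i [set x | (i < size w)%N -> digit x i = nth false w i]).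
  apply: bigcapT_measurable => i; case: ltnP => iw.
    rewrite (_ : [set x | _] = [set x | digit x i = nth false w i]); first exact: digit_measurable.
    by apply/seteqP; split=> x h //; exact: h.
  by rewrite (_ : [set x | _] = setT) //; apply/seteqP; split.
rewrite kk; apply/seteqP; split=> x.
  by move=> /initial_Inf[_ h] i _ iw; rewrite /= h nth_mkseq.
move=> h; apply/initial_Inf; split=> //; apply: (@eq_from_nth _ false); rewrite ?size_mkseq // => i iw.
by rewrite nth_mkseq // h.
Qed.

Lemma digit_shift x i : digit (shift x) i = digit x i.+1.
Proof. by rewrite /digit iterSr. Qed.

Let I01 : set RM := `[0, 1[%classic.

Definition branch_start (b : bool) : R := if b then q else 0.
Definition branch_len (b : bool) : R := if b then 1 - q else q.

Lemma branch_len_gt0 b : 0 < branch_len b.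
Proof. by case: b; rewrite /branch_len // subr_gt0. Qed.

(** Where the first digit is b, [shift] is an affine bijection onto [0, 1), and the digits of x are
    b followed by those of its image. *)
Lemma digit_branch k b (A : set X) :
  digit_path k @^-1` (xcons_set (ray_edge k b) A) `&` I01 =
  [set x | (digit_path (k + b) @^-1` A `&` I01) ((x - branch_start b) / branch_len b)].
Proof.
have bl := branch_len_gt0 b.
have hI x : I01 ((x - branch_start b) / branch_len b) <-> I01 x /\ digit x 0 = b.
  have iE (y : R) : I01 y <-> (0 <= y) && (y < 1) by rewrite /I01 /= in_itv.
  have q0' := q0; have q1' := q1.
  rewrite !iE ler_pdivlMr // ltr_pdivrMr // mul0r mul1r /digit /branch_start /branch_len /=.
  case: b {bl}; (split=> [/andP[h1 h2]|[/andP[h1 h2]]]).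
  - have qx : q <= x by lra.
    by split=> //; apply/andP; split; lra.
  - by move=> h3; have {}h3 : q <= x := h3; apply/andP; split; lra.
  - have qx : x < q by lra.
    by split; [apply/andP; split; lra|rewrite leNgt qx].
  - by move=> /negbT; rewrite -ltNge => h3; apply/andP; split; lra.
have hS x : digit x 0 = b -> shift x = (x - branch_start b) / branch_len b.
  rewrite /digit /shift /branch_start /branch_len /=; case: b {bl hI} => h.
    by rewrite ltNge h.
  by rewrite ltNge h /= subr0.
have dE x : digit x 0 = b -> digit x = bcons b (digit ((x - branch_start b) / branch_len b)).
  by move=> h; apply/funext => -[|i] //=; rewrite -hS // digit_shift.
rewrite xcons_setE; apply/seteqP; split=> x /=.
  move=> [[[w _]//|[g Ag e]] Ix].
  have /ip_inj[_ gE] : ip k (digit x) = ip k (bcons b g).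
    by have := congr1 (fun x : X => if x is Inf y then y else ip k g) e.
  have d0 : digit x 0 = b by have := congr1 (fun h => h 0%N) gE.
  split; last exact/hI.
  rewrite /digit_path (_ : digit _ = g) //; apply/funext => i.
  by have := congr1 (fun h => h i.+1) gE; rewrite /= dE.
move=> [Ag /hI[Ix d0]]; split=> //; right.
by exists (digit ((x - branch_start b) / branch_len b)) => //; rewrite /digit_path dE.
Qed.

Lemma I01_measurable : measurable I01. Proof. exact: measurable_itv. Qed.

Definition digit_mass (k : nat) (A : set (borel_paths E)) : \bar R :=
  leb (digit_path k @^-1` A `&` I01).

Lemma digit_preimage_measurable k (A : set (borel_paths E)) : measurable A ->
  measurable (digit_path k @^-1` A `&` I01).
Proof.
move=> mA; apply: measurableI I01_measurable.
by have := digit_path_measurable k measurableT mA; rewrite setTI.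
Qed.

Lemma digit_mass_branch k b (A : set (borel_paths E)) : measurable A ->
  digit_mass k (xcons_set (ray_edge k b) A) = ((branch_len b)%:E * digit_mass (k + b) A)%E.
Proof.
move=> mA; rewrite /digit_mass digit_branch.
apply: lebesgue_affine (branch_len_gt0 b) _; exact: digit_preimage_measurable.
Qed.

Lemma digit_mass_other k j b (A : set (borel_paths E)) : j <> k ->
  digit_mass j (xcons_set (ray_edge k b) A) = 0%E.
Proof.
move=> jk; rewrite /digit_mass (_ : _ `&` _ = set0) ?measure0 //.
rewrite xcons_setE; apply/seteqP; split=> x // [[[w _]//|[g _]]].
by move=> /(congr1 (fun x : X => if x is Inf y then y else ip k g)) /ip_inj[].
Qed.

Lemma digit_mass_cyl k j (A : set (borel_paths E)) : j <> k -> A `<=` cyl k [::] ->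
  digit_mass j A = 0%E.
Proof.
move=> jk sA; rewrite /digit_mass (_ : _ `&` _ = set0) ?measure0 //.
by apply/seteqP; split=> x // [/sA/initial_Inf[/esym]].
Qed.

Lemma digit_mass_full k (A : set (borel_paths E)) :
  (forall g, A (Inf (ip k g))) -> digit_mass k A = 1%E.
Proof.
move=> hA; rewrite /digit_mass (_ : _ `&` _ = I01).
  by rewrite /I01 lebesgue_measure_itv /= lte_fin ltr01 sube0.
by apply/seteqP; split=> x; [case|move=> Ix; split=> //; exact: hA].
Qed.

Lemma digit_mass_measure k : exists nu : {measure set (borel_paths E) -> \bar R},
  forall A, nu A = digit_mass k A.
Proof.
have [nu nuE] := measure_preimage (mrestr leb I01_measurable : {measure set RM -> \bar R})
  (digit_path_measurable k).
by exists nu => A; rewrite nuE.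
Qed.

Hypothesis qh : 1 / 2 < q.
Let r := (1 - q) / q.

(** The reason for the digit probabilities: against the weights [geo], either edge costs exactly a
    factor q, as the scaling of an associated measure demands. *)
Lemma geo_branch k b : geo q k * branch_len b = q * geo q (k + b).
Proof.
have qn : q != 0 by rewrite gt_eqF.
rewrite /geo /branch_len; case: b => /=; last by rewrite addn0 mulrC.
by rewrite addn1 exprS; field.
Qed.

Lemma geo_ge0 k : 0 <= geo q k.
Proof. by have [h _ _] := geo_kmsd q0 q1 qh; exact: h. Qed.

Definition wandering_measure (A : set (borel_paths E)) : \bar R :=
  (\sum_(k <oo) (geo q k)%:E * digit_mass k A)%E.

Let term_ge0 A k : (0 <= (geo q k)%:E * digit_mass k A)%E.
Proof. by rewrite mule_ge0 ?lee_fin ?geo_ge0 // /digit_mass measure_ge0. Qed.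

Lemma wandering_prob : exists P : probability (borel_paths E) R,
  forall A, P A = wandering_measure A.
Proof.
have [nu nuE] := choice digit_mass_measure.
pose nu' := mseries (fun k => mscale (NngNum (geo_ge0 k)) (nu k)) 0.
have e A : nu' A = wandering_measure A.
  by apply: eq_eseriesr => k _; rewrite -nuE.
have [P PE] : exists P : probability (borel_paths E) R, forall A, P A = nu' A.
  apply: mk_prob.
  - exact: measure0.
  - by move=> A; exact: measure_ge0.
  - exact: measure_semi_sigma_additive.
  rewrite e /wandering_measure.
  have -> : (\sum_(k <oo) (geo q k)%:E * digit_mass k setT = \sum_(k <oo) (geo q k)%:E)%E.
    by apply: eq_eseriesr => k _; rewrite digit_mass_full // mule1.
  have [g0 sg _] := geo_kmsd q0 q1 qh.
  rewrite nneseries_esumT; last by move=> k; rewrite lee_fin.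
  exact/nneseries_EFinP.
by exists P => A; rewrite PE e.
Qed.

Variable beta : R.
Hypothesis qE : q = expR (- beta).

Lemma wandering_assoc (P : probability (borel_paths E) R) : (forall A, P A = wandering_measure A) ->
  @assoc_measure R E beta (geo q) P.
Proof.
move=> PE; split; first exact: prob_regular.
  move=> v; rewrite (fnil_fp v) PE /wandering_measure (esum_single (k := (v : nat))) //.
    by rewrite digit_mass_full ?mule1 // => g; apply/initial_Inf.
  by move=> j jv; rewrite (@digit_mass_cyl v) ?mule0.
move=> e A mA; rewrite (edge_ray_edge e) rng_ray_edge fnil_fp => sA.
set k := (src e : nat); set b := edge_bit e.
rewrite !PE /wandering_measure (esum_single (k := k)) //; last first.
  by move=> j jk; rewrite digit_mass_other ?mule0.
rewrite (esum_single (k := (k + b)%N)) //; last first.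
  by move=> j jk; rewrite (digit_mass_cyl jk sA) mule0.
by rewrite digit_mass_branch // -qE !muleA -!EFinM geo_branch.
Qed.

End DigitMeasure.

(** * Recurrent paths are null for beta > 0 *)

Section NullSets.
Variables (R : realType) (beta : R) (m : nat -> R) (mu : probability (borel_paths E) R).
Hypothesis am : @assoc_measure R E beta m mu.
Hypotheses (b0 : 0 < beta) (m1 : forall k, m k <= 1).
Let q := expR (- beta).

Lemma assoc_cyl_le k w : (mu (cyl k w) <= (q ^+ size w)%:E)%E.
Proof.
elim: w k => [|b w IH] k; first by rewrite (assoc_cyl am) lee_fin expr0.
rewrite -xcons_cyl (assoc_xcons am); [|exact: borel_cyl|exact: cyl_sub_nil].
by rewrite /= exprS EFinM; apply: lee_wpmul2l => //; rewrite lee_fin expR_ge0.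
Qed.

Lemma assoc_recpt_null kw : mu [set recpt kw] = 0%E.
Proof.
apply/eqP; rewrite eq_le measure_ge0 andbT.
have h n : (mu [set recpt kw] <= (q ^+ n)%:E)%E.
  apply: (@le_trans _ _ (mu (cyl kw.1 (mkseq (nth false kw.2) n)))).
    apply: le_measure; rewrite ?inE; [exact: borel_set1|exact: borel_cyl|].
    by move=> x ->; apply/initial_Inf; rewrite size_mkseq.
  by apply: le_trans (assoc_cyl_le _ _) _; rewrite size_mkseq.
have cq : (fun n => (q ^+ n)%:E) @ \oo --> (0%:E : \bar R).
  apply/fine_cvgP; split; first exact: nearW.
  by apply: cvg_expr; rewrite ger0_norm ?expR_ge0 // expR_lt1 oppr_lt0.
suff : (mu [set recpt kw] <= 0%:E)%E by [].
rewrite -(cvg_lim (@ereal_hausdorff R) cq).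
by apply: lime_ge; [apply/cvg_ex; eexists; exact: cq|exact: nearW].
Qed.

(** The recurrent paths are countably many, and each lies in cylinders of mass at most q^n for every
    n. *)
Lemma assoc_recpaths_null : mu (@recpaths E) = 0%E.
Proof.
apply/eqP; rewrite eq_le measure_ge0 andbT.
pose G n : set X := if choice.unpickle n is Some kw then [set recpt kw] else set0.
have mG n : measurable (G n : set (borel_paths E)).
  by rewrite /G; case: choice.unpickle => // kw; exact: borel_set1.
apply: (@le_trans _ _ (\sum_(n <oo) mu (G n))%E).
  apply: measure_sigma_subadditive => //; first exact: borel_recpaths.
  move=> x /recpaths_recpt[kw _ <-]; exists (choice.pickle kw) => //.
  by rewrite /G choice.pickleK.
rewrite eseries0 // => n _ _; rewrite /G; case: choice.unpickle => [kw|]; last exact: measure0.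
exact: assoc_recpt_null.
Qed.

End NullSets.

Lemma geo_Ddis (R : realType) (beta : R) : 0 < beta -> 1 / 2 < expR (- beta) ->
  @Ddis R E beta (geo (expR (- beta))).
Proof.
move=> b0 qh; set q := expR (- beta).
have q0 : 0 < q := expR_gt0 _.
have q1 : q < 1 by rewrite expR_lt1 oppr_lt0.
have kg : kmsd q (geo q) := geo_kmsd q0 q1 qh.
have dg : @Dkms R E beta (geo q) by apply/Dkms_kmsd.
split=> //; have [P PE] := wandering_prob q0 q1 qh.
have aP : @assoc_measure R E beta (geo q) P by exact: wandering_assoc.
exists P => //.
have m1 k : geo q k <= 1 by have [h _ _] := dg; have /andP[] := h k.
have rec0 : P (@recpaths E) = 0%E := assoc_recpaths_null aP b0 m1.
have fin0 : P (@finpaths E) = 0%E.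
  rewrite PE /wandering_measure eseries0 // => k _ _; rewrite /digit_mass.
  rewrite (_ : _ `&` _ = set0) ?measure0 ?mule0 //.
  by apply/seteqP; split=> x // [[u]].
have e : @wanpaths E = ~` (@finpaths E `|` @recpaths E).
  by rewrite /wanpaths -finpathsC setCU setDE.
rewrite e probability_setC; last exact: measurableU borel_finpaths borel_recpaths.
suff -> : P (@finpaths E `|` @recpaths E) = 0%E by rewrite sube0.
apply/eqP; rewrite eq_le measure_ge0 andbT -[leRHS]adde0 -{1}fin0 -rec0.
exact: measureU2 borel_finpaths borel_recpaths.
Qed.

(** * The simplices of KMS and ground states *)

Section GroundStates.
Variable R : realType.

Definition dist (m : nat -> R) : Prop := (forall k, 0 <= m k) /\ series m @ \oo --> (1 : R).

Lemma dist_le1 m : dist m -> forall k, m k <= 1.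
Proof. by move=> [m0 sm] k; exact: term_le_sum m0 sm. Qed.

Lemma Dgr_dist (m : vert E -> R) : @Dgr R E m <-> dist m.
Proof.
split=> [[mb /nneseries_EFinP sm]|[m0 sm]].
  by split=> [k|]; [have /andP[] := mb k|apply: sm => k; have /andP[] := mb k].
split=> [v|]; first by rewrite m0 dist_le1.
exact/nneseries_EFinP.
Qed.

Lemma mgr_dist n : dist (@mgr R E n).
Proof.
split=> [k|]; first exact: ler0n.
apply: cvg_near_cst; exists n.+1 => // N /= nN; rewrite /series /= /mgr.
rewrite (bigD1_seq n) ?iota_uniq ?mem_index_iota //= eqxx big1 ?addr0 // => i /negbTE.
by move=> ->.
Qed.

(** Off n two nonnegative terms add up to 0, so x vanishes there and lies below [mgr n]; equal
    masses give equality. *)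
Lemma mgr_extreme n (x y : nat -> R) (t : R) : dist x -> dist y -> 0 < t < 1 ->
  @mgr R E n = (fun k => t * x k + (1 - t) * y k) -> x = @mgr R E n.
Proof.
move=> dx [y0 _] /andP[t0 t1] e; have [x0 sx] := dx; have [_ sn] := mgr_dist n.
apply: sum1_ge_eq => // k; have [->|kn] := eqVneq k n.
  by rewrite {1}/mgr eqxx dist_le1.
have /eqP := congr1 (fun f => f k) e; rewrite /= /mgr (negbTE kn) eq_sym.
have p1 : 0 <= t * x k by rewrite mulr_ge0 // ltW.
have p2 : 0 <= (1 - t) * y k by rewrite mulr_ge0 // subr_ge0 ltW.
by rewrite paddr_eq0 // => /andP[]; rewrite mulf_eq0 (gt_eqF t0) /= => /eqP ->.
Qed.

Lemma extreme_Dgr : extreme (@Dgr R E) = [set @mgr R E n | n in [set: nat]].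
Proof.
apply/seteqP; split=> m; last first.
  move=> [n _ <-]; split; first exact/Dgr_dist/mgr_dist.
  move=> x y t /Dgr_dist dx /Dgr_dist dy t01 e.
  split; first exact: mgr_extreme dx dy t01 e.
  apply: (mgr_extreme (t := 1 - t) dy dx); first by rewrite subr_gt0 gtrBl andbC.
  by rewrite e; apply/funext => k; rewrite subKr addrC.
move=> [/Dgr_dist dm ext]; have [m0 sm] := dm.
have [n mn] : exists n, 0 < m n.
  apply: contrapT => /forallNP h.
  have e : series m = (fun=> 0).
    apply/funext => N; rewrite /series /= big1 // => i _.
    by apply/eqP; rewrite eq_le m0 andbT leNgt; apply/negP; exact: h.
  rewrite e in sm; move/(cvg_lim (@Rhausdorff R)): sm; rewrite lim_cst // => /eqP.
  by rewrite eq_sym oner_eq0.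
exists n => //; have [_ sn] := mgr_dist n.
have [mn1|mn1] := eqVneq (m n) 1.
  apply: sum1_ge_eq => // k; rewrite /mgr; case: eqP => [->|_]; last exact: m0.
  by rewrite mn1.
have lt1 : m n < 1 by rewrite lt_neqAle mn1 dist_le1.
have c0 : 0 < 1 - m n by rewrite subr_gt0.
have cn : 1 - m n != 0 by rewrite gt_eqF.
(* The rest of m after removing its atom at n, renormalised; extremality then forces [mgr n] to be
   m. *)
pose x k := (1 - m n)^-1 * (m k + - m n * @mgr R E n k).
have dx : dist x.
  split=> [k|].
    rewrite mulr_ge0 ?invr_ge0 ?(ltW c0) // /mgr.
    by case: eqP => [->|_]; rewrite ?mulr1 ?subrr // mulr0 addr0.
  rewrite -[X in _ --> X](mulVf cn); apply: series_scale.
  by have := series_add sm (series_scale (c := - m n) sn); rewrite mulr1.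
have [] // := ext (@mgr R E n) x (m n).
- exact/Dgr_dist/mgr_dist.
- exact/Dgr_dist.
- exact/andP.
- by apply/funext => k; rewrite /x mulVKf // mulNr addrC subrK.
Qed.

End GroundStates.

(** * Classification for beta > 0 *)

Section Positive.
Variables (R : realType) (beta : R).
Hypothesis b0 : 0 < beta.
Let q := expR (- beta).
Let q0 : 0 < q. Proof. exact: expR_gt0. Qed.
Let q1 : q < 1. Proof. by rewrite /q expR_lt1 oppr_lt0. Qed.

Lemma Dfin_fin_set : @Dfin R E beta = fin_set q.
Proof.
apply/seteqP; split=> m.
  move=> [/Dkms_kmsd km [mu am h]]; split=> //.
  exact: assoc_fin_transient am h.
by move=> [km tm]; exact: transient_Dfin.
Qed.

Lemma extreme_Dfin : extreme (@Dfin R E beta) = [set @mkms R E beta n | n in [set: nat]].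
Proof.
rewrite Dfin_fin_set extreme_fin //.
by apply/seteqP; split=> m [n _ <-]; exists n; rewrite // mkms_mun.
Qed.

Lemma minf_geo : minf beta = geo q.
Proof.
have qn : q != 0 by rewrite gt_eqF.
have qn1 : 1 - q != 0 by rewrite gt_eqF // subr_gt0.
apply/funext => k; rewrite /minf /geo -/q -exprVn invf_div exprS.
by set t := _ ^+ k; field; rewrite qn qn1.
Qed.

Section Dissipative.
Hypothesis qh : 1 / 2 < q.

Lemma Ddis_geo : @Ddis R E beta = [set geo q].
Proof.
apply/seteqP; split=> m; last by move=> ->; exact: geo_Ddis.
move=> [/Dkms_kmsd km [mu am h]].
exact: (harmonic_kmsd q0 q1 qh km (assoc_wan_harmonic am h)).
Qed.

Lemma Dkms_hull : @Dkms R E beta = convex_hull (@Dfin R E beta `|` @Ddis R E beta).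
Proof.
rewrite Dfin_fin_set Ddis_geo; apply/seteqP; split=> m.
  move=> /Dkms_kmsd /(kmsd_decomp q0 q1 qh)[t [m' [/andP[t0 t1] fm' ->]]].
  exists 2, (fun i => if i == ord0 then t else 1 - t), (fun i => if i == ord0 then geo q else m').
  split=> [i|i||]; last first.
  - by apply/funext => k; rewrite !big_ord_recl big_ord0 /= addr0.
  - by rewrite !big_ord_recl big_ord0 /= addr0 addrC subrK.
  - by case: ifP; [right|left].
  - by case: ifP; rewrite // subr_ge0.
move=> [n [c [x [c0 hx c1 ->]]]]; apply/Dkms_kmsd; apply: kmsd_convex => // i.
by case: (hx i) => [[]//|->]; exact: geo_kmsd.
Qed.

Lemma Dfin_Ddis_disjoint : @Dfin R E beta `&` @Ddis R E beta = set0.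
Proof.
rewrite Dfin_fin_set Ddis_geo; apply/seteqP; split=> // m [[_ tm] /= e].
by rewrite e in tm; have := geo_not_transient q0 qh tm.
Qed.

End Dissipative.

Lemma Dkms_Dfin : q <= 1 / 2 -> @Dkms R E beta = @Dfin R E beta.
Proof.
move=> qh; rewrite Dfin_fin_set; apply/seteqP; split=> m.
  by move=> /Dkms_kmsd km; split=> //; exact: kmsd_transient qh km.
by move=> [km _]; exact/Dkms_kmsd.
Qed.

End Positive.

Theorem theorem7p5 (R : realType) (A : cstarAlg R)
    (s : edge loop_ray -> A) (p : vert loop_ray -> A)
    (hA : toeplitz_algebra s p)
    (sigma : R -> A -> A) (hsigma : gauge_dynamics s p sigma) :
  [/\ (* (1) *)
      @Dkms R loop_ray 0 = [set @mkms R loop_ray 0 0%N] /\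
      Dcon 0 (@mkms R loop_ray 0 0%N),
      (* (2) *)
      (forall beta : R, 0 < beta < ln 2 ->
         [/\ @Dkms R loop_ray beta =
               convex_hull (@Dfin R loop_ray beta `|` @Ddis R loop_ray beta),
             @Dfin R loop_ray beta `&` @Ddis R loop_ray beta = set0,
             extreme (@Dfin R loop_ray beta) =
               [set @mkms R loop_ray beta n | n in [set: nat]] &
             @Ddis R loop_ray beta = [set minf beta]]),
      (* (3) *)
      (forall beta : R, ln 2 <= beta ->
         @Dkms R loop_ray beta = @Dfin R loop_ray beta /\
         extreme (@Dkms R loop_ray beta) =
           [set @mkms R loop_ray beta n | n in [set: nat]]) &
      (* (4) *)
      extreme (@Dgr R loop_ray) =
        [set @mgr R loop_ray n | n in [set: nat]] /\
      (forall psi : {scalar A},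
         ground_state sigma psi -> kms_infty_state sigma psi)].
Proof.
have qE : expR (- ln 2) = 1 / 2 :> R by rewrite -lnV ?posrE // lnK ?posrE ?invr_gt0 // div1r.
split.
- by split; [exact: Dkms0|rewrite mkms0; exact: loop_Dcon].
- move=> beta /andP[b0 bl].
  have qh : 1 / 2 < expR (- beta) by rewrite -qE ltr_expR ltrN2.
  split; [exact: Dkms_hull|exact: Dfin_Ddis_disjoint|exact: extreme_Dfin|].
  by rewrite Ddis_geo // minf_geo.
- move=> beta lb.
  have b0 : 0 < beta by apply: lt_le_trans lb; rewrite ln_gt0 ?ltr1n.
  have qh : expR (- beta) <= 1 / 2 by rewrite -qE ler_expR lerN2.
  by rewrite Dkms_Dfin // extreme_Dfin.
- by split; [exact: extreme_Dgr|move=> psi hpsi; exact: (ground_kms_infty hA hsigma hpsi)].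
Qed.
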